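(* Let $n\geq 2$ and $k\geq 0$. Let $\mathcal{A}$ be the quotient of the free graded commutative $\mathbb{Z}$-algebra on generators $\{\alpha_{ab}\}_{1\leq a\neq b\leq k}$ of degree $n-1$ by the ideal generated by the elements $$\alpha_{ab}+(-1)^{n+1}\alpha_{ba},\qquad \alpha_{ab}^2,\qquad \alpha_{ab}\alpha_{bc}+\alpha_{bc}\alpha_{ca}+\alpha_{ca}\alpha_{ab}$$ (for all distinct indices $a,b$, respectively $a,b,c$, in $\{1,\ldots,k\}$). Then the natural map of graded commutative algebras $$\mathcal{A}\to H^*(\mathrm{Conf}_k(\mathbb{R}^n);\mathbb{Z}),$$ sending $\alpha_{ab}$ to the pullback of the standard generator of $H^{n-1}(S^{n-1};\mathbb{Z})$ along the Gauss map $\gamma_{ab}$, is (well defined and) an isomorphism.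
   Context: $\mathrm{Conf}_k(\mathbb{R}^n)=\{(x_1,\ldots,x_k)\in(\mathbb{R}^n)^k: x_i\neq x_j\text{ if }i\neq j\}$ with the subspace topology. For $1\leq a\neq b\leq k$, the Gauss map $\gamma_{ab}:\mathrm{Conf}_k(\mathbb{R}^n)\to S^{n-1}$ is $\gamma_{ab}(x_1,\ldots,x_k)=\frac{x_b-x_a}{\|x_b-x_a\|}$. The standard generator of $H^{n-1}(S^{n-1};\mathbb{Z})$ is the class of the standard (normalized) volume form. *)

(* Defs.v *)
From HB Require Import structures.
From mathcomp Require Import all_boot all_order all_algebra.
From mathcomp Require Import generic_quotient ring_quotient.
From mathcomp.multinomials Require Import -(notations) monalg.
From mathcomp Require Import all_classical all_reals.
From mathcomp Require Import topology normedtype realfun.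
From mathcomp Require Import zify ring.

Set Implicit Arguments.
Unset Strict Implicit.
Unset Printing Implicit Defensive.

Import Order.TTheory GRing.Theory Num.Theory numFieldNormedType.Exports.

Local Open Scope classical_set_scope.
Local Open Scope quotient_scope.
Local Open Scope ring_scope.

Section TwoSidedIdeals.
Variable R : pzRingType.

Definition ideal_closed (I : set R) : Prop :=
  [/\ I 0, forall x y, I x -> I y -> I (x - y),
      forall r x, I x -> I (r * x) & forall r x, I x -> I (x * r)].

Record ideal := Ideal { ideal_set :> set R; idealP : ideal_closed ideal_set }.

Lemma gen_ideal_closed (G : set R) : ideal_closed (smallest ideal_closed G).
Proof.
split=> [I [[]]//|x y Ix Iy I IG|r x Ix I IG|r x Ix I IG].
- by have [[_ + _ _] _] := IG; apply; [exact: Ix|exact: Iy].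
- by have [[_ _ + _] _] := IG; apply; exact: Ix.
- by have [[_ _ _ +] _] := IG; apply; exact: Ix.
Qed.

Definition gen_ideal (G : set R) : ideal := Ideal (gen_ideal_closed G).

End TwoSidedIdeals.

Section QuotientRing.
Variables (R : pzRingType) (I : ideal R).

Definition ideal_pred : {pred R} := [pred x | x \in ideal_set I].

Lemma ideal_pred_zmod_closed : zmod_closed ideal_pred.
Proof.
have [I0 IB _ _] := idealP I.
by split=> [|x y]; rewrite !inE //; exact: IB.
Qed.
HB.instance Definition _ := GRing.isZmodClosed.Build R ideal_pred
  ideal_pred_zmod_closed.

(* The library equips [Quotient.quot] with a ring structure only over
   commutative rings. *)
Definition qring : Type := Quotient.quot ideal_pred.
HB.instance Definition _ := GRing.Zmodule.on qring.
HB.instance Definition _ := EqQuotient.on qring.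

Definition qring_one : qring := \pi_qring 1.
Definition qring_mul := lift_op2 qring *%R.

Lemma qring_eqP (x y : R) : \pi_qring x = \pi_qring y <-> ideal_set I (x - y).
Proof.
have e : (x - y \in ideal_pred) = (\pi_qring x == \pi_qring y).
  exact: (Quotient.idealrBE ideal_pred).
split=> [/eqP|Ixy]; first by rewrite -e !inE.
by apply/eqP; rewrite -e !inE.
Qed.

Lemma qring_mulE (x y : R) :
  qring_mul (\pi_qring x) (\pi_qring y) = \pi_qring (x * y).
Proof.
have [_ IB Il Ir] := idealP I.
have r (z : R) : ideal_set I (repr (\pi_qring z) - z) by apply/qring_eqP; rewrite reprK.
unlock qring_mul; apply/qring_eqP.
set x' := repr _; set y' := repr _.
have -> : x' * y' - x * y = x' * (y' - y) - (x - x') * y.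
  by rewrite mulrBr mulrBl opprB addrA subrK.
apply: (IB); [apply: (Il); exact: r|apply: (Ir)].
by rewrite -opprB -[- _]add0r; apply: IB; [case: (idealP I)|exact: r].
Qed.

Lemma qring_addE (x y : R) : \pi_qring x + \pi_qring y = \pi_qring (x + y).
Proof. exact/esym/(raddfD (\pi_(Quotient.quot ideal_pred))). Qed.

Lemma qring_mulA : associative qring_mul.
Proof.
by move=> x y z; rewrite -[x]reprK -[y]reprK -[z]reprK !qring_mulE mulrA.
Qed.

Lemma qring_mul1 : left_id qring_one qring_mul.
Proof. by move=> x; rewrite -[x]reprK /qring_one qring_mulE mul1r. Qed.

Lemma qring_mulr1 : right_id qring_one qring_mul.
Proof. by move=> x; rewrite -[x]reprK /qring_one qring_mulE mulr1. Qed.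

Lemma qring_mulDl : left_distributive qring_mul +%R.
Proof.
move=> x y z; rewrite -[x]reprK -[y]reprK -[z]reprK.
by rewrite qring_addE !qring_mulE qring_addE mulrDl.
Qed.

Lemma qring_mulDr : right_distributive qring_mul +%R.
Proof.
move=> x y z; rewrite -[x]reprK -[y]reprK -[z]reprK.
by rewrite qring_addE !qring_mulE qring_addE mulrDr.
Qed.

HB.instance Definition _ := GRing.Zmodule_isPzRing.Build qring
  qring_mulA qring_mul1 qring_mulr1 qring_mulDl qring_mulDr.

Definition qproj (x : R) : qring := \pi_qring x.

Lemma qproj_zmod_morphism : zmod_morphism qproj.
Proof. exact: (raddfB (\pi_(Quotient.quot ideal_pred))). Qed.
HB.instance Definition _ := GRing.isZmodMorphism.Build R qring qproj
  qproj_zmod_morphism.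

Lemma qproj_monoid_morphism : monoid_morphism qproj.
Proof. by split=> // x y; rewrite /qproj -qring_mulE. Qed.
HB.instance Definition _ := GRing.isMonoidMorphism.Build R qring qproj
  qproj_monoid_morphism.

End QuotientRing.

Section ContinuityHelpers.
Variables (R : realType) (T : topologicalType).

Lemma continuous_entries m n (f : T -> 'M[R]_(m, n)) :
  (forall i j, continuous (fun x => f x i j)) -> continuous f.
Proof.
move=> cf x A [P Pf sPA].
have h i j : \forall y \near x, P i j (f y i j) by apply: (cf i j x); exact: Pf.
have : \forall y \near x, forall ij : 'I_m * 'I_n, P ij.1 ij.2 (f y ij.1 ij.2).
  by apply: filter_forall => -[i j]; exact: h.
by apply: filterS => y Py; apply: sPA => i j; exact: (Py (i, j)).
Qed.

Lemma continuous_to_set (U : topologicalType) (A : set U) (f : T -> A) :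
  continuous (fun x => val (f x)) -> continuous f.
Proof. by move=> cf; apply: continuous_comp_initial. Qed.

Lemma continuous_sumr (I : Type) (r : seq I) (P : pred I) (F : I -> T -> R) :
  (forall i, P i -> continuous (F i)) ->
  continuous (fun x => \sum_(i <- r | P i) F i x).
Proof. by apply: continuous_big; exact: add_continuous. Qed.

End ContinuityHelpers.

Lemma continuous_val_entry (R : realType) m n (A : set 'M[R]_(m, n)) i j :
  continuous (fun x : A => val x i j).
Proof.
move=> x; apply: (@continuous_comp _ _ _ (fun x : A => val x)
  (fun M : 'M[R]_(m, n) => M i j)).
  exact: initial_continuous.
exact: coord_continuous.
Qed.

Section StandardSimplex.
Variable R : realType.

Definition stdsimplex (d : nat) : set 'rV[R]_d.+1 :=
  [set t | (forall i, 0 <= t 0 i) /\ \sum_i t 0 i = 1].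
Arguments stdsimplex : clear implicits.

Section VertexMap.
Variables (p q : nat) (g : 'I_p.+1 -> 'I_q.+1).

Definition vertex_row (t : 'rV[R]_p.+1) : 'rV[R]_q.+1 :=
  \row_j \sum_(i | g i == j) t 0 i.

Lemma vertex_row_simplex (t : stdsimplex p) : vertex_row (val t) \in stdsimplex q.
Proof.
have /set_mem[t0 t1] := valP t; apply/mem_set; split.
  by move=> j; rewrite mxE; apply: sumr_ge0 => i _; exact: t0.
under eq_bigr do rewrite mxE.
by rewrite -t1 [RHS](partition_big g predT).
Qed.

(* The affine map sending the vertex [i] to the vertex [g i]. *)
Definition vertex_map_fun (t : stdsimplex p) : stdsimplex q :=
  SigSub (vertex_row_simplex t).

Lemma vertex_map_continuous : continuous vertex_map_fun.
Proof.
apply: continuous_to_set; apply: continuous_entries => i j /=.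
under eq_fun do rewrite mxE.
by apply: continuous_sumr => l _; exact: continuous_val_entry.
Qed.

Definition vertex_map : continuousType (stdsimplex p) (stdsimplex q) :=
  mkcts vertex_map_continuous.

End VertexMap.
End StandardSimplex.
Arguments stdsimplex : clear implicits.
Arguments vertex_map {R p q} g.

Section SingularCochains.
Variables (R : realType) (X : topologicalType).

Definition simplex (d : nat) : Type := continuousType (stdsimplex R d) X.

Definition restr d e (s : simplex d) (g : 'I_e.+1 -> 'I_d.+1) : simplex e :=
  s \o vertex_map g.

Definition face d (s : simplex d.+1) (i : 'I_d.+2) : simplex d :=
  restr s (lift i).

(* The front [i]-face and the back [(d - i)]-face. *)
Definition front d (s : simplex d) (i : 'I_d.+1) : simplex i :=
  restr s (fun j => inord j).

Definition back d (s : simplex d) (i : 'I_d.+1) : simplex (d - i)%N :=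
  restr s (fun j => inord (i + j)%N).

Lemma restr_id d (s : simplex d) (g : 'I_d.+1 -> 'I_d.+1) :
  g =1 id -> restr s g = s.
Proof.
move=> gid; apply/continuousEP => t; rewrite /restr /=; congr (s _).
apply/val_inj/rowP => j /=; rewrite mxE.
under eq_bigl do rewrite gid.
by rewrite big_pred1_eq.
Qed.

Lemma eq_restr d e (s : simplex d) (g h : 'I_e.+1 -> 'I_d.+1) :
  g =1 h -> restr s g = restr s h.
Proof. by move=> /funext ->. Qed.

Lemma restr_comp d e f (s : simplex d) (g : 'I_e.+1 -> 'I_d.+1)
    (h : 'I_f.+1 -> 'I_e.+1) :
  restr (restr s g) h = restr s (g \o h).
Proof.
apply/continuousEP => t; rewrite /restr /=; congr (s _).
apply/val_inj/rowP => j /=; rewrite !mxE.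
under eq_bigr do rewrite mxE.
rewrite [RHS](partition_big h (fun i => g i == j)) //=.
apply: eq_bigr => i /eqP gi; apply: eq_bigl => l.
by case: (h l =P i) => [->|]; rewrite ?gi ?eqxx ?andbF.
Qed.

Definition bounded_cochain : {pred {d & simplex d} -> int} :=
  [pred c | `[< exists N, forall d (s : simplex d),
                  (N <= d)%N -> c (existT _ d s) = 0 >]].

(* An element of the direct sum over [d] of the groups of integral singular
   [d]-cochains. *)
Record cochain := Cochain {
  cochain_val : {d & simplex d} -> int;
  _ : cochain_val \in bounded_cochain }.

HB.instance Definition _ := [isSub for cochain_val].
HB.instance Definition _ := [Choice of cochain by <:].

Lemma bounded_cochain_zmod_closed : zmod_closed bounded_cochain.
Proof.
split=> [|c c']; rewrite !inE; first by exists 0%N.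
move=> [N cN] [M cM]; exists (N + M)%N => d s h.
by rewrite !fctE cN ?cM ?subrr// (leq_trans _ h) ?leq_addl ?leq_addr.
Qed.
HB.instance Definition _ := GRing.isZmodClosed.Build _ bounded_cochain
  bounded_cochain_zmod_closed.
HB.instance Definition _ := [SubChoice_isSubZmodule of cochain by <:].

Definition cochain_at (c : cochain) d (s : simplex d) : int :=
  cochain_val c (existT _ d s).
Coercion cochain_at : cochain >-> Funclass.

Lemma cochainP (c c' : cochain) : (forall d (s : simplex d), c d s = c' d s) <-> c = c'.
Proof.
by split=> [h|->//]; apply/val_inj/funext => -[d s]; exact: h.
Qed.

Lemma cochain_boundP (c : cochain) :
  exists N, forall d (s : simplex d), (N <= d)%N -> c d s = 0.
Proof. by have /asboolP := valP c. Qed.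

Definition mk_cochain (f : forall d, simplex d -> int)
    (fN : exists N, forall d s, (N <= d)%N -> f d s = 0) : cochain :=
  @Cochain (fun ds => f (projT1 ds) (projT2 ds)) (asboolT fN).

Lemma cochainD (c c' : cochain) d (s : simplex d) : (c + c') d s = c d s + c' d s.
Proof. by []. Qed.

Lemma cochainN (c : cochain) d (s : simplex d) : (- c) d s = - c d s.
Proof. by []. Qed.

Lemma cochain0 d (s : simplex d) : (0 : cochain) d s = 0.
Proof. by []. Qed.

Definition coboundary_at (c : cochain) d : simplex d -> int :=
  if d is d'.+1 then fun s => \sum_(i < d'.+2) (-1) ^+ i * c d' (face s i)
  else fun=> 0.

Lemma coboundary_bound (c : cochain) :
  exists N, forall d s, (N <= d)%N -> @coboundary_at c d s = 0.
Proof.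
have [N cN] := cochain_boundP c; exists N.+1 => -[//|d] s Nd /=.
by apply: big1 => i _; rewrite cN ?mulr0.
Qed.

Definition coboundary (c : cochain) : cochain := mk_cochain (coboundary_bound c).

(* The Alexander-Whitney product. *)
Definition cup_at (c c' : cochain) d (s : simplex d) : int :=
  \sum_(i < d.+1) c i (front s i) * c' (d - i)%N (back s i).

Lemma cup_bound (c c' : cochain) :
  exists N, forall d s, (N <= d)%N -> @cup_at c c' d s = 0.
Proof.
have [N cN] := cochain_boundP c; have [M cM] := cochain_boundP c'.
exists (N + M)%N => d s NMd; apply: big1 => i _.
have [Ni|iN] := leqP N i; first by rewrite cN ?mul0r.
rewrite cM ?mulr0// leq_subRL; last by rewrite -ltnS ltn_ord.
by rewrite (leq_trans _ NMd)// leq_add2r ltnW.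
Qed.

Definition cup (c c' : cochain) : cochain := mk_cochain (cup_bound c c').

Lemma cochain1_bound : exists N, forall d (s : simplex d),
  (N <= d)%N -> (d == 0%N)%:Z = 0.
Proof. by exists 1%N => -[]. Qed.

Definition cochain1 : cochain := mk_cochain cochain1_bound.

(* The value of [c] on the image of [s] under the vertex map [g]; auxiliary to
   the proofs below. *)
Definition subeval (c : cochain) d (s : simplex d) p (g : nat -> nat) : int :=
  c p (restr s (fun j => inord (g j))).

Lemma eq_subeval c d (s : simplex d) p g h :
  (forall j, (j <= p)%N -> g j = h j) -> subeval c s p g = subeval c s p h.
Proof.
move=> gh; rewrite /subeval; congr (c _ _); apply: eq_restr => j.
by rewrite gh // -ltnS.
Qed.

Lemma subeval_comp c d e (s : simplex d) (h : nat -> nat) p g :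
  (forall j, (j <= p)%N -> (g j <= e)%N) ->
  subeval c (restr s (fun j : 'I_e.+1 => inord (h j))) p g = subeval c s p (h \o g).
Proof.
move=> ge; rewrite /subeval restr_comp; congr (c _ _); apply: eq_restr => j.
by rewrite /= inordK // ltnS ge // -ltnS.
Qed.

Lemma subeval_id (c : cochain) d (s : simplex d) : subeval c s d id = c d s.
Proof. by rewrite /subeval restr_id // => j; rewrite inord_val. Qed.

Lemma cupE c c' d (s : simplex d) :
  cup c c' d s = \sum_(0 <= i < d.+1) subeval c s i id * subeval c' s (d - i) (addn i).
Proof. by rewrite big_mkord. Qed.

Lemma coboundaryE c d (s : simplex d.+1) :
  coboundary c d.+1 s = \sum_(0 <= i < d.+2) (-1) ^+ i * subeval c s d (bump i).
Proof.
rewrite big_mkord; apply: eq_bigr => i _; congr (_ * c _ _).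
by apply: eq_restr => j; apply: val_inj; rewrite /= inordK // (ltn_ord (lift i j)).
Qed.

Lemma subeval_cup c c' d (s : simplex d) p g :
  subeval (cup c c') s p g =
  \sum_(0 <= i < p.+1) subeval c s i g * subeval c' s (p - i) (g \o addn i).
Proof.
rewrite /subeval cupE; apply: eq_big_nat => i /andP[_ ip].
by rewrite !subeval_comp; [|lia..].
Qed.

Lemma subeval_coboundary c d (s : simplex d) p g :
  subeval (coboundary c) s p.+1 g =
  \sum_(0 <= i < p.+2) (-1) ^+ i * subeval c s p (g \o bump i).
Proof.
rewrite /subeval coboundaryE; apply: eq_big_nat => i /andP[_ ip].
by rewrite subeval_comp // => j jp; rewrite /bump; lia.
Qed.

Lemma cup1l : left_id cochain1 cup.
Proof.
move=> c; apply/cochainP => d s; rewrite cupE big_nat_recl // big1 => [|i _].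
  rewrite addr0 subn0 (_ : subeval cochain1 s 0%N id = 1)// mul1r -[RHS]subeval_id.
  exact: eq_subeval.
by rewrite (_ : subeval cochain1 s i.+1 id = 0)// mul0r.
Qed.

Lemma cup1r : right_id cochain1 cup.
Proof.
move=> c; apply/cochainP => d s; rewrite cupE big_nat_recr // big1_seq /=.
  by rewrite add0r subnn mulr1 subeval_id.
move=> i; rewrite mem_index_iota => /andP[_ ltid].
by rewrite subn_eq0 leqNgt ltid mulr0.
Qed.

Lemma cupDl : left_distributive cup +%R.
Proof.
move=> c1 c2 c3; apply/cochainP => d s; rewrite cochainD !cupE -big_split /=.
by apply: eq_bigr => i _; rewrite -mulrDl.
Qed.

Lemma cupDr : right_distributive cup +%R.
Proof.
move=> c1 c2 c3; apply/cochainP => d s; rewrite cochainD !cupE -big_split /=.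
by apply: eq_bigr => i _; rewrite -mulrDr.
Qed.

Lemma cupA : associative cup.
Proof.
move=> c1 c2 c3; apply/cochainP => d s; rewrite !cupE.
pose F j i := subeval c1 s j id * subeval c2 s (i - j) (addn j) * subeval c3 s (d - i) (addn i).
transitivity (\sum_(0 <= j < d.+1) \sum_(j <= i < d.+1) F j i).
  apply: eq_big_nat => j /andP[_ jd]; rewrite subeval_cup mulr_sumr.
  rewrite -[X in _ = \sum_(X <= _ < _) _]add0n big_addn subSn //.
  apply: eq_big_nat => l /andP[_ ld].
  rewrite mulrA /F addnK -subnDA addnC; congr (_ * _).
  by apply: eq_subeval => m _ /=; lia.
transitivity (\sum_(0 <= i < d.+1) \sum_(0 <= j < i.+1) F j i); last first.
  by apply: eq_big_nat => i /andP[_ id]; rewrite subeval_cup mulr_suml.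
transitivity (\sum_(0 <= j < d.+1) \sum_(0 <= i < d.+1 | (j <= i)%N) F j i).
  by apply: eq_bigr => j _; rewrite (big_nat_widenl _ 0).
rewrite (exchange_big_dep_nat xpredT) //=; apply: eq_big_nat => i /andP[_ ilt].
by rewrite [RHS](big_nat_widen _ _ d.+1).
Qed.

HB.instance Definition _ := GRing.Zmodule_isPzRing.Build cochain
  cupA cup1l cup1r cupDl cupDr.

Lemma coboundary_zmod_morphism : zmod_morphism coboundary.
Proof.
move=> c c'; apply/cochainP => -[|d] s; first by rewrite cochainD cochainN subrr.
rewrite cochainD cochainN !coboundaryE -sumrB; apply: eq_bigr => i _.
by rewrite -mulrBr.
Qed.
HB.instance Definition _ := GRing.isZmodMorphism.Build cochain cochain coboundary
  coboundary_zmod_morphism.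

Lemma coboundaryK c : coboundary (coboundary c) = 0.
Proof.
apply/cochainP => -[//|[|d]] s.
  by rewrite coboundaryE big1 // => i _; rewrite mulr0.
rewrite coboundaryE.
pose F i j := subeval c s d (bump i \o bump j).
pose G i j := (-1) ^+ (i + j) * F i j.
have -> : \sum_(0 <= i < d.+3) (-1) ^+ i * subeval (coboundary c) s d.+1 (bump i) =
    \sum_(0 <= i < d.+3) \sum_(0 <= j < d.+2) G i j.
  apply: eq_big_nat => i _; rewrite subeval_coboundary mulr_sumr.
  by apply: eq_big_nat => j _; rewrite mulrA -exprD.
have FE i j : (i <= j)%N -> F i j = F j.+1 i.
  by move=> ij; apply: eq_subeval => m _ /=; rewrite /bump; lia.
transitivity (\sum_(0 <= i < d.+3) \sum_(0 <= j < d.+2 | (i <= j)%N) G i j +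
    \sum_(0 <= i < d.+3) \sum_(0 <= j < d.+2 | ~~ (i <= j)%N) G i j).
  rewrite -[RHS]big_split /=; apply: eq_bigr => i _.
  by rewrite (bigID (fun j => (i <= j)%N)).
rewrite big_nat_recr //= [X in _ + X + _]big_nat_cond [X in _ + X + _]big1 => [|j].
  rewrite addr0 [X in _ + X]big_nat_recl // [X in _ + (X + _)]big1 => [|j].
    rewrite add0r (exchange_big_dep_nat xpredT) //= -big_split big1_seq //= => j _.
    rewrite [X in _ + X](eq_bigl (fun i => (i <= j)%N)) => [|i]; last first.
      by rewrite -ltnNge ltnS.
    rewrite -big_split big1 //= => i ij.
    by rewrite /G -FE // addSn exprS mulN1r mulNr addnC subrr.
  by rewrite leq0n.
by case/andP; lia.
Qed.

(* Multiplication by [(-1)^d] in degree [d]. *)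
Definition parity (c : cochain) : cochain.
Proof.
apply: (@mk_cochain (fun d s => (-1) ^+ d * c d s)).
have [N cN] := cochain_boundP c; exists N => d s h.
by rewrite cN ?mulr0.
Defined.

Lemma subeval_parity c d (s : simplex d) p g :
  subeval (parity c) s p g = (-1) ^+ p * subeval c s p g.
Proof. by []. Qed.

Lemma parityK c : parity (parity c) = c.
Proof.
apply/cochainP => d s; rewrite -[LHS]/((-1) ^+ d * ((-1) ^+ d * c d s)).
by rewrite mulrA -exprMn mulrNN mulr1 expr1n mul1r.
Qed.

Lemma parity0 : parity 0 = 0.
Proof. by apply/cochainP => d s; exact: mulr0. Qed.

Lemma coboundary_parity c : coboundary (parity c) = - parity (coboundary c).
Proof.
apply/cochainP => -[|d] s; rewrite cochainN.
  by rewrite [X in - X]mulr0 oppr0.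
have -> : parity (coboundary c) d.+1 s = (-1) ^+ d.+1 * coboundary c d.+1 s by [].
rewrite !coboundaryE mulr_sumr -sumrN; apply: eq_bigr => i _.
by rewrite subeval_parity exprS mulN1r mulNr opprK mulrCA.
Qed.

Arguments subeval : simpl never.

Lemma coboundary_cup c c' :
  coboundary (c * c') = coboundary c * c' + parity c * coboundary c'.
Proof.
apply/cochainP => -[|d] s; rewrite cochainD.
  by rewrite !cupE !big_nat1 /subeval /= !(mul0r, mulr0) addr0.
rewrite coboundaryE !cupE.
transitivity (\sum_(0 <= j < d.+1) \sum_(0 <= i < d.+2) (-1) ^+ i *
    (subeval c s j (bump i) * subeval c' s (d - j) (bump i \o addn j))).
  rewrite exchange_big; apply: eq_bigr => i _.
  by rewrite -mulr_sumr -subeval_cup.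
rewrite [X in _ = X + _]big_nat_recl // [X in _ = X + _ + _]mul0r add0r.
rewrite [X in _ = _ + X]big_nat_recr // subnn [X in _ = _ + (_ + X)]mulr0 addr0.
rewrite -[RHS]big_split /=; apply: eq_big_nat => j /andP[_ jd].
rewrite subSS subSn // !subeval_coboundary subeval_parity mulr_suml.
rewrite [X in _ = X + _]big_nat_recr //= [X in _ = _ + X]mulr_sumr.
rewrite [X in _ = _ + X]big_nat_recl //=.
rewrite (@big_cat_nat _ _ _ j.+1) //=; last exact: ltnW.
have e1 : subeval c s j (id \o bump j.+1) = subeval c s j id.
  by apply: eq_subeval => m mj /=; rewrite /bump; lia.
have e2 : subeval c' s (d - j) (addn j \o bump 0) = subeval c' s (d - j) (addn j.+1).
  by apply: eq_subeval => m mj /=; rewrite /bump; lia.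
rewrite e1 e2 -!addrA; congr (_ + _).
  apply: eq_big_nat => i /andP[_ ij]; rewrite -mulrA; congr (_ * (_ * _)).
  by apply: eq_subeval => m mj /=; rewrite /bump; lia.
rewrite addrA [X in _ = X + _](_ : _ = 0) ?add0r; last first.
  by rewrite exprS; ring.
rewrite -[X in \sum_(X <= _ < _) _]add0n big_addn subSS subSn //.
apply: eq_big_nat => i /andP[_ ilt].
rewrite (_ : subeval c s j (bump (i + j.+1)) = subeval c s j id); last first.
  by apply: eq_subeval => m mj /=; rewrite /bump; lia.
rewrite (_ : subeval c' s (d - j) _ = subeval c' s (d - j) (addn j \o bump i.+1)); last first.
  by apply: eq_subeval => m mj /=; rewrite /bump; lia.
by rewrite exprD !exprS; ring.
Qed.

Definition cocycle : {pred cochain} := [pred c | coboundary c == 0].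

Lemma cocycleP c : c \in cocycle <-> coboundary c = 0.
Proof. by split=> /eqP. Qed.

Lemma cocycle_subring_closed : subring_closed cocycle.
Proof.
split=> [|c c' /cocycleP c0 /cocycleP c'0|c c' /cocycleP c0 /cocycleP c'0].
- apply/cocycleP/cochainP => -[//|d] s; rewrite coboundaryE.
  case: d s => [|d] s; last by rewrite big1 // => i _; exact: mulr0.
  by rewrite !big_nat_recl // big_geq // expr0 expr1 mul1r mulN1r addr0 subrr.
- by apply/cocycleP; rewrite (raddfB coboundary) /= c0 c'0 subrr.
- by apply/cocycleP; rewrite coboundary_cup c0 c'0 mul0r mulr0 addr0.
Qed.
HB.instance Definition _ := GRing.isSubringClosed.Build cochain cocycle
  cocycle_subring_closed.

Record cocycles := Cocycles { cocycles_val : cochain; _ : cocycles_val \in cocycle }.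
HB.instance Definition _ := [isSub for cocycles_val].
HB.instance Definition _ := [Choice of cocycles by <:].
HB.instance Definition _ :=
  GRing.SubChoice_isSubPzRing.Build cochain cocycle cocycles
    cocycle_subring_closed.

Definition coboundaries : set cocycles :=
  [set z | exists c, val z = coboundary c].

Lemma coboundaries_ideal : ideal_closed coboundaries.
Proof.
split=> [|z z' [c zc] [c' zc']|z z' [c zc]|z z' [c zc]].
- by exists 0; rewrite !raddf0.
- by exists (c - c'); rewrite !raddfB /= zc zc'.
- exists (parity (val z) * c); rewrite coboundary_cup coboundary_parity parityK.
  have /cocycleP -> := valP z.
  by rewrite parity0 oppr0 mul0r add0r rmorphM /= zc.
- exists (c * val z); rewrite coboundary_cup.
  have /cocycleP -> := valP z.
  by rewrite mulr0 addr0 rmorphM /= zc.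
Qed.

Definition cohomology : pzRingType := qring (Ideal coboundaries_ideal).

Definition coclass : cocycles -> cohomology := qproj (Ideal coboundaries_ideal).

(* Cochains concentrated in degree [d]. *)
Definition homogeneous_cochain (d : nat) (c : cochain) : Prop :=
  forall e (s : simplex e), e <> d -> c e s = 0.

(* The subgroup [H^d(X; Z)] of the total cohomology ring. *)
Definition cohomology_deg (d : nat) : set cohomology :=
  [set coclass z | z in [set z : cocycles | homogeneous_cochain d (val z)]].

End SingularCochains.
Arguments cocycle : clear implicits.

Section Pullback.
Variables (R : realType) (X Y : topologicalType) (f : continuousType X Y).

Definition pull_simplex d (s : simplex R X d) : simplex R Y d := f \o s.

Lemma pull_cochain_bound (c : cochain R Y) :
  exists N, forall d s, (N <= d)%N -> c d (@pull_simplex d s) = 0.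
Proof. by have [N cN] := cochain_boundP c; exists N => d s /cN. Qed.

Definition pull_cochain (c : cochain R Y) : cochain R X :=
  mk_cochain (pull_cochain_bound c).

Lemma pull_simplex_face d (s : simplex R X d.+1) i :
  pull_simplex (face s i) = face (pull_simplex s) i.
Proof. exact/continuousEP. Qed.

Lemma pull_coboundary c :
  coboundary (pull_cochain c) = pull_cochain (coboundary c).
Proof.
apply/cochainP => -[//|d] s; apply: eq_bigr => i _.
by rewrite -pull_simplex_face.
Qed.

Lemma pull_cocycle_subproof (z : cocycles R Y) : pull_cochain (val z) \in cocycle R X.
Proof.
apply/cocycleP; rewrite pull_coboundary.
have /cocycleP -> := valP z.
exact/cochainP.
Qed.

Definition pull_cocycle (z : cocycles R Y) : cocycles R X :=
  Cocycles (pull_cocycle_subproof z).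

Definition pullback (h : cohomology R Y) : cohomology R X :=
  coclass (pull_cocycle (repr h)).

Lemma pullback_coclass (z : cocycles R Y) :
  pullback (coclass z) = coclass (pull_cocycle z).
Proof.
have /qring_eqP[c zc] : coclass (repr (coclass z)) = coclass z by exact: reprK.
apply/qring_eqP; exists (pull_cochain c).
by rewrite pull_coboundary -zc; apply/cochainP.
Qed.

End Pullback.

Section Spheres.
Variable R : realType.

Definition enorm n (v : 'rV[R]_n) : R := Num.sqrt (\sum_i v 0 i ^+ 2).

(* The unit sphere of R^n, i.e. S^{n-1}. *)
Definition sphere (n : nat) : set 'rV[R]_n := [set v | enorm v = 1].
Arguments sphere : clear implicits.

Lemma enorm_gt0 n (v : 'rV[R]_n) : v != 0 -> 0 < enorm v.
Proof.
move=> v0; rewrite sqrtr_gt0 lt_def sumr_ge0 ?andbT => [|i _]; last exact: sqr_ge0.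
apply: contra v0; rewrite psumr_eq0 => [/allP v0|i _]; last exact: sqr_ge0.
apply/eqP/rowP => i; rewrite mxE; apply/eqP.
by have := v0 i (mem_index_enum i); rewrite /= sqrf_eq0.
Qed.

Lemma enorm_unit n (v : 'rV[R]_n) : v != 0 -> (enorm v)^-1 *: v \in sphere n.
Proof.
move=> /enorm_gt0 v0; apply/mem_set; rewrite /sphere /= {1}/enorm.
under eq_bigr do rewrite mxE exprMn.
rewrite -mulr_sumr sqrtrM ?sqr_ge0// sqrtr_sqr ger0_norm ?invr_ge0 ?ltW//.
by rewrite mulVf // gt_eqF.
Qed.

Section Normalize.
Variables (T : topologicalType) (n : nat) (v : T -> 'rV[R]_n).
Hypotheses (v_neq0 : forall x, v x != 0) (v_cont : forall i, continuous (fun x => v x 0 i)).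

Definition normalize_fun (x : T) : sphere n := SigSub (enorm_unit (v_neq0 x)).

Lemma normalize_continuous : continuous normalize_fun.
Proof.
apply: continuous_to_set; apply: continuous_entries => i j /=.
rewrite (ord1 i); under eq_fun do rewrite mxE.
move=> x; apply: (@continuousM R T (fun x => (enorm (v x))^-1)); last exact: v_cont.
apply: continuousV; first by rewrite gt_eqF // enorm_gt0.
apply: (@continuous_comp _ _ _ (fun x => \sum_i v x 0 i ^+ 2) Num.sqrt).
  apply: (@continuous_sumr R) => l _ y.
  by apply: (@continuousM R T (fun x => v x 0 l)); exact: v_cont.
exact: sqrt_continuous.
Qed.

(* [x |-> v x / ||v x||] *)
Definition normalize : continuousType T (sphere n) := mkcts normalize_continuous.

End Normalize.

(* The vertices of an [n]-simplex of R^n with the origin in its interior; the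
   basis [v_1 - v_0, ..., v_n - v_0] is positively oriented. *)
Definition vertex n (i : nat) : 'rV[R]_n :=
  if i is i'.+1 then \row_j (j == i' :> nat)%:R else const_mx (-1).

(* The point with barycentric coordinates [t] in the facet opposite to
   [vertex n i]. *)
Definition facet_point n (i : 'I_n.+1) (t : stdsimplex R n.-1) : 'rV[R]_n :=
  \sum_(j < n.-1.+1) val t 0 j *: vertex n (bump i j).

Lemma facet_point_neq0 n (n_gt0 : (0 < n)%N) i t : @facet_point n i t != 0.
Proof.
case: n n_gt0 i t => // n _ i t /=.
have /set_mem[_ t1] := valP t.
apply/eqP => f0.
pose w m : R := \sum_(j < n.+1 | bump i j == m) val t 0 j.
have w0 m : (m < n.+1)%N -> w m.+1 = w 0%N.
  move=> mn; have /rowP/(_ (Ordinal mn)) := f0.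
  rewrite /facet_point summxE mxE => /eqP; rewrite -[_ == 0]subr_eq0 subr0.
  rewrite (_ : \sum_j _ = w m.+1 - w 0%N) ?subr_eq0; first by move=> /eqP.
  rewrite /w [X in X - _]big_mkcond [X in _ - X]big_mkcond -sumrB.
  apply: eq_bigr => j _; rewrite mxE; case: (bump i j) => [|l] /=.
    by rewrite mxE sub0r mulrN1.
  by rewrite mxE eqSS /= subr0 eq_sym; case: eqP; rewrite ?mulr1 ?mulr0.
have wi : w i = 0.
  by rewrite /w big_pred0 // => j; rewrite /bump; lia.
have w00 : w 0%N = 0.
  by case: (i : nat) (ltn_ord i) wi => [//|l] ln; rewrite w0.
have : \sum_(j < n.+1) val t 0 j = \sum_(m < n.+2) w m.
  rewrite (partition_big (fun j : 'I_n.+1 => lift i j) predT) //=.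
rewrite t1 big1 => [/eqP|[[|m] /= mn] _]; rewrite ?oner_eq0// ?w00// w0 ?w00//.
Qed.

Lemma facet_point_continuous n (i : 'I_n.+1) j :
  continuous (fun t => facet_point i t 0 j).
Proof.
rewrite /facet_point; under eq_fun do rewrite summxE.
apply: continuous_sumr => l _ t; under eq_fun do rewrite mxE.
by apply: continuousM; [exact: continuous_val_entry|exact: cst_continuous].
Qed.

Definition sphere_facet n (n_gt0 : (0 < n)%N) (i : 'I_n.+1) :
    simplex R (sphere n) n.-1 :=
  normalize (facet_point_neq0 n_gt0 i) (@facet_point_continuous n i).

(* The value of an (n-1)-cochain on the fundamental cycle of S^{n-1}: the
   singular boundary [\sum_i (-1)^i (facet i)] of the positively oriented simplex
   with vertices [vertex n i], radially projected. This cycle represents S^{n-1}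
   oriented as the boundary of the unit ball. *)
Definition sphere_eval n (n_gt0 : (0 < n)%N) (c : cochain R (sphere n)) : int :=
  \sum_(i < n.+1) (-1) ^+ i * c n.-1 (sphere_facet n_gt0 i).

(* The class of the normalized volume form: as a volume form is normalized by
   having integral 1 over the oriented sphere, its class is the integral class in
   degree n-1 whose value on the fundamental cycle is 1. For [1 < n] there is
   exactly one such class; [xget] selects it. *)
Definition std_generator n (n_gt0 : (0 < n)%N) : cohomology R (sphere n) :=
  xget 0 [set coclass z | z in [set z : cocycles R (sphere n) |
    homogeneous_cochain n.-1 (val z) /\ sphere_eval n_gt0 (val z) = 1]].

End Spheres.
Arguments sphere : clear implicits.

Section Configurations.
Variables (R : realType) (k n : nat).

(* The rows of the matrix are the points of the configuration. *)
Definition conf : set 'M[R]_(k, n) :=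
  [set x | forall i j, i != j -> row i x != row j x].

Variables (a b : 'I_k) (ab : a != b).

Lemma conf_sub_neq0 (x : conf) : row b (val x) - row a (val x) != 0.
Proof.
by have /set_mem xP := valP x; rewrite subr_eq0 eq_sym xP.
Qed.

Lemma conf_sub_continuous i :
  continuous (fun x : conf => (row b (val x) - row a (val x)) 0 i).
Proof.
under eq_fun do rewrite !mxE.
by move=> x; apply: continuousB; exact: continuous_val_entry.
Qed.

Definition gauss : continuousType conf (sphere R n) :=
  normalize conf_sub_neq0 (@conf_sub_continuous).

End Configurations.
Arguments conf : clear implicits.

Section ArnoldAlgebra.
Variables (n k : nat).

Definition arnold_index : choiceType := {ab : 'I_k * 'I_k | ab.1 != ab.2}.

(* The free associative Z-algebra, i.e. the monoid algebra of words. *)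
Definition free_alg : nzRingType := malg (fmonom arnold_index) int.

Definition free_var (ab : arnold_index) : free_alg := mkmalgU (fmu ab) 1.

(* Homogeneous elements, each generator having degree [n - 1]. *)
Definition free_deg (d : nat) : set free_alg :=
  [set x : free_alg | forall w : fmonom arnold_index,
     mcoeff w x != 0 -> (fdeg w * n.-1 = d)%N].

Definition graded_commutators : set free_alg :=
  [set r | exists p q x y, [/\ free_deg p x, free_deg q y &
     r = x * y - (-1) ^+ (p * q) * (y * x)]].

Definition free_gc_alg : pzRingType := qring (gen_ideal graded_commutators).

Definition gc_var (a b : 'I_k) (ab : a != b) : free_gc_alg :=
  qproj _ (free_var (exist _ (a, b) ab)).

Inductive arnold_relation : free_gc_alg -> Prop :=
| arnold_sym a b (ab : a != b) (ba : b != a) :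
    arnold_relation (gc_var ab + (-1) ^+ n.+1 * gc_var ba)
| arnold_sqr a b (ab : a != b) :
    arnold_relation (gc_var ab ^+ 2)
| arnold_cyc a b c (ab : a != b) (bc : b != c) (ca : c != a) :
    arnold_relation
      (gc_var ab * gc_var bc + gc_var bc * gc_var ca + gc_var ca * gc_var ab).

Definition arnold_alg : pzRingType :=
  qring (gen_ideal (arnold_relation : set free_gc_alg)).

Definition arnold_gen (a b : 'I_k) (ab : a != b) : arnold_alg :=
  qproj _ (gc_var ab).

Definition arnold_deg (d : nat) : set arnold_alg :=
  [set qproj _ (qproj _ x) | x in free_deg d].

End ArnoldAlgebra.

(* Main.v *)
(* A cochain evaluated on the affine simplices of a convex set is a function on lists
   of vertices; coning off at a vertex gives explicit natural homotopies between
   cochain operators on lists: barycentric subdivision, the prism and the reversal of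
   vertices. They yield Mayer-Vietoris gluing, homotopy invariance and graded
   commutativity of the cup product.

   Adding a point to a configuration of [k] points makes the cohomology of Conf_(k+1)
   a free module over that of Conf_k, with basis [1] and the [k] Gauss classes of the
   new point: the forbidden points are removed one at a time, each removal adding one
   class by Mayer-Vietoris. Hence the products of Gauss classes with distinct second
   indices form a Z-basis of the cohomology of Conf_k.

   In degree [2 (n - 1)] the cohomology of Conf_3 thus has rank two, and two families
   of configurations parametrized by a product of two punctured spaces detect both
   coordinates; the Arnold combination vanishes on both. Conversely the relations
   reduce every word in the generators to the same monomials, so that a spanning set
   of the algebra is mapped to a basis of the cohomology. *)

From HB Require Import structures.
From mathcomp Require Import all_boot all_order all_algebra.
From mathcomp Require Import all_classical all_reals.
From mathcomp Require Import topology normedtype sequences.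
From mathcomp Require Import zify ring lra.
From mathcomp.multinomials Require Import -(notations) monalg.
From mathcomp Require Import -(notations) finmap.
Require Import Defs.

Set Implicit Arguments.
Unset Strict Implicit.
Unset Printing Implicit Defensive.

Import Order.TTheory GRing.Theory Num.Theory numFieldNormedType.Exports.

Local Open Scope classical_set_scope.
Local Open Scope ring_scope.

(** * Cochains on lists of vertices *)

(** Cohomology is given directly by functions on singular simplices, so constructions usually made
    on chains appear as their duals: operators on integer-valued functions. Freeness is stated with
    coefficients in an arbitrary open base, and the generator [z] of a punctured space is
    constructed to be free over all bases at once. This uniformity does the work of the theorems of
    Künneth and Leray-Hirsch: over configurations it drives the removal of points, and over the base
    [nz] it shows that [z1 * z2] has infinite order on a product of two punctured spaces. The
    generator lives on the punctured space rather than on the sphere. It can then be pulled back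
    along plain differences of points and compared along straight segments; normalization comes in
    only at the end, to match the Gauss maps. No primitive of the Arnold combination is exhibited.
    As the rank is known, the combination is determined by two integers, and these are computed by
    restriction. From the sections on punctured spaces on, the points mostly lie in R^(n+1), so that
    [n] is the degree of the generators. *)

Section ListCochains.
Variable V : Type.
Implicit Types (phi psi : seq V -> int) (l : seq V).

Definition consf phi (x : V) : seq V -> int := fun m => phi (x :: m).

(* A function on lists is a cochain on the augmented complex of ordered affine
   simplices, the list [:: v_0; ...; v_d] standing for the simplex with these
   vertices; this is its coboundary. *)
Fixpoint ldelta phi l : int :=
  if l is x :: l' then phi l' - ldelta (consf phi x) l' else 0.

Definition ldel i l := take i l ++ drop i.+1 l.

Lemma size_ldel i l : (i < size l)%N -> size (ldel i l) = (size l).-1.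
Proof. by move=> il; rewrite size_cat size_take size_drop il; lia. Qed.

Lemma ldeltaE phi l :
  ldelta phi l = \sum_(0 <= i < size l) (-1) ^+ i * phi (ldel i l).
Proof.
elim: l phi => [|x l IH] phi; first by rewrite big_geq.
rewrite big_nat_recl //= /ldel take0 drop1 expr0 mul1r /= IH; congr (_ + _).
rewrite -sumrN; apply: eq_bigr => i _.
by rewrite exprS mulN1r mulNr.
Qed.

Lemma eq_ldelta phi psi l :
  (forall i, (i < size l)%N -> phi (ldel i l) = psi (ldel i l)) ->
  ldelta phi l = ldelta psi l.
Proof.
move=> h; rewrite !ldeltaE; apply: eq_big_nat => i /andP[_ il].
by rewrite h.
Qed.

Lemma ldeltaD phi psi l :
  ldelta (fun m => phi m + psi m) l = ldelta phi l + ldelta psi l.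
Proof.
rewrite !ldeltaE -big_split; apply: eq_bigr => i _; exact: mulrDr.
Qed.

Lemma ldeltaN phi l : ldelta (fun m => - phi m) l = - ldelta phi l.
Proof.
rewrite !ldeltaE -sumrN; apply: eq_bigr => i _; exact: mulrN.
Qed.

Lemma ldeltaB phi psi l :
  ldelta (fun m => phi m - psi m) l = ldelta phi l - ldelta psi l.
Proof. by rewrite ldeltaD ldeltaN. Qed.

Lemma ldelta_cons phi x : consf (ldelta phi) x = fun m => phi m - ldelta (consf phi x) m.
Proof. by []. Qed.

Lemma ldeltaK phi l : ldelta (ldelta phi) l = 0.
Proof.
elim: l phi => [//|x l IH] phi /=.
by rewrite ldelta_cons ldeltaB IH subr0 subrr.
Qed.

End ListCochains.

(** * Homotopies of operators on lists by coning *)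

Section ListHomotopy.
Variables (V W : Type) (A B : (seq W -> int) -> seq V -> int) (apex : seq V -> W).
Hypotheses
  (AB : forall phi psi l, A (fun m => phi m - psi m) l = A phi l - A psi l)
  (BB : forall phi psi l, B (fun m => phi m - psi m) l = B phi l - B psi l)
  (Adelta : forall phi l, A (ldelta phi) l = ldelta (A phi) l)
  (Bdelta : forall phi l, B (ldelta phi) l = ldelta (B phi) l)
  (AB0 : forall phi, A phi [::] = B phi [::]).

(* The homotopy from [A] to [B] given by coning off at [apex]. *)
Fixpoint lhomotopy_rec n (phi : seq W -> int) (l : seq V) : int :=
  if n is n'.+1 then
    A (consf phi (apex l)) l - B (consf phi (apex l)) l
      - ldelta (lhomotopy_rec n' (consf phi (apex l))) l
  else 0.

Definition lhomotopy phi l := lhomotopy_rec (size l) phi l.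

Lemma lhomotopyE phi l : (0 < size l)%N ->
  lhomotopy phi l = A (consf phi (apex l)) l - B (consf phi (apex l)) l
      - ldelta (lhomotopy (consf phi (apex l))) l.
Proof.
rewrite {1}/lhomotopy; case sl: (size l) => [//|n] _ /=; congr (_ - _).
apply: eq_ldelta => i il; rewrite /lhomotopy size_ldel // sl //.
Qed.

Lemma lhomotopyB phi psi l :
  lhomotopy (fun m => phi m - psi m) l = lhomotopy phi l - lhomotopy psi l.
Proof.
rewrite /lhomotopy; move: (size l) => n; elim: n phi psi l => [|n IH] phi psi l /=.
  by rewrite subrr.
have -> x : consf (fun m => phi m - psi m) x = fun m => consf phi x m - consf psi x m.
  by [].
rewrite AB BB.
rewrite (_ : ldelta (lhomotopy_rec n _) l = ldelta
  (fun m => lhomotopy_rec n (consf phi (apex l)) m - lhomotopy_rec n (consf psi (apex l)) m) l).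
  by rewrite ldeltaB; ring.
by apply: eq_ldelta => i _; rewrite IH.
Qed.

(** Coning gives [consf (ldelta phi) a = phi - ldelta psi] with [psi = consf phi a]. Substituted
    into the recursion, this leaves [ldelta] of [A psi - B psi - lhomotopy (ldelta psi)]; by
    induction on shorter lists that is [ldelta (ldelta (lhomotopy psi))], which is zero. *)
Lemma lhomotopyP phi l :
  lhomotopy (ldelta phi) l + ldelta (lhomotopy phi) l = A phi l - B phi l.
Proof.
have [n] := ubnP (size l); elim: n l phi => [//|n IH] l phi sl.
case: (posnP (size l)) => [/size0nil ->|l0].
  by rewrite AB0 [RHS]subrr.
set psi := consf phi (apex l).
have e : consf (ldelta phi) (apex l) = fun m => phi m - ldelta psi m by [].
rewrite lhomotopyE // e AB BB Adelta Bdelta.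
rewrite (_ : ldelta (lhomotopy _) l = ldelta (fun m => lhomotopy phi m - lhomotopy (ldelta psi) m) l); last first.
  by apply: eq_ldelta => i _; rewrite lhomotopyB.
rewrite ldeltaB.
rewrite (_ : ldelta (lhomotopy (ldelta psi)) l = ldelta (fun m => (A psi m - B psi m) - ldelta (lhomotopy psi) m) l); last first.
  apply: eq_ldelta => i il; rewrite -IH ?size_ldel //; last by lia.
  by rewrite addrK.
by rewrite !ldeltaB ldeltaK; ring.
Qed.

End ListHomotopy.

(** * Barycentric subdivision *)

Section ListSubdivision.
Variables (V : Type) (bary : seq V -> V).
Implicit Types (phi psi : seq V -> int) (l : seq V).

Fixpoint lsd_rec n phi l : int :=
  if n is n'.+1 then ldelta (lsd_rec n' (consf phi (bary l))) l else phi l.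

(* Barycentric subdivision. *)
Definition lsd phi l := lsd_rec (size l) phi l.

Lemma lsdE phi l : (0 < size l)%N -> lsd phi l = ldelta (lsd (consf phi (bary l))) l.
Proof.
rewrite {1}/lsd; case sl: (size l) => [//|n] _ /=.
by apply: eq_ldelta => i il; rewrite /lsd size_ldel // sl.
Qed.

Lemma lsdB phi psi l : lsd (fun m => phi m - psi m) l = lsd phi l - lsd psi l.
Proof.
rewrite /lsd; move: (size l) => n; elim: n phi psi l => [//|n IH] phi psi l /=.
by rewrite -ldeltaB; apply: eq_ldelta => i _; exact: IH.
Qed.

Lemma lsd_delta phi l : lsd (ldelta phi) l = ldelta (lsd phi) l.
Proof.
have [n] := ubnP (size l); elim: n l phi => [//|n IH] l phi sl.
case: (posnP (size l)) => [/size0nil ->//|l0].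
rewrite lsdE // ldelta_cons.
rewrite (_ : ldelta _ l = ldelta (fun m => lsd phi m - ldelta (lsd (consf phi (bary l))) m) l).
  by rewrite ldeltaB ldeltaK subr0.
apply: eq_ldelta => i il; rewrite lsdB; congr (_ - _).
by apply: IH; rewrite size_ldel //; lia.
Qed.

(** With a vertex as apex the homotopy stays in the hull of the list and is natural in the vertices.
    [bary [::]] is a default value for the empty list, where [lhomotopy] is 0. *)
Definition lsdh := lhomotopy (fun phi => phi) lsd (head (bary [::])).

Lemma lsdhP phi l : lsdh (ldelta phi) l + ldelta (lsdh phi) l = phi l - lsd phi l.
Proof.
apply: lhomotopyP => //; [exact: lsdB|exact: lsd_delta].
Qed.

(** The [j]-th summand is a homotopy from [iter j lsd] to [iter j.+1 lsd], so the sum telescopes. *)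
Definition lsdh_iter n phi l := \sum_(0 <= j < n) iter j lsd (lsdh phi) l.

Lemma iter_lsdB n phi psi l :
  iter n lsd (fun m => phi m - psi m) l = iter n lsd phi l - iter n lsd psi l.
Proof.
elim: n phi psi l => [//|n IH] phi psi l.
by rewrite !iterSr -IH; congr (iter n lsd _ l); apply/funext => m; exact: lsdB.
Qed.

Lemma iter_lsd_delta n phi l : iter n lsd (ldelta phi) l = ldelta (iter n lsd phi) l.
Proof.
elim: n phi l => [//|n IH] phi l; rewrite !iterSr -IH.
by congr (iter n lsd _ l); apply/funext => m; exact: lsd_delta.
Qed.

Lemma lsdh_iterP n phi l :
  lsdh_iter n (ldelta phi) l + ldelta (lsdh_iter n phi) l = phi l - iter n lsd phi l.
Proof.
have e : ldelta (lsdh_iter n phi) l = \sum_(0 <= j < n) ldelta (iter j lsd (lsdh phi)) l.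
  rewrite ldeltaE; under eq_bigr do rewrite mulr_sumr.
  by rewrite exchange_big; apply: eq_bigr => j _; rewrite ldeltaE.
rewrite e -big_split /= -[RHS]opprB.
rewrite -(telescope_sumr (fun j => iter j lsd phi l) (leq0n n)) -sumrN.
apply: eq_bigr => j _.
rewrite -iter_lsd_delta iterSr opprB -iter_lsdB.
rewrite -[lsdh (ldelta phi)](_ : (fun m => (phi m - lsd phi m) - ldelta (lsdh phi) m) = _).
  by rewrite (iter_lsdB j _ (ldelta _)) subrK.
by apply/funext => m; rewrite -lsdhP addrK.
Qed.

End ListSubdivision.

(** * Reversal of vertices *)

Section ListReversal.
Variable V : Type.
Implicit Types (phi psi : seq V -> int) (l : seq V).

Lemma ldelta_rcons phi l x :
  ldelta phi (rcons l x) =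
    ldelta (fun m => phi (rcons m x)) l + (-1) ^+ size l * phi l.
Proof.
elim: l phi => [|y l IH] phi /=; first by rewrite subr0 mul1r add0r.
by rewrite IH exprS; rewrite /consf /=; ring.
Qed.

Lemma ldelta_rev phi l :
  ldelta phi (rev l) = (-1) ^+ (size l).-1 * ldelta (fun m => phi (rev m)) l.
Proof.
elim: l phi => [|x l IH] phi; first by rewrite mulr0.
rewrite rev_cons ldelta_rcons IH size_rev /=.
rewrite (_ : ldelta _ l = ldelta (consf (fun m => phi (rev m)) x) l); last first.
  by apply: eq_ldelta => i _; rewrite /consf rev_cons.
by case: l {IH} => [|y l] /=; rewrite ?exprS; ring.
Qed.

(* [(-1) ^+ 'C(d + 1, 2)] is the sign of the reversal of [d + 1] vertices. *)
Definition lrev phi l := (-1) ^+ 'C(size l, 2) * phi (rev l).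

Lemma lrevB phi psi l : lrev (fun m => phi m - psi m) l = lrev phi l - lrev psi l.
Proof. exact: mulrBr. Qed.

Lemma lrev_delta phi l : lrev (ldelta phi) l = ldelta (lrev phi) l.
Proof.
rewrite /lrev ldelta_rev mulrA -exprD.
case sl: (size l) => [|n]; first by move/size0nil: sl ->; rewrite mulr0.
(* [ldelta_rev] contributes another [n] to the exponent; up to the even number [n.*2] what is left
   is the sign belonging to lists of size [n], that is, to the faces. *)
have -> : ('C(n.+1, 2) + n)%N = ('C(n, 2) + n.*2)%N by rewrite binS bin1; lia.
rewrite exprD -signr_odd -[(-1) ^+ n.*2]signr_odd odd_double mulr1 signr_odd.
rewrite !ldeltaE mulr_sumr; apply: eq_big_nat => i /andP[_ il].
by rewrite size_ldel // sl mulrCA.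
Qed.

Variable v0 : V.
Definition lrevh := lhomotopy (fun phi => phi) lrev (head v0).

Lemma lrevhP phi l : lrevh (ldelta phi) l + ldelta (lrevh phi) l = phi l - lrev phi l.
Proof.
apply: lhomotopyP => //; [exact: lrevB|exact: lrev_delta|].
by move=> psi; rewrite /lrev mul1r.
Qed.

End ListReversal.

Lemma continuous_pair (T U V : topologicalType) (f : T -> U) (g : T -> V) :
  continuous f -> continuous g -> continuous (fun x => (f x, g x)).
Proof. by move=> cf cg x; exact: (cvg_pair (cf x) (cg x)). Qed.

Section RealContinuity.
Variables (R : realType) (T : topologicalType) (f g : T -> R).
Hypotheses (cf : continuous f) (cg : continuous g).

Lemma continuous_mulr : continuous (fun x => f x * g x).
Proof. by move=> x; apply: continuousM; [exact: cf|exact: cg]. Qed.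

Lemma continuous_addr : continuous (fun x => f x + g x).
Proof. by move=> x; apply: continuousD; [exact: cf|exact: cg]. Qed.

Lemma continuous_oppr : continuous (fun x => - f x).
Proof. by move=> x; apply: continuousN; exact: cf. Qed.

Lemma continuous_normr : continuous (fun x => `|f x|).
Proof. by move=> x; apply: continuous_comp; [exact: cf|exact: norm_continuous]. Qed.

End RealContinuity.

(** * Affine simplices in convex sets *)

Section Convexity.
Variable R : realType.

(* [cmb p f] is the affine simplex with vertices [f 0, ..., f p]. *)
Record convex (D : topologicalType) := Convex {
  cmb : forall p, (nat -> D) -> simplex R D p;
  eq_cmb : forall p (f f' : nat -> D),
    (forall j, (j <= p)%N -> f j = f' j) -> cmb p f = cmb p f';
  cmb_restr : forall p q (f : nat -> D) (h : nat -> nat),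
    (forall j, (j <= q)%N -> (h j <= p)%N) ->
    restr (cmb p f) (fun j : 'I_q.+1 => inord (h j)) = cmb q (f \o h) }.

Lemma restr_compl (X Y : topologicalType) (g : continuousType X Y) d e
    (s : simplex R X d) (h : 'I_e.+1 -> 'I_d.+1) :
  restr (g \o s : simplex R Y d) h = g \o restr s h :> simplex R Y e.
Proof. exact/continuousEP. Qed.

Section Evaluation.
Variables (D X : topologicalType) (C : convex D).

(* The cochain [c] evaluated on affine simplices mapped to [X] by [g]. *)
Definition cev (c : cochain R X) (g : continuousType D X) (l : seq D) : int :=
  if l is x :: l' then c (size l') (g \o cmb C (size l') (nth x l)) else 0.

Lemma cevE c g x0 p l : size l = p.+1 ->
  cev c g l = c p (g \o cmb C p (nth x0 l)).
Proof.
case: l => [//|x l] [<-] /=; congr (c _ (_ \o _)); apply: eq_cmb => j jl.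
exact: set_nth_default.
Qed.

Lemma cev_delta c g l : cev (coboundary c) g l = ldelta (cev c g) l.
Proof.
case sl: (size l) => [|[|p]]; first by move/size0nil: sl => ->.
  by case: l sl => [//|x []//] _ /=; rewrite subr0.
have x0 : D by case: l sl => [//|x] *; exact: x.
rewrite (cevE _ _ x0 sl).
rewrite coboundaryE ldeltaE sl; apply: eq_big_nat => i /andP[_ ip].
congr (_ * _); rewrite (@cevE _ _ x0 p); last by rewrite size_ldel ?sl.
rewrite /subeval restr_compl; congr (c _ (_ \o _)).
rewrite cmb_restr => [|j jp]; last by rewrite /bump; lia.
apply: eq_cmb => j jp /=; rewrite /ldel nth_cat size_take sl ip /bump.
case: (leqP i j) => ij; first by rewrite nth_drop; congr nth; lia.
by rewrite nth_take.
Qed.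

End Evaluation.

Lemma cev_pull (D X Y : topologicalType) (C : convex D) (g : continuousType X Y)
    (h : continuousType D X) c l :
  cev C (pull_cochain g c) h l = cev C c (g \o h) l.
Proof.
case: l => [//|x l]; rewrite /cev.
rewrite -[LHS]/(c (size l) (pull_simplex g (h \o cmb C (size l) (nth x (x :: l))))).
by congr (c _ _); exact/continuousEP.
Qed.

Section LinearSimplex.
Variable m : nat.
Implicit Types f : nat -> 'rV[R]_m.

Definition lin_fun p f (t : stdsimplex R p) : 'rV[R]_m := \sum_(j < p.+1) val t 0 j *: f j.

Lemma lin_continuous p f : continuous (@lin_fun p f).
Proof.
apply: continuous_entries => i j; rewrite /lin_fun.
under eq_fun do rewrite summxE.
apply: continuous_sumr => l _ t; under eq_fun do rewrite mxE.
by apply: continuousM; [exact: continuous_val_entry|exact: cst_continuous].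
Qed.

Definition lin p f : simplex R 'rV[R]_m p := mkcts (@lin_continuous p f).

Lemma lin_fun_restr p q f (h : nat -> nat) (t : stdsimplex R q) :
  (forall j, (j <= q)%N -> (h j <= p)%N) ->
  lin_fun f (vertex_map (fun j : 'I_q.+1 => inord (h j) : 'I_p.+1) t) = lin_fun (f \o h) t.
Proof.
move=> hq; rewrite /lin_fun [RHS](partition_big (fun j : 'I_q.+1 => inord (h j) : 'I_p.+1) predT) //=.
apply: eq_bigr => i _; rewrite mxE scaler_suml; apply: eq_bigr => j /eqP <-.
by rewrite inordK // ltnS hq // -ltnS.
Qed.

Lemma eq_lin p f f' : (forall j, (j <= p)%N -> f j = f' j) -> lin_fun f =1 @lin_fun p f'.
Proof. by move=> ff' t; apply: eq_bigr => j _; rewrite ff' // -ltnS. Qed.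

Definition convex_row : convex 'rV[R]_m.
Proof.
apply: (@Convex _ lin) => [p f f' ff'|p q f h hp].
  by apply/continuousEP => t; exact: eq_lin.
by apply/continuousEP => t; exact: lin_fun_restr.
Defined.

End LinearSimplex.

Section AffineSimplex.
Variable d : nat.
Implicit Types f : nat -> stdsimplex R d.

Lemma aff_subproof p f (t : stdsimplex R p) :
  lin_fun (fun j => val (f j)) t \in stdsimplex R d.
Proof.
have /set_mem[t0 t1] := valP t.
apply/mem_set; split=> [i|].
  rewrite summxE; apply: sumr_ge0 => j _; rewrite mxE mulr_ge0 //.
  by have /set_mem[+ _] := valP (f j); apply.
under eq_bigr do rewrite summxE.
rewrite exchange_big /= -t1; apply: eq_bigr => j _.
under eq_bigr do rewrite mxE.
by rewrite -mulr_sumr; have /set_mem[_ ->] := valP (f j); rewrite mulr1.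
Qed.

Definition aff_fun p f (t : stdsimplex R p) : stdsimplex R d := SigSub (aff_subproof f t).

Lemma aff_continuous p f : continuous (@aff_fun p f).
Proof. by apply: continuous_to_set; exact: lin_continuous. Qed.

Definition aff p f : simplex R (stdsimplex R d) p := mkcts (@aff_continuous p f).

Definition convex_simplex : convex (stdsimplex R d).
Proof.
apply: (@Convex _ aff) => [p f f' ff'|p q f h hp].
  by apply/continuousEP => t; apply: val_inj; apply: eq_lin => j /ff' ->.
by apply/continuousEP => t; apply: val_inj; exact: (lin_fun_restr (fun j => val (f j))).
Defined.

End AffineSimplex.

Section PrismSimplex.
Variable d : nat.
Let prism := (R * stdsimplex R d)%type.
Implicit Types f : nat -> prism.

Definition paff_fun p f (t : stdsimplex R p) : prism :=
  (\sum_(j < p.+1) (val t 0 j : R) * ((f j).1 : R), aff_fun (fun j => (f j).2) t).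

Lemma paff_continuous p f : continuous (@paff_fun p f).
Proof.
apply: continuous_pair; last exact: aff_continuous.
apply: (@continuous_sumr R) => j _.
by apply: continuous_mulr; [exact: continuous_val_entry|exact: cst_continuous].
Qed.

Definition paff p f : simplex R prism p := mkcts (@paff_continuous p f).

Definition convex_prism : convex prism.
Proof.
apply: (@Convex _ paff) => [p f f' ff'|p q f h hp].
  apply/continuousEP => t; congr pair.
    by apply: eq_bigr => j _; rewrite ff' // -ltnS.
  by apply: val_inj; apply: eq_lin => j /ff' ->.
apply/continuousEP => t; congr pair.
  rewrite /= [RHS](partition_big (fun j : 'I_q.+1 => inord (h j) : 'I_p.+1) predT) //=.
  apply: eq_bigr => i _; rewrite mxE mulr_suml; apply: eq_bigr => j /eqP <-.
  by rewrite inordK // ltnS hp // -ltnS.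
by apply: val_inj; exact: (lin_fun_restr (fun j => val (f j).2)).
Defined.

End PrismSimplex.

Section Vertices.
Variable d : nat.

Lemma svert_subproof (i : nat) : (\row_(j < d.+1) (j == inord i)%:R : 'rV[R]_d.+1) \in stdsimplex R d.
Proof.
apply/mem_set; split=> [j|]; first by rewrite mxE ler0n.
under eq_bigr do rewrite mxE.
rewrite (bigD1 (inord i)) //= eqxx big1 ?addr0 // => j /negPf ->.
by [].
Qed.

Definition svert (i : nat) : stdsimplex R d := SigSub (svert_subproof i).

Definition sverts := mkseq svert d.+1.

Lemma aff_svert (t : stdsimplex R d) : aff_fun svert t = t.
Proof.
apply: val_inj; apply/rowP => i; rewrite /= /lin_fun summxE.
rewrite (bigD1 i) //= big1 ?addr0 => [|j ji].
  by rewrite !mxE inord_val eqxx mulr1.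
by rewrite !mxE inord_val eq_sym (negPf ji) mulr0.
Qed.

(** The identity of the standard simplex is the affine simplex on its own vertices. Through this,
    identities between functions on lists become identities between cochains. *)
Lemma cev_sverts (X : topologicalType) (c : cochain R X) (s : simplex R X d) :
  cev (convex_simplex d) c s sverts = c d s.
Proof.
rewrite (@cevE _ _ _ _ _ (svert 0) d) ?size_mkseq //; congr (c _ _).
apply/continuousEP => t; congr (s _); rewrite -[RHS]aff_svert.
by apply: val_inj; apply: eq_lin => j jd; rewrite nth_mkseq.
Qed.

End Vertices.

End Convexity.

(** * Diameters under subdivision *)

Section SubdivisionMesh.
Variables (R : realType) (V : eqType) (dist : V -> V -> R) (bary : seq V -> V).

(** The intersection of all closed balls containing [l]. It serves in place of the convex hull and
    can be expressed by [dist] alone. *)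
Definition hull (l : seq V) (x : V) :=
  forall p r, (forall v, v \in l -> dist p v <= r) -> dist p x <= r.

Definition diam_le (e : R) (l : seq V) :=
  forall v w, v \in l -> w \in l -> dist v w <= e.

Hypotheses (dist_sym : forall v w, dist v w = dist w v)
  (distvv : forall v, dist v v = 0)
  (bary_hull : forall l, l != [::] -> hull l (bary l))
  (bary_close : forall n e l v, (size l <= n.+1)%N -> diam_le e l -> v \in l ->
     dist (bary l) v <= n%:R / n.+1%:R * e).

Lemma mem_hull l v : v \in l -> hull l v.
Proof. by move=> vl p r; apply. Qed.

Lemma hull_sub l m x : {subset l <= m} -> hull l x -> hull m x.
Proof. by move=> lm lx p r h; apply: lx => v vl; apply/h/lm. Qed.

Lemma mem_ldel i (l : seq V) : {subset ldel i l <= l}.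
Proof. by move=> v; rewrite mem_cat => /orP[/mem_take|/mem_drop]. Qed.

Lemma diam_le_sub e l m : {subset l <= m} -> diam_le e m -> diam_le e l.
Proof. by move=> lm h v w vl wl; apply: h; exact: lm. Qed.

(** The ball property is applied to each of the two points in turn: to balls around [x], then to
    balls around the points of [l]. *)
Lemma diam_le_hull e l m : (forall x, x \in m -> hull l x) -> diam_le e l -> diam_le e m.
Proof.
move=> ml le x y xm ym; apply: (ml _ ym) => v vl; rewrite dist_sym.
by apply: (ml _ xm) => w; exact: le.
Qed.

Lemma head_hull l x0 : l != [::] -> hull l (head x0 l).
Proof. by case: l => // x l _; apply: mem_hull; rewrite inE eqxx. Qed.

Lemma lsd_hull phi l :
  (forall m, size m = size l -> (forall x, x \in m -> hull l x) -> phi m = 0) ->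
  lsd bary phi l = 0.
Proof.
have [n] := ubnP (size l); elim: n l phi => [//|n IH] l phi sl h.
have [l0|l0] := eqVneq l [::]; first by rewrite l0 /lsd /= h // l0.
have l0' : (0 < size l)%N by rewrite lt0n size_eq0.
rewrite lsdE // ldeltaE big1_seq // => i; rewrite mem_index_iota => /andP[_ il].
rewrite (IH _ (consf phi (bary l))) ?mulr0 //; first by rewrite size_ldel //; lia.
move=> m sm mh; apply: h => /= [|x]; first by rewrite sm size_ldel //; lia.
rewrite inE => /orP[/eqP ->|/mh]; first exact: bary_hull.
exact/hull_sub/mem_ldel.
Qed.

Lemma lsdh_hull phi l :
  (forall m, (forall x, x \in m -> hull l x) -> phi m = 0) -> lsdh bary phi l = 0.
Proof.
have [n] := ubnP (size l); elim: n l phi => [//|n IH] l phi sl h.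
have [->//|l0] := eqVneq l [::].
have l0' : (0 < size l)%N by rewrite lt0n size_eq0.
have hcons m : (forall x, x \in m -> hull l x) -> consf phi (head (bary [::]) l) m = 0.
  move=> mh; apply: h => x; rewrite inE => /orP[/eqP ->|/mh//].
  exact: head_hull.
rewrite /lsdh lhomotopyE // hcons => [|x xl]; last exact: mem_hull.
rewrite lsd_hull => [|m _]; last exact: hcons.
rewrite ldeltaE big1_seq ?subr0 // => i; rewrite mem_index_iota => /andP[_ il].
rewrite [lhomotopy _ _ _ _ _](IH _ (consf phi _)) ?mulr0 //; first by rewrite size_ldel //; lia.
move=> m mh; apply: hcons => x /mh; exact/hull_sub/mem_ldel.
Qed.

Lemma lsdh_small e phi l : diam_le e l -> (forall m, diam_le e m -> phi m = 0) ->
  lsdh bary phi l = 0.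
Proof. by move=> le h; apply: lsdh_hull => m mh; apply: h; exact: diam_le_hull le. Qed.

(** A simplex of the subdivision is the barycenter followed by a simplex of a subdivided face.
    Distances among the latter are small by induction, distances to the barycenter by
    [bary_close]. *)
Lemma lsd_small n e phi l : (size l <= n.+1)%N -> diam_le e l -> 0 <= e ->
  (forall m, (size m <= n.+1)%N -> diam_le (n%:R / n.+1%:R * e) m -> phi m = 0) ->
  lsd bary phi l = 0.
Proof.
move=> ln le e0 h; set d := _ * e in h.
have d0 : 0 <= d by rewrite mulr_ge0 // divr_ge0.
(* The induction on faces has to remember that the small simplices stay in the hull of [l]; this is
   how [bary l] is seen to be close to their vertices. *)
have {h}: forall m, (size m <= size l)%N -> (forall x, x \in m -> hull l x) -> diam_le d m -> phi m = 0.
  by move=> m ml _; apply: h; exact: leq_trans ln.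
have [k] := ubnP (size l); elim: k l ln le phi => [//|k IH] l ln le phi lk h.
have [l0|l0] := eqVneq l [::]; first by rewrite l0 /lsd /= h.
have l0' : (0 < size l)%N by rewrite lt0n size_eq0.
rewrite lsdE // ldeltaE big1_seq // => i; rewrite mem_index_iota => /andP[_ il].
have sl := size_ldel il.
rewrite (IH _ _ _ (consf phi (bary l))) ?mulr0 //; try lia.
  apply: diam_le_sub le; exact: mem_ldel.
move=> m sm mh md; apply: h => /= [|x|x y].
- by rewrite sl in sm; lia.
- rewrite inE => /orP[/eqP ->|/mh]; first exact: bary_hull.
  exact/hull_sub/mem_ldel.
- have bd z : z \in m -> dist (bary l) z <= d.
    move=> /mh; apply => v /mem_ldel; exact: bary_close.
  rewrite !inE => /orP[/eqP->|xm] /orP[/eqP->|ym]; [by rewrite distvv| | |exact: md].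
    exact: bd.
  by rewrite dist_sym; exact: bd.
Qed.

Lemma iter_lsd_small n k e phi l : (size l <= n.+1)%N -> diam_le e l -> 0 <= e ->
  (forall m, diam_le ((n%:R / n.+1%:R) ^+ k * e) m -> phi m = 0) ->
  iter k (lsd bary) phi l = 0.
Proof.
move=> ln le e0 h.
have {}h m : (size m <= n.+1)%N -> diam_le ((n%:R / n.+1%:R) ^+ k * e) m -> phi m = 0.
  by move=> _; exact: h.
elim: k phi l ln le h => [|k IH] phi l ln le h /=.
  by apply: h => //; rewrite mul1r.
rewrite -iterS iterSr; apply: IH => // m mn me; apply: (lsd_small mn me) => [|m' m'n m'e].
  by rewrite mulr_ge0 // exprn_ge0 // divr_ge0.
by apply: h => //; rewrite exprS -mulrA.
Qed.

End SubdivisionMesh.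

(** * Naturality of subdivision in the vertices *)

Section ListNaturality.
Variables (V W : Type) (bV : seq V -> V) (bW : seq W -> W) (f : V -> W).
Hypothesis bf : forall l, (0 < size l)%N -> f (bV l) = bW (map f l).
Implicit Types (phi : seq W -> int) (l : seq V).
Local Notation pull phi := (fun m => phi (map f m)).

Lemma map_ldel i l : map f (ldel i l) = ldel i (map f l).
Proof. by rewrite /ldel map_cat map_take map_drop. Qed.

Lemma ldelta_map phi l : ldelta phi (map f l) = ldelta (pull phi) l.
Proof.
rewrite !ldeltaE size_map; apply: eq_bigr => i _.
by rewrite map_ldel.
Qed.

Lemma lsd_map phi l : lsd bW phi (map f l) = lsd bV (pull phi) l.
Proof.
have [n] := ubnP (size l); elim: n l phi => [//|n IH] l phi sl.
case: (posnP (size l)) => [/size0nil ->//|l0].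
rewrite !lsdE ?size_map // ldelta_map -bf //; apply: eq_ldelta => i il.
by rewrite IH // size_ldel //; lia.
Qed.

Lemma lsdh_map phi l : lsdh bW phi (map f l) = lsdh bV (pull phi) l.
Proof.
have [n] := ubnP (size l); elim: n l phi => [//|n IH] l phi sl.
case: (posnP (size l)) => [/size0nil ->//|l0].
have hd : head (bW [::]) (map f l) = f (head (bV [::]) l) by case: (l) l0.
rewrite /lsdh !lhomotopyE ?size_map // hd lsd_map ldelta_map; congr (_ - _).
apply: eq_ldelta => i il; apply: IH.
by rewrite size_ldel //; lia.
Qed.

Lemma iter_lsd_map k phi l : iter k (lsd bW) phi (map f l) = iter k (lsd bV) (pull phi) l.
Proof.
elim: k phi l => [//|k IH] phi l; rewrite !iterSr IH.
by congr (iter k _ _ l); apply/funext => m; exact: lsd_map.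
Qed.

Lemma lsdh_iter_map n phi l : lsdh_iter bW n phi (map f l) = lsdh_iter bV n (pull phi) l.
Proof.
apply: eq_bigr => j _; rewrite iter_lsd_map.
by congr (iter j _ _ l); apply/funext => m; exact: lsdh_map.
Qed.

End ListNaturality.

(** * Distances and barycenters in the standard simplex *)

Section SimplexGeometry.
Variable R : realType.

Lemma mx_norm_le m n (x : 'M[R]_(m, n)) r : 0 <= r ->
  (forall i j, `|x i j| <= r) -> `|x| <= r.
Proof.
by move=> r0 h; rewrite /Num.norm /= mx_normrE; apply/bigmax_leP; split=> // -[i j].
Qed.

Lemma mx_norm_entry m n (x : 'M[R]_(m, n)) i j : `|x i j| <= `|x|.
Proof.
by rewrite [leRHS]mx_normrE; exact: (le_bigmax _ (fun i => `|x i.1 i.2|) (i, j)).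
Qed.

Variable d : nat.
Implicit Types (x y : stdsimplex R d) (l : seq (stdsimplex R d)).

Definition sdist x y : R := `|val x - val y|.

Lemma sdistC x y : sdist x y = sdist y x.
Proof. exact: distrC. Qed.

Lemma sdistxx x : sdist x x = 0.
Proof. by rewrite /sdist subrr normr0. Qed.

Lemma simplex_ge0 p (t : stdsimplex R p) i : 0 <= val t 0 i.
Proof. by have /set_mem[+ _] := valP t; apply. Qed.

Lemma simplex_sum p (t : stdsimplex R p) : \sum_i val t 0 i = 1.
Proof. by have /set_mem[] := valP t. Qed.

Lemma aff_sub (f : nat -> stdsimplex R d) p (t : stdsimplex R p) x :
  val x - val (aff_fun f t) = \sum_(j < p.+1) val t 0 j *: (val x - val (f j)).
Proof.
under eq_bigr do rewrite scalerBr.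
by rewrite sumrB -scaler_suml simplex_sum scale1r.
Qed.

Lemma hull_aff l p (f : nat -> stdsimplex R d) (t : stdsimplex R p) :
  (forall j, (j <= p)%N -> f j \in l) -> hull sdist l (aff_fun f t).
Proof.
move=> fl x r h; rewrite /sdist aff_sub.
apply: le_trans (ler_norm_sum _ _ _) _.
rewrite -[r]mul1r -(simplex_sum t) mulr_suml; apply: ler_sum => j _.
by rewrite normrZ ger0_norm ?simplex_ge0// ler_wpM2l ?simplex_ge0// h // fl // -ltnS.
Qed.

Lemma centroid_subproof p : (const_mx (p.+1%:R^-1) : 'rV[R]_p.+1) \in stdsimplex R p.
Proof.
apply/mem_set; split=> [i|]; first by rewrite mxE invr_ge0.
under eq_bigr do rewrite mxE.
by rewrite sumr_const card_ord -[LHS]mulr_natr mulVf // pnatr_eq0.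
Qed.

Definition centroid p : stdsimplex R p := SigSub (centroid_subproof p).

Definition sbary l : stdsimplex R d :=
  aff_fun (nth (svert R d 0) l) (centroid (size l).-1).

Lemma sbary_hull l : l != [::] -> hull sdist l (sbary l).
Proof.
by case: l => // x l _; apply: hull_aff => j jl; apply: mem_nth.
Qed.

Lemma sbary_close n e l x : (size l <= n.+1)%N -> diam_le sdist e l -> x \in l ->
  sdist (sbary l) x <= n%:R / n.+1%:R * e.
Proof.
move=> ln le xl.
have e0 : 0 <= e by rewrite -(sdistxx x) le.
have l0 : (0 < size l)%N by case: (l) xl.
set i0 := index x l; have i0l : (i0 < (size l).-1.+1)%N by rewrite prednK // index_mem.
(* In the weighted sum of the differences [x - v] the term of [x] itself vanishes. There remain
   [(size l).-1] terms of weight [(size l)^-1], whence the factor [n / (n + 1)]. *)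
rewrite sdistC /sdist aff_sub (bigD1 (Ordinal i0l)) //= nth_index // subrr scaler0 add0r.
apply: le_trans (ler_norm_sum _ _ _) _.
apply: (@le_trans _ _ (\sum_(i < (size l).-1.+1 | i != Ordinal i0l) (size l)%:R^-1 * e)).
  apply: ler_sum => i _; rewrite mxE normrZ ger0_norm ?invr_ge0 //.
  have il : (i < size l)%N by rewrite (leq_trans (ltn_ord i)) // prednK.
  rewrite (_ : (size l).-1.+1 = size l) ?prednK // in i il *.
  by rewrite ler_wpM2l ?invr_ge0 // le // mem_nth.
rewrite sumr_const -[leLHS]mulr_natl mulrA ler_wpM2r //.
rewrite (_ : #|_| = (size l).-1); last first.
  by rewrite [LHS](cardC1 (Ordinal i0l)) card_ord.
case sl: (size l) l0 ln => [//|N] _ /=; rewrite ltnS => Nn.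
rewrite ler_pdivrMr // mulrAC ler_pdivlMr // -!natrM ler_nat; nia.
Qed.

End SimplexGeometry.

Section Lebesgue.
Variable R : realType.

Lemma stdsimplex_compact d : compact (stdsimplex R d).
Proof.
have box : compact [set v : 'rV[R]_d.+1 | forall i, `[0, 1]%classic (v ord0 i)].
  by apply: (@rV_compact R _ (fun=> `[0, 1]%classic)) => i; exact: segment_compact.
apply: (subclosed_compact _ box).
- rewrite (_ : stdsimplex R d = (\bigcap_i [set t | 0 <= t 0 i]) `&` [set t | \sum_i t 0 i = 1]).
    apply: closedI.
      apply: closed_bigI => i _.
      by apply: (@preimage_closed _ _ (fun t : 'rV[R]_d.+1 => t 0 i) [set r | 0 <= r]) => [t _|];
        [exact: coord_continuous|exact: closed_ge].
    apply: (@preimage_closed _ _ (fun t : 'rV[R]_d.+1 => \sum_i t 0 i) [set 1]) => [t _|].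
      by apply: (@continuous_sumr R) => i _; exact: coord_continuous.
    exact: closed_eq.
  by apply/seteqP; split=> t [t0 t1]; split=> // i; [move=> _; exact: t0|exact: t0].
- move=> t [t0 t1] i; rewrite /= in_itv /= t0 /= -t1 (bigD1 i) //= lerDl.
  by apply: sumr_ge0.
Qed.

(** A Lebesgue number for a cover by two open sets. Compactness enters through near coverings along
    the filter [0^'+] of radii: a radius that works near each point yields one that works
    everywhere. *)
Lemma simplex_lebesgue (X : topologicalType) (U V : set X) d (s : simplex R X d) :
  open U -> open V -> (forall t, U (s t) \/ V (s t)) ->
  exists2 e : R, 0 < e & forall x, (forall y, sdist x y < e -> U (s y)) \/
                               (forall y, sdist x y < e -> V (s y)).
Proof.
move=> oU oV UV.
have /compact_near_coveringP := @stdsimplex_compact d.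
pose P (e : R) (x : 'rV[R]_d.+1) := (forall y, `|x - val y| < e -> U (s y)) \/
                               (forall y, `|x - val y| < e -> V (s y)).
move=> /(_ _ (0^'+ : set_system R) P _).
have key (W : set X) (t : stdsimplex R d) : open W -> W (s t) ->
    exists2 r : R, 0 < r & forall y, `|val t - val y| < r -> W (s y).
  move=> oW Wt.
  have : nbhs t (s @^-1` W).
    by apply: (@cts_fun _ _ s); exact: open_nbhs_nbhs.
  move=> /nbhs_ballP[r r0 rW]; exists r => // y yr; apply: rW.
  by rewrite -[ball t r y]/(ball (val t) r (val y)) -ball_normE.
case.
- move=> t /mem_set tD; pose t' : stdsimplex R d := SigSub tD.
  suff : exists2 r : R, 0 < r & (forall y, `|val t' - val y| < r -> U (s y)) \/
      (forall y, `|val t' - val y| < r -> V (s y)).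
    move=> [r r0 rUV].
    have r2 : 0 < r / 2 by rewrite divr_gt0.
    (* Half of the radius is spent on moving the center from [t] to [x], the other half bounds
       [e]. *)
    exists (ball t (r / 2), [set e | e < r / 2]) => [|[x e] /= [xt er]].
      by split; [exact: nbhsx_ballx|exact: nbhs_right_lt].
    have sub y : `|x - val y| < e -> `|val t' - val y| < r.
      move=> xy; rewrite (splitr r) (le_lt_trans (ler_distD x _ _)) // ltrD //.
        by move: xt; rewrite -ball_normE.
      exact: lt_trans er.
    by case: rUV => h; [left|right] => y /sub; exact: h.
  by case: (UV t') => /key[]// r r0 h; exists r => //; [left|right].
- move=> e /= e0 h; have e2 : 0 < e / 2 by rewrite divr_gt0.
  exists (e / 2) => // x; apply: (h (e / 2)) => //=; last exact/set_mem/valP.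
  by rewrite sub0r normrN gtr0_norm // gtr_pMr // invf_lt1 // ltr1n.
Qed.

End Lebesgue.

(** * Small simplices and the Mayer-Vietoris sequence *)

Section ListSize.
Variables (V W : Type) (A B : (seq W -> int) -> seq V -> int) (apex : seq V -> W).
Hypotheses
  (A_size : forall phi l, (forall m, size m = size l -> phi m = 0) -> A phi l = 0)
  (B_size : forall phi l, (forall m, size m = size l -> phi m = 0) -> B phi l = 0).

(** A homotopy shifts the degree by exactly one. This is what bounds the degrees of the cochains
    constructed from it. *)
Lemma lhomotopy_size phi l : (forall m, size m = (size l).+1 -> phi m = 0) ->
  lhomotopy A B apex phi l = 0.
Proof.
have [n] := ubnP (size l); elim: n l phi => [//|n IH] l phi sl h.
case: (posnP (size l)) => [/size0nil ->//|l0].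
have h' m : size m = size l -> consf phi (apex l) m = 0 by move=> ml; apply: h; rewrite /= ml.
rewrite lhomotopyE // A_size // B_size // ldeltaE big1_seq ?subr0 // => i.
rewrite mem_index_iota => /andP[_ il].
rewrite IH ?mulr0 // ?size_ldel //; first by lia.
by rewrite prednK.
Qed.

Variable bary : seq V -> V.

Lemma lsd_size phi l : (forall m, size m = size l -> phi m = 0) -> lsd bary phi l = 0.
Proof.
have [n] := ubnP (size l); elim: n l phi => [//|n IH] l phi sl h.
case: (posnP (size l)) => [/size0nil l0|l0]; first by rewrite l0 /lsd /= h // l0.
rewrite lsdE // ldeltaE big1_seq // => i; rewrite mem_index_iota => /andP[_ il].
rewrite IH ?mulr0 // ?size_ldel //; first by lia.
by move=> m sm; apply: h; rewrite /= sm prednK.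
Qed.

End ListSize.

Section Small.
Variable V : Type.

Lemma lsdh_iter_size (bary : seq V -> V) n phi l :
  (forall m, size m = (size l).+1 -> phi m = 0) -> lsdh_iter bary n phi l = 0.
Proof.
move=> h; apply: big1 => j _.
have {}h m : size m = size l -> lsdh bary phi m = 0.
  move=> ml; apply: lhomotopy_size => [psi k|psi k|k]; [exact|exact: lsd_size|].
  by rewrite ml; exact: h.
elim: j (lsdh bary phi) h => [|j IH] psi h; first exact: h.
rewrite iterSr; apply: IH => m ml; apply: lsd_size => k km.
by apply: h; rewrite km.
Qed.

End Small.

Section FaceMaps.
Variable R : realType.

Lemma lin_vertex_row p q d (g : 'I_p.+1 -> 'I_q.+1) (f : nat -> 'rV[R]_p.+1) (t : stdsimplex R d) :
  vertex_row g (lin_fun f t) = lin_fun (fun j => vertex_row g (f j)) t.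
Proof.
apply/rowP => i; rewrite /lin_fun summxE mxE.
under eq_bigr do rewrite summxE.
rewrite exchange_big; apply: eq_bigr => j _ /=; rewrite !mxE mulr_sumr.
by apply: eq_bigr => k _; rewrite mxE.
Qed.

Lemma aff_vertex_map p q d (g : 'I_p.+1 -> 'I_q.+1) f (t : stdsimplex R d) :
  vertex_map g (aff_fun f t) = aff_fun (fun j => vertex_map g (f j)) t.
Proof. by apply: val_inj; exact: lin_vertex_row. Qed.

Lemma vertex_map_svert p q (g : 'I_p.+1 -> 'I_q.+1) (i : nat) :
  vertex_map g (svert R p i) = svert R q (g (inord i)).
Proof.
apply: val_inj; apply/rowP => j; rewrite /= !mxE inord_val.
rewrite (bigID (pred1 (inord i))) /= [X in _ + X]big1 ?addr0 => [|k /andP[_ /negPf ki]]; last first.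
  by rewrite mxE ki.
have [<-|gj] := eqVneq (g (inord i)) j.
  rewrite (eq_bigl (pred1 (inord i))) => [|k]; first by rewrite big_pred1_eq mxE eqxx.
  by rewrite /=; case: (k =P inord i) => [->|]; rewrite ?eqxx ?andbF.
rewrite big_pred0 // => k; case: (k =P inord i) => [->|]; last by rewrite andbF.
by rewrite (negPf gj).
Qed.

Variable d : nat.
Local Notation face_map i := (@vertex_map R d d.+1 (@lift d.+2 i)).

Lemma face_map_sverts (i : 'I_d.+2) : map (face_map i) (sverts R d) = ldel i (sverts R d.+1).
Proof.
have i2 := ltn_ord i.
apply: (@eq_from_nth _ (svert R d.+1 0)); first by rewrite size_map size_ldel !size_mkseq.
move=> j; rewrite size_map size_mkseq => jd.
rewrite (nth_map (svert R d 0)) ?size_mkseq // nth_mkseq // [LHS]vertex_map_svert /=.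
rewrite /ldel nth_cat size_take size_mkseq i2 /bump inordK //.
case: leqP => ij.
  by rewrite nth_drop nth_mkseq; [congr svert|]; lia.
by rewrite nth_take // nth_mkseq // ltnW.
Qed.

Lemma face_map_sbary (i : 'I_d.+2) l : (0 < size l)%N -> face_map i (sbary l) = sbary (map (face_map i) l).
Proof.
case: l => // x l _; rewrite /sbary size_map [LHS]aff_vertex_map; apply: val_inj; apply: eq_lin => j jl.
by congr val; rewrite [RHS](nth_map x) //; congr (face_map i _); exact: set_nth_default.
Qed.

Lemma sdist_face_map (i : 'I_d.+2) x y : sdist (face_map i x) (face_map i y) <= sdist x y.
Proof.
apply: mx_norm_le => [|a b]; [exact: normr_ge0|rewrite (ord1 a) !mxE -sumrB].
case: (unliftP i b) => [j ->|->].
  rewrite (big_pred1 j) => [|k]; last exact/inj_eq/lift_inj.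
  by have := mx_norm_entry (val x - val y) 0 j; rewrite !mxE.
rewrite big_pred0 ?normr0; [exact: normr_ge0|move=> k].
by rewrite eq_sym; exact/negbTE/neq_lift.
Qed.

Lemma cev_face (X : topologicalType) (c : cochain R X) (s : simplex R X d.+1) i l :
  cev (convex_simplex R d) c (face s i) l = cev (convex_simplex R d.+1) c s (map (face_map i) l).
Proof.
case: l => [//|x l]; rewrite /cev /= size_map; congr (c _ _).
apply/continuousEP => t /=; congr (s _); rewrite [LHS]aff_vertex_map.
apply: val_inj; apply: eq_lin => j jl; congr val.
exact/esym/(@nth_map _ x _ (face_map i x) (face_map i) j (x :: l)).
Qed.

End FaceMaps.

Section Vanishing.
Variables (R : realType) (M : topologicalType).
Implicit Types (A U V : set M) (c : cochain R M).

Definition lands A d (s : simplex R M d) := forall t, A (s t).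

(* The cohomology of a subspace [A] is described by cochains of the ambient space,
   taken modulo those vanishing on the simplices that land in [A]. *)
Definition vanish A c := forall d (s : simplex R M d), lands A s -> c d s = 0.

Lemma lands_restr A d e (s : simplex R M d) (g : 'I_e.+1 -> 'I_d.+1) :
  lands A s -> lands A (restr s g).
Proof. by move=> sA t; exact: sA. Qed.

Lemma vanish0 A : vanish A 0.
Proof. by []. Qed.

Lemma vanishD A c c' : vanish A c -> vanish A c' -> vanish A (c + c').
Proof. by move=> h h' d s sA; rewrite cochainD h ?h'. Qed.

Lemma vanishN A c : vanish A c -> vanish A (- c).
Proof. by move=> h d s sA; rewrite cochainN h ?oppr0. Qed.

Lemma vanishB A c c' : vanish A c -> vanish A c' -> vanish A (c - c').
Proof. by move=> h /vanishN; exact: vanishD. Qed.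

Lemma vanishMl A c c' : vanish A c -> vanish A (c * c').
Proof. by move=> h d s sA; apply: big1 => i _; rewrite h ?mul0r //; exact: lands_restr. Qed.

Lemma vanishMr A c c' : vanish A c' -> vanish A (c * c').
Proof. by move=> h d s sA; apply: big1 => i _; rewrite h ?mulr0 //; exact: lands_restr. Qed.

Lemma vanish_coboundary A c : vanish A c -> vanish A (coboundary c).
Proof.
move=> h [//|d] s sA; apply: big1 => i _; rewrite h ?mulr0 //; exact: lands_restr.
Qed.

Lemma vanish_parity A c : vanish A c -> vanish A (parity c).
Proof. by move=> h d s sA; rewrite -[LHS]/((-1) ^+ d * c d s) h ?mulr0. Qed.

Lemma vanish_sub A U c : A `<=` U -> vanish U c -> vanish A c.
Proof. by move=> AU h d s sA; apply: h => t; exact/AU/sA. Qed.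

(** Cochains are arbitrary functions on simplices, so this glues without any compatibility. The
    price is that the coboundary of the result is controlled only on simplices landing in one of the
    two sets. *)
Definition glue A c c' : cochain R M.
Proof.
apply: (@mk_cochain _ _ (fun d s => if `[< lands A s >] then c d s else c' d s)).
have [N cN] := cochain_boundP c; have [N' cN'] := cochain_boundP c'.
exists (maxn N N') => d s; rewrite geq_max => /andP[Nd Nd'].
by rewrite cN // cN' // if_same.
Defined.

Lemma glue1 A c c' : vanish A (glue A c c' - c).
Proof.
move=> d s sA; rewrite cochainD cochainN.
rewrite -[glue A c c' d s]/(if `[< lands A s >] then c d s else c' d s).
by rewrite asboolT // subrr.
Qed.

Lemma glue2 A U c c' : vanish (A `&` U) (c - c') -> vanish U (glue A c c' - c').
Proof.
move=> h d s sU; rewrite cochainD cochainN.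
rewrite -[glue A c c' d s]/(if `[< lands A s >] then c d s else c' d s).
case: asboolP => sA; last by rewrite subrr.
by apply: h => t; split; [exact: sA|exact: sU].
Qed.

End Vanishing.

Section SmallSimplices.
Variables (R : realType) (M : topologicalType) (U V : set M).
Hypotheses (oU : open U) (oV : open V).
Implicit Types (c w : cochain R M).

Local Notation cv d := (cev (convex_simplex R d)).

(* Affine simplices of mesh at most [(d / (d + 1)) ^+ m] are mapped into [U] or
   into [V]. *)
Definition fine d (s : simplex R M d) (m : nat) := forall w l,
  vanish U w -> vanish V w -> diam_le (@sdist R d) ((d%:R / d.+1%:R) ^+ m) l ->
  cv d w s l = 0.

Lemma cev_vanish A d (s : simplex R M d) w l :
  vanish A w -> (forall p (f : nat -> stdsimplex R d), lands A (s \o aff p f : simplex R M p)) ->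
  cv d w s l = 0.
Proof. by case: l => [//|x l] wA h; apply: wA; exact: h. Qed.

Lemma rate_ge0 d : 0 <= d%:R / d.+1%:R :> R.
Proof. by rewrite divr_ge0. Qed.

Lemma rate_lt1 d : d%:R / d.+1%:R < 1 :> R.
Proof. by rewrite ltr_pdivrMr // mul1r ltr_nat. Qed.

Lemma fine_exists d (s : simplex R M d) : lands (U `|` V) s -> exists m, fine s m.
Proof.
move=> sUV; have [e e0 he] := simplex_lebesgue oU oV sUV.
have [m hm] : exists m, (d%:R / d.+1%:R) ^+ m < e.
  have z1 : `|d%:R / d.+1%:R : R| < 1 by rewrite ger0_norm ?rate_ge0 // rate_lt1.
  have /cvgrPdist_lt/(_ e e0)[m _ hm] := cvg_geometric 1 z1.
  exists m; have := hm m (leqnn m).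
  by rewrite /= sub0r normrN mul1r ger0_norm // exprn_ge0 // rate_ge0.
exists m => w [//|x l] wU wV dl; rewrite /cev.
(* The whole affine simplex lies in the ball of radius [e] about its first vertex [x], hence is
   mapped into one of the two sets. *)
have xx (t : stdsimplex R (size l)) : sdist x (aff_fun (nth x (x :: l)) t) < e.
  apply: le_lt_trans hm; apply: (@hull_aff _ _ (x :: l)) => [j jl|v vl].
    exact: mem_nth.
  by apply: dl => //; rewrite inE eqxx.
by case: (he x) => h; [apply: wU|apply: wV] => t; apply: h; exact: xx.
Qed.

Lemma fineS d (s : simplex R M d) m n : (m <= n)%N -> fine s m -> fine s n.
Proof.
move=> mn h w l wU wV dl; apply: h => // x y xl yl; apply: le_trans (dl _ _ xl yl) _.
by rewrite ler_wiXn2l // ?rate_ge0 // ltW // rate_lt1.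
Qed.

(** The rate [d / (d + 1)] increases with [d], so lists that are small for the face are also small
    for [s]. *)
Lemma fine_face d (s : simplex R M d.+1) m i : fine s m -> fine (face s i) m.
Proof.
move=> h w l wU wV dl; rewrite cev_face; apply: h => // _ _ /mapP[x xl ->] /mapP[y yl ->].
apply: le_trans (sdist_face_map _ _ _) _; apply: le_trans (dl _ _ xl yl) _.
rewrite lerXn2r ?nnegrE ?rate_ge0 //.
by rewrite ler_pdivrMr // mulrAC ler_pdivlMr // -!natrM ler_nat; nia.
Qed.

(** The least number of subdivisions that makes [s] fine. Minimality gives 0 for simplices already
    inside [U] or [V], and a value on faces not exceeding that on the simplex. *)
Definition mesh d (s : simplex R M d) : nat :=
  if pselect (exists m, `[< fine s m >]) is left h then ex_minn h else 0%N.

Lemma fine_mesh d (s : simplex R M d) : lands (U `|` V) s -> fine s (mesh s).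
Proof.
move=> /fine_exists[m sm]; rewrite /mesh; case: pselect => [h|[]]; last by exists m; exact/asboolP.
by case: ex_minnP => k /asboolP.
Qed.

Lemma mesh_le d (s : simplex R M d) m : fine s m -> (mesh s <= m)%N.
Proof. by move=> sm; rewrite /mesh; case: pselect => // h; case: ex_minnP => k _; apply; exact/asboolP. Qed.

Lemma mesh0 d (s : simplex R M d) : lands U s \/ lands V s -> mesh s = 0%N.
Proof.
move=> h; apply/eqP; rewrite -leqn0; apply: mesh_le => w l wU wV _.
by case: h => h; [apply: cev_vanish wU _|apply: cev_vanish wV _] => p f t; exact: h.
Qed.

(** Each simplex is subdivided as often as it requires. The numbers for a simplex and for its faces
    may differ, and [small_homotopyP] has to absorb the difference. *)
Definition small_homotopy c : cochain R M.
Proof.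
apply: (@mk_cochain _ _ (fun d s => lsdh_iter (@sbary R d) (mesh s) (cv d c s) (sverts R d))).
have [N cN] := cochain_boundP c; exists N => d s Nd; apply: lsdh_iter_size => -[//|x l].
by rewrite size_mkseq => -[sl]; rewrite /cev cN // sl ltnW.
Defined.

Lemma small_homotopyE c d (s : simplex R M d) :
  small_homotopy c d s = lsdh_iter (@sbary R d) (mesh s) (cv d c s) (sverts R d).
Proof. by []. Qed.

Lemma small_homotopy_vanish A c : vanish A c -> vanish A (small_homotopy c).
Proof.
move=> h d s sA; apply: lsdh_iter_size => m _.
by apply: cev_vanish h _ => p f t; exact: sA.
Qed.

Lemma small_homotopy0 c : vanish U (small_homotopy c) /\ vanish V (small_homotopy c).
Proof. by split=> d s sA; rewrite small_homotopyE mesh0 ?[LHS]big_geq //; [left|right]. Qed.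

Lemma sverts_diam d : diam_le (@sdist R d) 1 (sverts R d).
Proof.
move=> x y _ _; apply: mx_norm_le => // i j; rewrite (ord1 i) !mxE.
have le1 (z : stdsimplex R d) : val z 0 j <= 1.
  by rewrite -(simplex_sum z) (bigD1 j) //= lerDl sumr_ge0 // => k _; exact: simplex_ge0.
have := le1 x; have := le1 y; have := simplex_ge0 x j; have := simplex_ge0 y j.
by rewrite ler_norml; lra.
Qed.

(** In [lsdh_iterP] with [mesh s] subdivisions the fully subdivided term vanishes because [w] is
    zero on small simplices. What remains is to replace [mesh s] by the mesh of each face in the
    boundary term. *)
Lemma small_homotopyP w : vanish U w -> vanish V w ->
  vanish (U `|` V) (w - coboundary (small_homotopy w) - small_homotopy (coboundary w)).
Proof.
move=> wU wV d s sUV; rewrite !cochainD !cochainN small_homotopyE.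
have -> : lsdh_iter (@sbary R d) (mesh s) (cv d (coboundary w) s) (sverts R d) =
    w d s - ldelta (lsdh_iter (@sbary R d) (mesh s) (cv d w s)) (sverts R d).
  have := lsdh_iterP (@sbary R d) (mesh s) (cv d w s) (sverts R d).
  rewrite [iter _ _ _ _](@iter_lsd_small R _ (@sdist R d) _ (@sdistC R d) (@sdistxx R d)
    (@sbary_hull R d) (@sbary_close R d) d _ 1); last first.
  - by move=> m; rewrite mulr1; exact: fine_mesh.
  - by [].
  - exact: sverts_diam.
  - by rewrite size_mkseq.
  rewrite cev_sverts subr0 => <-; rewrite addrK; congr (lsdh_iter _ _ _ _).
  by apply/funext => l; exact: cev_delta.
rewrite opprB addrC addrA subrK.
case: d s sUV => [|d] s sUV.
  by rewrite subr0 /= [lsdh_iter _ _ _ _]big1 ?subr0 // => j _; elim: j.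
rewrite ldeltaE size_mkseq big_mkord -sumrB big1 // => i _.
rewrite small_homotopyE -mulrBr -face_map_sverts.
rewrite (lsdh_iter_map (@face_map_sbary R d i)).
rewrite [X in lsdh_iter _ _ X _](_ : _ = cv d w (face s i)); last first.
  by apply/funext => l; rewrite cev_face.
have sfUV : lands (U `|` V) (face s i) by exact: lands_restr.
have le : (mesh (face s i) <= mesh s)%N by apply: mesh_le; exact/fine_face/fine_mesh.
(* The two homotopies on the face differ by the terms with [j] between the two meshes. There the
   face is already fine, and [lsdh] does not enlarge diameters, so these terms vanish. *)
rewrite /lsdh_iter (big_cat_nat (leq0n _) le) //= addrAC subrr add0r big1_seq ?mulr0 // => j.
rewrite mem_index_iota => /andP[_ /andP[mj _]].
apply: (@iter_lsd_small R _ (@sdist R d) _ (@sdistC R d) (@sdistxx R d)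
    (@sbary_hull R d) (@sbary_close R d) d _ 1) => //.
- by rewrite size_mkseq.
- exact: sverts_diam.
move=> m; rewrite mulr1 => dm.
apply: (@lsdh_small R _ (@sdist R d) _ (@sdistC R d) (@sbary_hull R d) _ _ _ dm) => k dk.
exact: (fineS mj (fine_mesh sfUV) wU wV dk).
Qed.

End SmallSimplices.

Section RelativeCohomology.
Variables (R : realType) (M : topologicalType).
Implicit Types (A U V : set M) (c e : cochain R M).

Lemma coboundaryD c e : coboundary (c + e) = coboundary c + coboundary e.
Proof. exact: (raddfD (@coboundary R M)). Qed.

Lemma coboundaryN c : coboundary (- c) = - coboundary c.
Proof. exact: (raddfN (@coboundary R M)). Qed.

Lemma coboundaryB c e : coboundary (c - e) = coboundary c - coboundary e.
Proof. exact: (raddfB (@coboundary R M)). Qed.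

Lemma coboundary0 : coboundary 0 = 0 :> cochain R M.
Proof. exact: (raddf0 (@coboundary R M)). Qed.

Definition cocyc A c := vanish A (coboundary c).

Definition cohom A c c' := exists e, vanish A (c - c' - coboundary e).

Lemma cohom_vanish A c c' : vanish A (c - c') -> cohom A c c'.
Proof. by move=> h; exists 0; rewrite coboundary0 subr0. Qed.

Lemma cohom_refl A c : cohom A c c.
Proof. by apply: cohom_vanish; rewrite subrr; exact: vanish0. Qed.

Lemma cohom_sym A c c' : cohom A c c' -> cohom A c' c.
Proof.
move=> [e he]; exists (- e); rewrite coboundaryN -(opprB c c') -opprD.
exact: vanishN.
Qed.

Lemma cohomD A c1 c1' c2 c2' :
  cohom A c1 c1' -> cohom A c2 c2' -> cohom A (c1 + c2) (c1' + c2').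
Proof.
move=> [e he] [e' he']; exists (e + e'); rewrite coboundaryD !opprD.
rewrite [X in vanish _ (X + _)]addrACA [X in vanish _ X]addrACA.
exact: vanishD.
Qed.

Lemma cohomN A c c' : cohom A c c' -> cohom A (- c) (- c').
Proof.
move=> [e he]; exists (- e); rewrite coboundaryN -!opprD; exact: vanishN.
Qed.

Lemma cohomB A c1 c1' c2 c2' :
  cohom A c1 c1' -> cohom A c2 c2' -> cohom A (c1 - c2) (c1' - c2').
Proof. by move=> h /cohomN; exact: cohomD.
Qed.

Lemma cohom_subr A c c' : cohom A c c' <-> cohom A (c - c') 0.
Proof. by split=> -[e he]; exists e; move: he; rewrite subr0. Qed.

Lemma cohom_trans A c1 c2 c3 : cohom A c1 c2 -> cohom A c2 c3 -> cohom A c1 c3.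
Proof.
move=> /cohom_subr h /cohom_subr h'; apply/cohom_subr.
have -> : c1 - c3 = (c1 - c2) + (c2 - c3) by rewrite addrA subrK.
by rewrite -[0]addr0; exact: cohomD.
Qed.

Lemma cohom_sum A (I : Type) (r : seq I) (P : pred I) (F G : I -> cochain R M) :
  (forall i, P i -> cohom A (F i) (G i)) ->
  cohom A (\sum_(i <- r | P i) F i) (\sum_(i <- r | P i) G i).
Proof.
move=> h; apply: (big_ind2 (cohom A)) => //; first exact: cohom_refl.
by move=> x x' y y' xx yy; exact: cohomD.
Qed.

Lemma cohom_sub A U c c' : A `<=` U -> cohom U c c' -> cohom A c c'.
Proof. by move=> AU [e he]; exists e; exact: vanish_sub he. Qed.

Lemma cocyc_cohom A c c' : cohom A c c' -> cocyc A c -> cocyc A c'.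
Proof.
move=> [e /vanish_coboundary he] h; rewrite /cocyc -[coboundary c'](subrK (coboundary c)).
apply: vanishD => //; rewrite -opprB; apply: vanishN.
by move: he; rewrite !coboundaryB coboundaryK subr0.
Qed.

Lemma cocycD A c c' : cocyc A c -> cocyc A c' -> cocyc A (c + c').
Proof. by rewrite /cocyc coboundaryD; exact: vanishD. Qed.

Lemma cocycN A c : cocyc A c -> cocyc A (- c).
Proof. by rewrite /cocyc coboundaryN; exact: vanishN. Qed.

Lemma cocycB A c c' : cocyc A c -> cocyc A c' -> cocyc A (c - c').
Proof. by rewrite /cocyc coboundaryB; exact: vanishB. Qed.

Lemma cocyc0 A : cocyc A 0.
Proof. by rewrite /cocyc coboundary0; exact: vanish0. Qed.

Lemma cocyc1 A : cocyc A 1.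
Proof.
have /cocycleP h : (1 : cochain R M) \in cocycle R M by exact: rpred1.
by rewrite /cocyc h; exact: vanish0.
Qed.

Lemma cocycM A c c' : cocyc A c -> cocyc A c' -> cocyc A (c * c').
Proof.
by move=> h h'; rewrite /cocyc coboundary_cup; apply: vanishD; [exact: vanishMl|exact: vanishMr].
Qed.

Lemma cocyc_sum A (I : Type) (r : seq I) (P : pred I) (F : I -> cochain R M) :
  (forall i, P i -> cocyc A (F i)) -> cocyc A (\sum_(i <- r | P i) F i).
Proof. by move=> h; apply: (big_ind (cocyc A)) => //; [exact: cocyc0|exact: cocycD]. Qed.

Lemma cocyc_parity A c : cocyc A c -> cocyc A (parity c).
Proof. by move=> h; rewrite /cocyc coboundary_parity; exact/vanishN/vanish_parity. Qed.

Lemma cocyc_coboundary A c : cocyc A (coboundary c).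
Proof. by rewrite /cocyc coboundaryK; exact: vanish0. Qed.

Lemma cocyc_sub A U c : A `<=` U -> cocyc U c -> cocyc A c.
Proof. by move=> AU; exact: vanish_sub. Qed.

Lemma cocyc_mulrz A c (m : int) : cocyc A c -> cocyc A (c *~ m).
Proof.
have nat (n : nat) : cocyc A c -> cocyc A (c *+ n).
  by move=> h; elim: n => [|n IH]; rewrite ?mulrS; [exact: cocyc0|exact: cocycD].
by case: m => m h; [exact: nat|rewrite NegzE mulrNz; exact/cocycN/nat].
Qed.

Lemma cohom_mulrz A c c' (m : int) : cohom A c c' -> cohom A (c *~ m) (c' *~ m).
Proof.
have nat (n : nat) : cohom A c c' -> cohom A (c *+ n) (c' *+ n).
  move=> h; elim: n => [|n IH]; first exact: cohom_refl.
  by rewrite !mulrS; exact: cohomD.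
by case: m => m h; [exact: nat|rewrite NegzE !mulrNz; exact/cohomN/nat].
Qed.

Lemma cohomMl A b c c' : cocyc A b -> cohom A c c' -> cohom A (b * c) (b * c').
Proof.
(* [parity] cancels the sign of the Leibniz rule; the other term of the rule contains the coboundary
   of [b], which vanishes on [A]. *)
move=> hb [e he]; exists (parity b * e).
have -> : b * c - b * c' - coboundary (parity b * e) =
    b * (c - c' - coboundary e) + parity (coboundary b) * e.
  rewrite coboundary_cup parityK coboundary_parity mulNr !mulrBr.
  by rewrite opprD opprK [parity _ * e - _]addrC addrA.
apply: vanishD; first exact: vanishMr.
exact/vanishMl/vanish_parity.
Qed.

Lemma cohomMr A b c c' : cocyc A b -> cohom A c c' -> cohom A (c * b) (c' * b).
Proof.
move=> hb [e he]; exists (e * b).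
have -> : c * b - c' * b - coboundary (e * b) =
    (c - c' - coboundary e) * b - parity e * coboundary b.
  by rewrite coboundary_cup opprD addrA !mulrBl.
apply: vanishB; first exact: vanishMl.
exact: vanishMr.
Qed.

Lemma cohomM A b b' c c' : cocyc A b -> cocyc A c' ->
  cohom A b b' -> cohom A c c' -> cohom A (b * c) (b' * c').
Proof.
by move=> hb hc bb cc; apply: cohom_trans (cohomMr hc bb); exact: cohomMl.
Qed.

Lemma cohom_parity A c c' : cohom A c c' -> cohom A (parity c) (parity c').
Proof.
have pD (x y : cochain R M) : parity (x + y) = parity x + parity y.
  by apply/cochainP => d s; rewrite cochainD; exact: mulrDr.
have pN (x : cochain R M) : parity (- x) = - parity x.
  by apply/cochainP => d s; rewrite cochainN; exact: mulrN.
move=> [e he]; exists (- parity e).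
by rewrite coboundaryN coboundary_parity opprK -!pN -!pD; exact: vanish_parity.
Qed.

Section MayerVietoris.
Variables (U V : set M).
Hypotheses (oU : open U) (oV : open V).

Lemma vanishU_coboundary A c e : cocyc A c -> vanish A (coboundary (c - coboundary e)).
Proof. by move=> h; rewrite coboundaryB coboundaryK subr0. Qed.

(** The coboundary [w] of the set-theoretic gluing vanishes on [U] and on [V]. Subtracting
    [small_homotopy U V w] makes the gluing a cocycle on the union, and changes nothing on [U] or
    [V] because the correction is zero there. *)
Lemma mv_glue c1 c2 : cocyc U c1 -> cocyc V c2 -> vanish (U `&` V) (c1 - c2) ->
  exists z, [/\ cocyc (U `|` V) z, vanish U (z - c1) & vanish V (z - c2)].
Proof.
move=> hc1 hc2 hW; pose g := glue U c1 c2.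
have gU : vanish U (g - c1) by exact: glue1.
have gV : vanish V (g - c2) by exact: glue2.
have dg A c : vanish A (g - c) -> cocyc A c -> cocyc A g.
  move=> /vanish_coboundary h hc; rewrite /cocyc -(subrK (coboundary c) (coboundary g)).
  by apply: vanishD => //; rewrite -coboundaryB.
pose w := coboundary g.
have [D0U D0V] := small_homotopy0 U V w.
exists (g - small_homotopy U V w); split.
- have := small_homotopyP oU oV (dg _ _ gU hc1) (dg _ _ gV hc2).
  rewrite (coboundaryK g) /cocyc coboundaryB => h.
  have h0 : vanish (U `|` V) (small_homotopy U V (0 : cochain R M)).
    by apply: small_homotopy_vanish; exact: vanish0.
  by rewrite -[coboundary g - _](subrK (small_homotopy U V 0)); exact: vanishD.
- by rewrite addrAC; exact: vanishB.
- by rewrite addrAC; exact: vanishB.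
Qed.

(** After gluing the primitives, the difference between [c] and the coboundary of the result
    vanishes on [U] and on [V]; by [small_homotopyP] it is a coboundary on the union. *)
Lemma mv_exact c e1 e2 : cocyc (U `|` V) c ->
  vanish U (c - coboundary e1) -> vanish V (c - coboundary e2) ->
  vanish (U `&` V) (e1 - e2) -> cohom (U `|` V) c 0.
Proof.
move=> hc h1 h2 hW; pose e := glue U e1 e2.
have eU : vanish U (c - coboundary e).
  have -> : c - coboundary e = (c - coboundary e1) - coboundary (e - e1).
    by rewrite coboundaryB opprB addrA subrK.
  by apply: vanishB => //; exact/vanish_coboundary/glue1.
have eV : vanish V (c - coboundary e).
  have -> : c - coboundary e = (c - coboundary e2) - coboundary (e - e2).
    by rewrite coboundaryB opprB addrA subrK.
  by apply: vanishB => //; exact/vanish_coboundary/glue2.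
set w := c - coboundary e in eU eV.
exists (e + small_homotopy U V w).
rewrite subr0 coboundaryD opprD addrA -/w.
rewrite -(subrK (small_homotopy U V (coboundary w)) (w - _)).
apply: vanishD; first exact: small_homotopyP.
exact/small_homotopy_vanish/vanishU_coboundary.
Qed.

End MayerVietoris.

End RelativeCohomology.

Section Pullback.
Variables (R : realType) (N M : topologicalType) (f : continuousType N M).
Implicit Types (c : cochain R M).

Lemma pull_simplex_restr d e (s : simplex R N d) (g : 'I_e.+1 -> 'I_d.+1) :
  pull_simplex f (restr s g) = restr (pull_simplex f s) g.
Proof. exact/continuousEP. Qed.

Lemma pull_zmod_morphism : zmod_morphism (@pull_cochain R N M f).
Proof. by move=> c c'; exact/cochainP. Qed.
HB.instance Definition _ := GRing.isZmodMorphism.Build (cochain R M) (cochain R N)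
  (@pull_cochain R N M f) pull_zmod_morphism.

Lemma pull_monoid_morphism : monoid_morphism (@pull_cochain R N M f).
Proof.
split=> [|c c']; first exact/cochainP.
apply/cochainP => d s; apply: eq_bigr => i _.
by rewrite /front /back -!pull_simplex_restr.
Qed.
HB.instance Definition _ := GRing.isMonoidMorphism.Build (cochain R M) (cochain R N)
  (@pull_cochain R N M f) pull_monoid_morphism.

Lemma pullM c c' : pull_cochain f (c * c') = pull_cochain f c * pull_cochain f c'.
Proof. by have [_ ->] := pull_monoid_morphism. Qed.

Lemma pull0 : pull_cochain f 0 = 0 :> cochain R N.
Proof. exact: (raddf0 (pull_cochain f)). Qed.

Lemma pullD c c' : pull_cochain f (c + c') = pull_cochain f c + pull_cochain f c'.
Proof. exact: (raddfD (pull_cochain f)). Qed.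

Lemma pullB c c' : pull_cochain f (c - c') = pull_cochain f c - pull_cochain f c'.
Proof. exact: (raddfB (pull_cochain f)). Qed.

Lemma pullN c : pull_cochain f (- c) = - pull_cochain f c.
Proof. exact: (raddfN (pull_cochain f)). Qed.

Lemma pull_mulrz c m : pull_cochain f (c *~ m) = pull_cochain f c *~ m.
Proof. exact: (raddfMz (pull_cochain f)). Qed.

Lemma pull1 : pull_cochain f 1 = 1 :> cochain R N.
Proof. by have [-> _] := pull_monoid_morphism. Qed.

Lemma pull_parity c : pull_cochain f (parity c) = parity (pull_cochain f c).
Proof. exact/cochainP. Qed.

Variables (C : set N) (A : set M).
Hypothesis fCA : forall x, C x -> A (f x).

Lemma pull_vanish c : vanish A c -> vanish C (pull_cochain f c).
Proof. by move=> h d s sC; apply: h => t; exact: fCA. Qed.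

Lemma pull_cocyc c : cocyc A c -> cocyc C (pull_cochain f c).
Proof. by rewrite /cocyc pull_coboundary; exact: pull_vanish. Qed.

Lemma pull_cohom c c' : cohom A c c' -> cohom C (pull_cochain f c) (pull_cochain f c').
Proof.
move=> [e he]; exists (pull_cochain f e).
by rewrite pull_coboundary -!raddfB; exact: pull_vanish.
Qed.

End Pullback.

Lemma pull_comp (R : realType) (X Y Z : topologicalType) (f : continuousType X Y)
    (g : continuousType Y Z) (c : cochain R Z) :
  pull_cochain f (pull_cochain g c) = pull_cochain (g \o f : continuousType X Z) c.
Proof.
apply/cochainP => d s; rewrite -[LHS]/(c d (pull_simplex g (pull_simplex f s))).
by rewrite -[RHS]/(c d (pull_simplex _ s)); congr (c _ _); exact/continuousEP.
Qed.

Lemma eq_pull (R : realType) (X Y : topologicalType) (f g : continuousType X Y)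
    (c : cochain R Y) : f =1 g -> pull_cochain f c = pull_cochain g c.
Proof. by move=> /continuousEP ->. Qed.

Lemma pull_id (R : realType) (X : topologicalType) (f : continuousType X X)
    (c : cochain R X) : f =1 id -> pull_cochain f c = c.
Proof.
move=> fid; apply/cochainP => d s; rewrite -[LHS]/(c d (pull_simplex f s)).
by congr (c _ _); apply/continuousEP => t /=; rewrite fid.
Qed.

(** * Homotopy invariance and graded commutativity *)

Section HomotopyNaturality.
Variables (V V' W W' : Type).
Variables (A B : (seq W -> int) -> seq V -> int) (A' B' : (seq W' -> int) -> seq V' -> int).
Variables (apex : seq V -> W) (apex' : seq V' -> W') (f : V -> V') (g : W -> W').
Hypotheses
  (Ag : forall phi l, A' phi (map f l) = A (fun m => phi (map g m)) l)
  (Bg : forall phi l, B' phi (map f l) = B (fun m => phi (map g m)) l)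
  (apexg : forall l, (0 < size l)%N -> g (apex l) = apex' (map f l)).

Lemma lhomotopy_map phi l :
  lhomotopy A' B' apex' phi (map f l) = lhomotopy A B apex (fun m => phi (map g m)) l.
Proof.
have [n] := ubnP (size l); elim: n l phi => [//|n IH] l phi sl.
case: (posnP (size l)) => [/size0nil ->//|l0].
rewrite !lhomotopyE ?size_map // Ag Bg -apexg //; congr (_ - _).
rewrite ldelta_map; apply: eq_ldelta => i il; apply: IH.
by rewrite size_ldel //; lia.
Qed.

End HomotopyNaturality.

Section HomotopyInvariance.
Variables (R : realType) (N M : topologicalType) (C : set N) (A : set M).

Section Prism.
Variable H : continuousType (R * N)%type M.
Hypothesis HCA : forall t x, C x -> A (H (t, x)).

Local Notation prism d := (R * stdsimplex R d)%type.

Lemma prism_map_continuous d (s : simplex R N d) :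
  continuous (fun z : prism d => H (z.1, s z.2)).
Proof.
move=> z; apply: (@continuous_comp _ _ _ (fun z : prism d => (z.1, s z.2)) H); last exact: cts_fun.
apply: (@continuous_pair (prism d) R N fst (fun z => s z.2)).
  by move=> ?; exact: cvg_fst.
move=> y; apply: (@continuous_comp _ _ _ snd s); first exact: cvg_snd.
exact: cts_fun.
Qed.

Definition prism_map d (s : simplex R N d) : continuousType (prism d) M :=
  mkcts (@prism_map_continuous d s).

(** The dual of the prism operator: a homotopy between the restrictions to the two ends, where the
    prism over a simplex is coned off at the first vertex of its bottom. *)
Definition prism_op d (phi : seq (prism d) -> int) (l : seq (stdsimplex R d)) : int :=
  lhomotopy (fun phi l => phi (map (pair (1 : R)) l)) (fun phi l => phi (map (pair (0 : R)) l))
    (fun l => (0 : R, head (svert R d 0) l)) phi l.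

Local Notation cp d := (cev (convex_prism R d)).

Lemma prism_op_size d (phi : seq (prism d) -> int) l :
  (forall m, size m = (size l).+1 -> phi m = 0) -> prism_op phi l = 0.
Proof.
by move=> h; apply: lhomotopy_size => // psi k h'; apply: h'; rewrite size_map.
Qed.

Lemma prism_opP d (phi : seq (prism d) -> int) l :
  prism_op (ldelta phi) l + ldelta (prism_op phi) l =
    phi (map (pair (1 : R)) l) - phi (map (pair (0 : R)) l).
Proof.
apply: (lhomotopyP (A := fun phi l => phi (map (pair (1 : R)) l))
  (B := fun phi l => phi (map (pair (0 : R)) l))) => // psi k; exact: ldelta_map.
Qed.

Lemma prism_op_map d e (f : stdsimplex R d -> stdsimplex R e) (phi : seq (prism e) -> int) l :
  prism_op phi (map f l) = prism_op (fun m => phi (map (fun z => (z.1, f z.2)) m)) l.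
Proof.
apply: lhomotopy_map => [psi k|psi k|[]//]; by rewrite -!map_comp.
Qed.

Definition prism_cochain (c : cochain R M) : cochain R N.
Proof.
apply: (@mk_cochain _ _ (fun d s => prism_op (cp d c (prism_map s)) (sverts R d))).
have [n cn] := cochain_boundP c; exists n => d s nd; apply: prism_op_size => -[//|x l].
by rewrite size_mkseq => -[sl]; rewrite /cev cn // sl ltnW.
Defined.

Lemma prism_slice (t : R) d (s : simplex R N d) (f : continuousType N M) c :
  (forall x, f x = H (t, x)) ->
  cp d c (prism_map s) (map (pair t) (sverts R d)) = pull_cochain f c d s.
Proof.
move=> fH; rewrite (@cevE _ _ _ _ _ _ (t, svert R d 0) d) ?size_map ?size_iota //.
rewrite -[RHS]/(c d (pull_simplex f s)); congr (c _ _); apply/continuousEP => x /=.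
have E j : (j <= d)%N -> nth (t, svert R d 0) (map (pair t) (sverts R d)) j = (t, svert R d j).
  by move=> jd; rewrite (nth_map (svert R d 0)) ?size_mkseq // nth_mkseq.
rewrite fH /=; congr (H (_, s _)); rewrite /paff_fun /=.
  rewrite -[RHS]mul1r -(simplex_sum x) mulr_suml; apply: eq_bigr => j _.
  by congr (_ * _); apply: (congr1 fst (E j _)); rewrite -ltnS.
rewrite -[RHS]aff_svert; apply: val_inj; apply: eq_lin => j jd.
exact: (congr1 (fun z => val z.2) (E j jd)).
Qed.

Lemma prism_cochainP (f0 f1 : continuousType N M) c :
  (forall x, f0 x = H (0, x)) -> (forall x, f1 x = H (1, x)) -> cocyc A c ->
  vanish C (pull_cochain f1 c - pull_cochain f0 c - coboundary (prism_cochain c)).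
Proof.
move=> h0 h1 hc d s sC; rewrite !cochainD !cochainN.
rewrite -(prism_slice s c h0) -(prism_slice s c h1).
(* All affine simplices of the prism are mapped into [A], where [c] is a cocycle; so the term with
   [ldelta] inside disappears. *)
rewrite -prism_opP [X in X + _ - _]prism_op_size ?add0r => [|m _]; last first.
  by rewrite -cev_delta; case: m => [//|x m]; apply: hc => y; exact: HCA.
case: d s sC => [|d] s sC; first by rewrite /= !subrr.
rewrite ldeltaE size_mkseq big_mkord -sumrB big1 // => i _.
rewrite -mulrBr -face_map_sverts prism_op_map.
set fm := vertex_map (lift i).
rewrite -[prism_cochain c d _]/(prism_op (cp d c (prism_map (face s i))) (sverts R d)).
rewrite [X in prism_op X _ - _](_ : _ = cp d c (prism_map (face s i))) ?subrr ?mulr0 //.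
apply/funext => -[//|x l]; rewrite /cev /= size_map; congr (c _ _).
have E j : (j <= size l)%N -> nth (x.1, fm x.2) (map (fun z => (z.1, fm z.2)) (x :: l)) j =
    ((nth x (x :: l) j).1, fm (nth x (x :: l) j).2).
  by move=> jl; rewrite (nth_map x).
apply/continuousEP => t; apply: (congr2 (fun a b => H (a, s b))).
  apply: eq_bigr => j _; congr (_ * _).
  by apply: (congr1 fst (E j _)); rewrite -ltnS.
rewrite [RHS]aff_vertex_map; apply: val_inj; apply: eq_lin => j jl.
exact: (congr1 (fun z => val z.2) (E j jl)).
Qed.

End Prism.

(** The truncation of [t] to the unit interval. The prism has the whole line as a factor, whereas a
    homotopy is asked to map [C] into [A] only for [0 <= t <= 1]. *)
Let clamp (t : R) : R := (`|t| - `|t - 1| + 1) * 2^-1.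

Let clamp_bounds t : 0 <= clamp t <= 1.
Proof.
by rewrite /clamp; case: (ler0P t) => t0; case: (ler0P (t - 1)) => t1; apply/andP; split; lra.
Qed.

Let clamp0 : clamp 0 = 0.
Proof. by rewrite /clamp normr0 !sub0r normrN normr1 addNr mul0r. Qed.

Let clamp1 : clamp 1 = 1.
Proof. by rewrite /clamp subrr normr0 subr0 normr1; lra. Qed.

Let clamp_continuous : continuous (fun z : R * N => (clamp z.1, z.2)).
Proof.
have c1 : continuous (fun z : R * N => z.1) by move=> ?; exact: cvg_fst.
apply: continuous_pair; last by move=> ?; exact: cvg_snd.
apply: continuous_mulr; last exact: cst_continuous.
apply: continuous_addr; last exact: cst_continuous.
apply: continuous_addr; first exact: continuous_normr.
apply/continuous_oppr/continuous_normr/continuous_addr => //; exact: cst_continuous.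
Qed.

Lemma pull_homotopic (H : R * N -> M) (f0 f1 : continuousType N M) (c : cochain R M) :
  continuous H ->
  (forall t x, 0 <= t <= 1 -> C x -> A (H (t, x))) ->
  (forall x, f0 x = H (0, x)) -> (forall x, f1 x = H (1, x)) -> cocyc A c ->
  cohom C (pull_cochain f0 c) (pull_cochain f1 c).
Proof.
move=> cH HCA h0 h1 hc.
have cH' : continuous (fun z : R * N => H (clamp z.1, z.2)).
  move=> z; apply: continuous_comp; last exact: cH.
  exact: clamp_continuous.
apply: cohom_sym; exists (prism_cochain (mkcts cH') c); apply: prism_cochainP => //=.
- by move=> t x Cx; apply: HCA.
- by move=> x; rewrite h0; exact: (congr1 (fun a => H (a, x)) (esym clamp0)).
- by move=> x; rewrite h1; exact: (congr1 (fun a => H (a, x)) (esym clamp1)).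
Qed.

End HomotopyInvariance.

Section Reversal.
Variables (R : realType) (M : topologicalType).
Implicit Types (A : set M) (c x y : cochain R M).

(* [c] composed with the reversal of the vertices, with the sign making it a
   cochain map. *)
Definition reversal c : cochain R M.
Proof.
apply: (@mk_cochain _ _ (fun d s => (-1) ^+ 'C(d.+1, 2) * subeval c s d (subn d))).
have [n cn] := cochain_boundP c; exists n => d s nd.
by rewrite /subeval cn ?mulr0.
Defined.

Definition reversal_cochain c : cochain R M.
Proof.
apply: (@mk_cochain _ _ (fun d s => lrevh (svert R d 0) (cev (convex_simplex R d) c s) (sverts R d))).
have [n cn] := cochain_boundP c; exists n => d s nd; apply: lhomotopy_size => [phi l|phi l h|[//|x l]].
- exact.
- by rewrite /lrev h ?mulr0 ?size_rev.
- by rewrite size_mkseq => -[sl]; rewrite /cev cn // sl ltnW.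
Defined.

Lemma cohom_reversal A c : cocyc A c -> cohom A c (reversal c).
Proof.
move=> hc; exists (reversal_cochain c) => d s sA; rewrite !cochainD !cochainN.
have -> : reversal c d s = lrev (cev (convex_simplex R d) c s) (sverts R d).
  rewrite /lrev size_mkseq (@cevE _ _ _ _ _ _ (svert R d 0) d) ?size_rev ?size_mkseq //.
  rewrite -[LHS]/(_ * subeval c s d (subn d)); congr (_ * c _ _).
  apply/continuousEP => t; congr (s _).
  rewrite -[t in LHS]aff_svert [LHS]aff_vertex_map; apply: val_inj; apply: eq_lin => j jd.
  congr val; rewrite nth_rev ?size_mkseq // nth_mkseq; last by lia.
  by rewrite vertex_map_svert subSS !inordK // ltnS ?leq_subr.
have := lrevhP (svert R d 0) (cev (convex_simplex R d) c s) (sverts R d).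
rewrite cev_sverts => <-.
rewrite [lrevh _ _ _](lhomotopy_size (A := fun phi => phi)) ?add0r; last first.
- by move=> m _; rewrite -cev_delta; apply: cev_vanish hc _ => p f t; exact: sA.
- by move=> phi l h; rewrite /lrev h ?mulr0 ?size_rev.
- by move=> phi l; exact.
case: d s sA => [|d] s sA; first by rewrite /= !subrr.
rewrite ldeltaE size_mkseq big_mkord -sumrB big1 // => i _.
rewrite -mulrBr -face_map_sverts.
rewrite -[reversal_cochain c d _]/(lrevh _ _ (sverts R d)).
rewrite [X in X - _](lhomotopy_map (A := fun phi => phi) (B := @lrev _)
  (apex := head (svert R d 0)) (f := vertex_map (lift i)) (g := vertex_map (lift i))) //; last 2 first.
- by move=> phi l; rewrite /lrev size_map map_rev.
- by case.
rewrite [X in X - lrevh _ _ _](_ : _ = lrevh (svert R d 0) (cev (convex_simplex R d) c (face s i)) (sverts R d)).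
  by rewrite subrr mulr0.
congr (lhomotopy _ _ _ _ _); apply/funext => l.
by rewrite cev_face.
Qed.

Lemma subeval_reversal c d (s : simplex R M d) p g :
  subeval (reversal c) s p g = (-1) ^+ 'C(p.+1, 2) * subeval c s p (g \o subn p).
Proof.
rewrite -[LHS]/(_ * subeval c _ p (subn p)); congr (_ * _).
by rewrite subeval_comp // => j _; exact: leq_subr.
Qed.

Lemma cochain_subeval c d (s : simplex R M d) p g :
  subeval c s p g = c p (restr s (fun j => inord (g j))).
Proof. by []. Qed.

(** Reversal exchanges front and back faces. The sign is the discrepancy ['C(p + q + 1, 2) - 'C(p +
    1, 2) - 'C(q + 1, 2) = p * q]. *)
Lemma reversal_cup p q x y : homogeneous_cochain p x -> homogeneous_cochain q y ->
  reversal (y * x) = (-1) ^+ (p * q) * (reversal x * reversal y).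
Proof.
move=> hx hy; apply/cochainP => d s.
have -> z : ((-1) ^+ (p * q) * z : cochain R M) d s = (-1) ^+ (p * q) * z d s.
  rewrite -signr_odd -[X in _ = X * _]signr_odd; case: (odd _).
    by rewrite expr1 mulN1r cochainN mulN1r.
  by rewrite expr0 !mul1r.
rewrite -[LHS]/(_ * subeval (y * x) s d (subn d)) subeval_cup cupE !mulr_sumr.
rewrite big_nat_rev; apply: eq_big_nat => i /andP[_ ltid].
rewrite add0n subSS subKn // !subeval_reversal.
have [ip|ip] := eqVneq i p; last first.
  by rewrite !cochain_subeval (hx i) ?(hx _ (restr _ _)) ?mulr0 ?mul0r ?mulr0 //; exact/eqP.
have [dq|dq] := eqVneq (d - i)%N q; last first.
  by rewrite !cochain_subeval (hy (d - i)%N) ?(hy _ (restr _ _)) ?mulr0 ?mul0r ?mulr0 //; exact/eqP.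
have -> : subeval y s (d - i) (subn d) = subeval y s (d - i) (addn i \o subn (d - i)).
  by apply: eq_subeval => j jd /=; lia.
have -> : subeval x s i (subn d \o addn (d - i)) = subeval x s i (id \o subn i).
  by apply: eq_subeval => j jd /=; lia.
have -> : 'C(d.+1, 2) = ('C(i.+1, 2) + 'C((d - i).+1, 2) + p * q)%N.
  rewrite -dq -ip -[in LHS](subnKC (_ : i <= d)%N) //.
  move: (d - i)%N => k; rewrite !binS !bin1.
  elim: k => [|k IH]; first by rewrite addn0 muln0 bin0n; lia.
  by rewrite addnS !binS !bin1; lia.
by rewrite !exprD; ring.
Qed.

(** On cocycles the reversal is cohomologous to the identity, and it reverses products; so both
    sides may be compared after reversal. *)
Lemma cohom_cupC A p q x y : homogeneous_cochain p x -> homogeneous_cochain q y ->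
  cocyc A x -> cocyc A y -> cohom A (x * y) ((-1) ^+ (p * q) * (y * x)).
Proof.
move=> hx hy zx zy.
have rx := cohom_reversal zx; have ry := cohom_reversal zy.
have h1 : cohom A (x * y) (reversal x * reversal y).
  by apply: cohomM => //; exact: cocyc_cohom ry zy.
have h2 : cohom A ((-1) ^+ (p * q) * (y * x)) ((-1) ^+ (p * q) * reversal (y * x)).
  apply: cohomMl; last exact/cohom_reversal/cocycM.
  by rewrite -signr_odd; case: (odd _); [exact/cocycN/cocyc1|exact: cocyc1].
apply: cohom_trans h1 _; apply: cohom_sym; apply: cohom_trans h2 _.
rewrite (reversal_cup hx hy) mulrA -exprD addnn -mul2n exprM sqrrN !expr1n mul1r.
exact: cohom_refl.
Qed.

End Reversal.

(** * Free cohomology over a base *)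

Section Freeness.
Variable R : realType.

Section Definitions.
Variables (M P : topologicalType) (p : continuousType M P) (B : set P) (A : set M).
Implicit Types (a : nat -> cochain R M) (b c : cochain R M).

(* The cohomology of [A] is a free left module over that of [B], along [p], with
   basis the classes of [a 0, ..., a r.-1]. *)
Record free_over r a : Prop := FreeOver {
  free_cocyc : forall i, (i < r)%N -> cocyc A (a i);
  free_span : forall c, cocyc A c -> exists beta : nat -> cochain R P, (forall i, cocyc B (beta i)) /\
    cohom A c (\sum_(i < r) pull_cochain p (beta i) * a i);
  free_indep : forall beta : nat -> cochain R P, (forall i, cocyc B (beta i)) ->
    cohom A (\sum_(i < r) pull_cochain p (beta i) * a i) 0 ->
    forall i, (i < r)%N -> cohom B (beta i) 0 }.

Definition unit_and b : nat -> cochain R M := fun i => if i is 0%N then 1 else b.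

Lemma free1_span a c : a 0%N = 1 -> free_over 1 a -> cocyc A c ->
  exists2 beta, cocyc B beta & cohom A c (pull_cochain p beta).
Proof.
move=> a0 [_ sp _] /sp[beta [hb h]]; exists (beta 0%N) => //.
by move: h; rewrite big_ord1 a0 mulr1.
Qed.

Lemma free1_indep a (beta : cochain R P) : a 0%N = 1 -> free_over 1 a -> cocyc B beta ->
  cohom A (pull_cochain p beta) 0 -> cohom B beta 0.
Proof.
move=> a0 [_ _ ind] hb h; apply: (ind (fun=> beta) _ _ 0%N) => //.
by rewrite big_ord1 a0 mulr1.
Qed.

Lemma free2_span b c : free_over 2 (unit_and b) -> cocyc A c ->
  exists beta1 beta2, [/\ cocyc B beta1, cocyc B beta2 &
    cohom A c (pull_cochain p beta1 + pull_cochain p beta2 * b)].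
Proof.
move=> [_ sp _] /sp[beta [hb h]]; exists (beta 0%N), (beta 1%N); split=> //.
by move: h; rewrite !big_ord_recl big_ord0 addr0 mulr1.
Qed.

Lemma free2_indep b (beta1 beta2 : cochain R P) : free_over 2 (unit_and b) -> cocyc B beta1 -> cocyc B beta2 ->
  cohom A (pull_cochain p beta1 + pull_cochain p beta2 * b) 0 ->
  cohom B beta1 0 /\ cohom B beta2 0.
Proof.
move=> [_ _ ind] h1 h2 h.
have {}ind := ind (fun i => if i is 0%N then beta1 else beta2).
split; [apply: (ind _ _ 0%N)|apply: (ind _ _ 1%N)] => //.
- by case.
- by rewrite !big_ord_recl big_ord0 addr0 mulr1.
- by case.
- by rewrite !big_ord_recl big_ord0 addr0 mulr1.
Qed.

Lemma free1I a : (forall c, cocyc A c -> exists2 beta, cocyc B beta & cohom A c (pull_cochain p beta)) ->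
  (forall beta : cochain R P, cocyc B beta -> cohom A (pull_cochain p beta) 0 -> cohom B beta 0) ->
  a 0%N = 1 -> free_over 1 a.
Proof.
move=> sp ind a0; split.
- by case=> // _; rewrite a0; exact: cocyc1.
- by move=> c /sp[beta hb h]; exists (fun=> beta); split=> //; rewrite big_ord1 a0 mulr1.
- by move=> beta hb; rewrite big_ord1 a0 mulr1 => h [|//] _; exact: ind.
Qed.

Lemma free2I b :
  cocyc A b ->
  (forall c, cocyc A c -> exists beta1 beta2, [/\ cocyc B beta1, cocyc B beta2 &
    cohom A c (pull_cochain p beta1 + pull_cochain p beta2 * b)]) ->
  (forall beta1 beta2 : cochain R P, cocyc B beta1 -> cocyc B beta2 ->
    cohom A (pull_cochain p beta1 + pull_cochain p beta2 * b) 0 ->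
    cohom B beta1 0 /\ cohom B beta2 0) ->
  free_over 2 (unit_and b).
Proof.
move=> hb sp ind; split.
- by move=> [|[|//]] _ //=; exact: cocyc1.
- move=> c /sp[b1 [b2 [h1 h2 h]]]; exists (fun i => if i is 0%N then b1 else b2); split=> [[]//|].
  by rewrite !big_ord_recl big_ord0 addr0 mulr1.
- move=> beta hbeta; rewrite !big_ord_recl big_ord0 addr0 mulr1 => /ind[//|//|h1 h2].
  by move=> [|[|//]].
Qed.

Lemma eq_free r a a' : (forall i, (i < r)%N -> cohom A (a i) (a' i)) ->
  (forall x, A x -> B (p x)) -> free_over r a -> free_over r a'.
Proof.
move=> aa pAB [za sp ind].
have e (beta : nat -> cochain R P) : (forall i, cocyc B (beta i)) ->
   cohom A (\sum_(i < r) pull_cochain p (beta i) * a i) (\sum_(i < r) pull_cochain p (beta i) * a' i).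
  move=> hb; apply: cohom_sum => i _; apply: cohomMl; last exact: aa.
  exact: pull_cocyc pAB _ _.
split.
- by move=> i ir; exact: cocyc_cohom (aa i ir) (za i ir).
- move=> c /sp[beta [hb h]]; exists beta; split=> //; exact: cohom_trans h (e _ hb).
- by move=> beta hb h; apply: ind => //; exact: cohom_trans (e _ hb) h.
Qed.

End Definitions.

Lemma free_id (P : topologicalType) (B : set P) (a : nat -> cochain R P) (p : continuousType P P) :
  p =1 id -> a 0%N = 1 -> free_over p B B 1 a.
Proof.
move=> pid a0; apply: free1I => // [c hc|beta hb].
  by exists c => //; rewrite pull_id //; exact: cohom_refl.
by rewrite pull_id.
Qed.

Section Transport.
Variables (M M' P : topologicalType) (p : continuousType M P) (p' : continuousType M' P).
Variables (B : set P) (A : set M) (A' : set M').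
Variables (f : continuousType M M') (g : continuousType M' M).
Variables (H : R * M -> M) (K : R * M' -> M').
Hypotheses (fA : forall x, A x -> A' (f x)) (gA : forall x, A' x -> A (g x)).
Hypotheses (pf : forall x, p' (f x) = p x) (pA' : forall x, A' x -> B (p' x)).
Hypotheses (cH : continuous H) (HA : forall t x, 0 <= t <= 1 -> A x -> A (H (t, x)))
  (H0 : forall x, H (0, x) = g (f x)) (H1 : forall x, H (1, x) = x).
Hypotheses (cK : continuous K) (KA : forall t x, 0 <= t <= 1 -> A' x -> A' (K (t, x)))
  (K0 : forall x, K (0, x) = f (g x)) (K1 : forall x, K (1, x) = x).

(** Coefficients from the base are carried along [f], which commutes with the projections; [g]
    serves as its inverse up to homotopy. Spanning is checked after pulling back along [g], and so
    is independence. *)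
Lemma free_transport r (a : nat -> cochain R M') :
  free_over p' B A' r a -> free_over p B A r (fun i => pull_cochain f (a i)).
Proof.
move=> [za sp ind].
have fg (c : cochain R M) : cocyc A c -> cohom A (pull_cochain f (pull_cochain g c)) c.
  move=> hc; rewrite pull_comp -[X in cohom _ _ X](@pull_id _ _ (idfun : continuousType M M)) //.
  by apply: (pull_homotopic cH HA) => // x; rewrite ?H0 ?H1.
have gf (c : cochain R M') : cocyc A' c -> cohom A' (pull_cochain g (pull_cochain f c)) c.
  move=> hc; rewrite pull_comp -[X in cohom _ _ X](@pull_id _ _ (idfun : continuousType M' M')) //.
  by apply: (pull_homotopic cK KA) => // x; rewrite ?K0 ?K1.
have fsum (beta : nat -> cochain R P) : pull_cochain f (\sum_(i < r) pull_cochain p' (beta i) * a i) =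
    \sum_(i < r) pull_cochain p (beta i) * pull_cochain f (a i).
  rewrite raddf_sum; apply: eq_bigr => i _.
  rewrite /= pullM; congr (_ * _).
  by rewrite pull_comp; apply: eq_pull => x; exact: pf.
split.
- by move=> i ir; apply: pull_cocyc fA _ _; exact: za.
- move=> c hc; have /sp[beta [hb h]] := pull_cocyc gA hc.
  exists beta; split=> //; rewrite -fsum.
  by apply: cohom_trans (cohom_sym (fg _ hc)) _; exact: pull_cohom fA _ _ h.
- move=> beta hb; rewrite -fsum => h i ir; apply: ind => //.
  set S := \sum_(i < r) _ in h *.
  have hS : cocyc A' S by apply: cocyc_sum => j _; apply: cocycM; [exact: pull_cocyc pA' _ _|exact: za].
  apply: cohom_trans (cohom_sym (gf _ hS)) _.
  by rewrite -(pull0 _ g); exact: pull_cohom gA _ _ h.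
Qed.

End Transport.

Section Steps.
Variables (M P : topologicalType) (p : continuousType M P) (B : set P) (U V : set M).
Hypotheses (oU : open U) (oV : open V)
  (pU : forall x, U x -> B (p x)) (pV : forall x, V x -> B (p x)).
Local Notation W := (U `&` V).
Local Notation X := (U `|` V).
Local Notation pb := (pull_cochain p).
Implicit Types (b c : cochain R M).

Let UX : U `<=` X. Proof. by move=> x; left. Qed.
Let VX : V `<=` X. Proof. by move=> x; right. Qed.
Let WU : W `<=` U. Proof. by move=> x []. Qed.
Let WV : W `<=` V. Proof. by move=> x []. Qed.
Let pW x : W x -> B (p x). Proof. by move=> [/pU]. Qed.
Let pX x : X x -> B (p x). Proof. by move=> [/pU|/pV]. Qed.

(** Multiplication by a class of the base commutes with the coboundary up to a sign, which [parity]
    absorbs. *)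
Lemma pull_mul_coboundary A (beta : cochain R P) u :
  (forall x, A x -> B (p x)) -> cocyc B beta ->
  vanish A (coboundary (pb (parity beta) * u) - pb beta * coboundary u).
Proof.
move=> pA hb; rewrite coboundary_cup pull_parity parityK addrK.
apply: vanishMl; rewrite coboundary_parity; apply/vanishN/vanish_parity.
exact: pull_cocyc pA _ hb.
Qed.

Variable one : nat -> cochain R M.
Hypothesis one0 : one 0%N = 1.
Hypotheses (fU : free_over p B U 1 one) (fV : free_over p B V 1 one).

Section Suspension.
Variables (a z u v : cochain R M).
Hypotheses (fW : free_over p B W 2 (unit_and a)) (zX : cocyc X z)
  (zu : vanish U (z - coboundary u)) (zv : vanish V (z - coboundary v))
  (uv : vanish W (u - v - a)).

Let pmul_z A (beta : cochain R P) w : (forall x, A x -> B (p x)) -> cocyc B beta ->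
  vanish A (z - coboundary w) ->
  vanish A (pb beta * z - coboundary (pb (parity beta) * w)).
Proof.
move=> pA hb zw.
have -> : pb beta * z - coboundary (pb (parity beta) * w) =
    pb beta * (z - coboundary w) - (coboundary (pb (parity beta) * w) - pb beta * coboundary w).
  by rewrite opprB mulrBr addrA subrK.
apply: vanishB; [exact: vanishMr|exact: pull_mul_coboundary].
Qed.

(** [z] is the image of [a] under the Mayer-Vietoris connecting map: [u] and [v] are its primitives
    on the two sets, and they differ by [a] on the overlap. As [U] and [V] have the cohomology of
    the base, the coefficient of [z] on the union corresponds to that of [a] on the overlap. *)
Lemma free_suspension : free_over p B X 2 (unit_and z).
Proof.
have onX beta : cocyc B beta -> cocyc X (pb beta) by move=> hb; exact: pull_cocyc pX _ hb.
have zU0 beta : cocyc B beta -> cohom U (pb beta * z) 0.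
  by move=> hb; exists (pb (parity beta) * u); rewrite subr0; exact: pmul_z.
apply: free2I => //.
- move=> c hc.
  have [g hg cg] := free1_span one0 fU (cocyc_sub UX hc).
  have /cohom_subr cgU := cg.
  have hcg : cocyc X (c - pb g) by apply: cocycB => //; exact: onX.
  have [g' hg' cg'] := free1_span one0 fV (cocyc_sub VX hcg).
  (* [c - pb g] is exact on [U], hence on [W], and independence of [1] and [a] there shows that its
     coefficient [g'] on [V] is zero as well. *)
  have g'0 : cohom B g' 0.
    have hg'2 : cohom B g' 0 /\ cohom B (0 : cochain R P) 0.
      apply: (free2_indep fW) => //; first exact: cocyc0.
      rewrite pull0 mul0r addr0.
      apply: cohom_trans (cohom_sym (cohom_sub WV cg')) _.
      exact: cohom_sub WU cgU.
    exact: hg'2.1.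
  have [u' hu'] := cgU.
  have [v' hv'] : cohom V (c - pb g) 0.
    by apply: cohom_trans cg' _; rewrite -(pull0 _ p); exact: pull_cohom pV _ _ g'0.
  rewrite subr0 in hu'; rewrite subr0 in hv'.
  have huv : cocyc W (u' - v').
    rewrite /cocyc coboundaryB -[coboundary u'](subrK (c - pb g)) -addrA.
    apply: vanishD; last exact: vanish_sub WV hv'.
    by rewrite -opprB; apply: vanishN; exact: vanish_sub WU hu'.
  (* The difference of the two primitives on [W] has a coefficient [be] at [a]; up to parity it is
     the coefficient of [z]. The remaining part [pb e + coboundary w] extends over [U] and is
     subtracted from the primitive there. *)
  have [e [be [he hbe [w hw]]]] := free2_span fW huv.
  exists g, (parity be); split=> //; first exact: cocyc_parity.
  apply/cohom_subr; rewrite opprD addrA.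
  have hbe' := cocyc_parity hbe.
  set pz := pb (parity be) * z.
  have hzp : cocyc X pz by apply: cocycM => //; exact: onX.
  apply: (@mv_exact _ _ U V oU oV _ (u' - pb be * u - pb e - coboundary w) (v' - pb be * v)).
  + exact: cocycB.
  + have h1 := pmul_z pU hbe' zu; rewrite parityK in h1.
    have h2 : vanish U (coboundary (pb e)) := pull_cocyc pU he.
    move=> d s sU; move: (hu' d s sU) (h1 d s sU) (h2 d s sU).
    by rewrite !coboundaryB coboundaryK !(cochainD, cochainN, cochain0) -/pz; lia.
  + have h1 := pmul_z pV hbe' zv; rewrite parityK in h1.
    move=> d s sV; move: (hv' d s sV) (h1 d s sV).
    by rewrite !coboundaryB !(cochainD, cochainN, cochain0) -/pz; lia.
  + have h1 : vanish W (pb be * (u - v - a)) by exact: vanishMr.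
    move=> d s sW; move: (hw d s sW) (h1 d s sW).
    rewrite !mulrBr !(cochainD, cochainN, cochain0).
    by move=> h1' h2'; lra.
- move=> g be hg hbe h.
  have hg0 : cohom B g 0.
    apply: (free1_indep one0 fU) => //.
    apply: cohom_trans (cohom_sub UX h).
    rewrite -[X in cohom _ X _]addr0; apply: cohomD; first exact: cohom_refl.
    by apply: cohom_sym; exact: zU0.
  split=> //.
  have [e he] : cohom X (pb be * z) 0.
    apply: cohom_trans _ h; rewrite -[X in cohom _ X _]add0r; apply: cohomD; last exact: cohom_refl.
    by apply: cohom_sym; rewrite -(pull0 _ p); exact: pull_cohom pX _ _ hg0.
  have hbe' := cocyc_parity hbe.
  have eU : cocyc U (e - pb (parity be) * u).
    have h1 := pmul_z pU hbe zu.
    rewrite /cocyc coboundaryB => d s sU; move: (he d s (fun t => UX (sU t))) (h1 d s sU).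
    by rewrite subr0 !(cochainD, cochainN); lia.
  have eV : cocyc V (e - pb (parity be) * v).
    have h1 := pmul_z pV hbe zv.
    rewrite /cocyc coboundaryB => d s sV; move: (he d s (fun t => VX (sV t))) (h1 d s sV).
    by rewrite subr0 !(cochainD, cochainN); lia.
  have [x hx [w hw]] := free1_span one0 fU eU.
  have [y hy [w' hw']] := free1_span one0 fV eV.
  (* [x] and [y] represent [e - pb (parity be) * u] and [e - pb (parity be) * v]; on [W] their
     difference cancels against [pb (parity be) * a]. *)
  have [_ hbe0] : cohom B (x - y) 0 /\ cohom B (parity be) 0.
    apply: (free2_indep fW) => //; first exact: cocycB.
    exists (w' - w) => d s sW.
    have h1 : vanish W (pb (parity be) * (u - v - a)) by exact: vanishMr.
    move: (hw d s (fun t => WU (sW t))) (hw' d s (fun t => WV (sW t))) (h1 d s sW).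
    rewrite pullB coboundaryB !mulrBr !(cochainD, cochainN, cochain0).
    by move=> h2 h3 h4; lra.
  by have := cohom_parity hbe0; rewrite parityK parity0.
Qed.

End Suspension.

Section Puncture.
Variables (r : nat) (a : nat -> cochain R M).
Hypotheses (fX : free_over p B X r a) (fW : free_over p B W 2 (unit_and (a r)))
  (bU : cocyc U (a r)).

(** Passing from [X] to [U] amounts to puncturing [V], with [W] the punctured part. The coefficient
    of the new class is read off on [W]; once it is removed, a class on [U] comes from the base on
    [W], so it extends over [V] to [X]. *)
Lemma free_puncture : free_over p B U r.+1 a.
Proof.
have bW : cocyc W (a r) := cocyc_sub WU bU.
have [za sp ind] := fX.
split.
- by move=> i; rewrite ltnS leq_eqVlt => /orP[/eqP ->//|ir]; exact: cocyc_sub UX (za i ir).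
- move=> c hc.
  have [g [be [hg hbe [w hw]]]] := free2_span fW (cocyc_sub WU hc).
  have hbU : cocyc U (pb be * a r) by apply: cocycM => //; exact: pull_cocyc pU _ _.
  (* Without its part at [a r], the restriction of [c] to [W] is the class of [pb g], which lives on
     [V]: the two glue. *)
  have [x [xX xU xV]] : exists x, [/\ cocyc X x, vanish U (x - (c - pb be * a r - coboundary w)) &
      vanish V (x - pb g)].
    apply: mv_glue => //.
    + by apply: cocycB; [exact: cocycB|exact: cocyc_coboundary].
    + exact: pull_cocyc pV _ _.
    + move=> d s sW; move: (hw d s sW); rewrite !(cochainD, cochainN); lia.
  have [beta [hb hx]] := sp _ xX.
  exists (fun i => if (i < r)%N then beta i else be); split=> [i|].
    by case: ifP.
  rewrite big_ord_recr /= ltnn.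
  have -> : \sum_(i < r) pb (if (i < r)%N then beta i else be) * a i = \sum_(i < r) pb (beta i) * a i.
    by apply: eq_bigr => i _; rewrite ltn_ord.
  apply: cohom_trans (_ : cohom U _ (x + pb be * a r)) _.
    exists w => d s sU; move: (xU d s sU); rewrite !(cochainD, cochainN); lia.
  by apply: cohomD; [exact: cohom_sub UX _|exact: cohom_refl].
- move=> beta hb; rewrite big_ord_recr /= => h.
  set x := \sum_(i < r) _ in h.
  have onX be : cocyc B be -> cocyc X (pb be) by move=> hbe; exact: pull_cocyc pX _ hbe.
  have hxX : cocyc X x by apply: cocyc_sum => i _; apply: cocycM; [exact: onX|exact: za].
  have [g hg xg] := free1_span one0 fV (cocyc_sub VX hxX).
  (* On [W] the old classes contribute only [pb g], because they extend over [V]. *)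
  have [g0 br0] : cohom B g 0 /\ cohom B (beta r) 0.
    apply: (free2_indep fW) => //; apply: cohom_trans (cohom_sub WU h).
    by apply: cohomD; [exact/cohom_sym/(cohom_sub WV)|exact: cohom_refl].
  have [e1 he1] : cohom U x 0.
    apply: cohom_trans _ h; rewrite -[X in cohom _ X _]addr0; apply: cohomD; first exact: cohom_refl.
    rewrite -[0](mul0r (a r)); apply: cohomMr => //; apply: cohom_sym.
    by rewrite -(pull0 _ p); exact: pull_cohom pU _ _ br0.
  have [e2 he2] : cohom V x 0.
    by apply: cohom_trans xg _; rewrite -(pull0 _ p); exact: pull_cohom pV _ _ g0.
  have hz : cocyc W (e1 - e2).
    rewrite /cocyc coboundaryB => d s sW.
    move: (he1 d s (fun t => WU (sW t))) (he2 d s (fun t => WV (sW t))).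
    by rewrite !subr0 !(cochainD, cochainN); lia.
  have [y [be [hy hbe [w hw]]]] := free2_span fW hz.
  have x0 : cohom X x 0.
    (* The primitives differ on [W] by [pb y + pb be * a r] and a coboundary. The first summand
       extends over [V], the others over [U]; moved to their sides, they make the primitives
       agree. *)
    apply: (@mv_exact _ _ U V oU oV _ (e1 - pb be * a r - coboundary w) (e2 + pb y)) => //.
    + have h1 : vanish U (coboundary (pb be * a r)).
        by apply: cocycM => //; exact: pull_cocyc pU _ hbe.
      move=> d s sU; move: (he1 d s sU) (h1 d s sU).
      by rewrite !coboundaryB coboundaryK !(cochainD, cochainN, cochain0); lia.
    + have h1 : vanish V (coboundary (pb y)) := pull_cocyc pV hy.
      move=> d s sV; move: (he2 d s sV) (h1 d s sV).
      by rewrite coboundaryD !(cochainD, cochainN, cochain0); lia.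
    + by move=> d s sW; move: (hw d s sW); rewrite !(cochainD, cochainN); lia.
  by move=> i; rewrite ltnS leq_eqVlt => /orP[/eqP ->//|]; exact: ind.
Qed.

End Puncture.
End Steps.
End Freeness.

(** * Homogeneous components *)

Section Projection.
Variables (R : realType) (M : topologicalType).
Implicit Types (A : set M) (c : cochain R M).

Definition component (d : nat) c : cochain R M.
Proof.
apply: (@mk_cochain _ _ (fun e (s : simplex R M e) => if e == d then c e s else 0 : int)).
have [n cn] := cochain_boundP c; exists n => e s ne.
by rewrite cn // if_same.
Defined.

Lemma componentE d c e (s : simplex R M e) : component d c e s = if e == d then c e s else 0.
Proof. by []. Qed.

Lemma component_homogeneous d c : homogeneous_cochain d (component d c).
Proof. by move=> e s /eqP/negPf ed; rewrite componentE ed. Qed.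

Lemma component_id d c : homogeneous_cochain d c -> component d c = c.
Proof.
move=> h; apply/cochainP => e s; rewrite componentE.
by case: eqP => // ed; rewrite h.
Qed.

Lemma component_eq0 d d' c : homogeneous_cochain d c -> d != d' -> component d' c = 0.
Proof.
move=> h dd'; apply/cochainP => e s; rewrite componentE.
by case: eqP => // ed; apply: h; rewrite ed; apply/eqP; rewrite eq_sym.
Qed.

Lemma component_zmod_morphism d : zmod_morphism (component d).
Proof.
move=> c c'; apply/cochainP => e s; rewrite !(cochainD, cochainN, componentE).
by case: eqP; rewrite ?subr0.
Qed.
HB.instance Definition _ d := GRing.isZmodMorphism.Build (cochain R M) (cochain R M)
  (component d) (component_zmod_morphism d).

Lemma componentB d c c' : component d (c - c') = component d c - component d c'.
Proof. exact: (raddfB (component d)). Qed.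

Lemma component_sum d (I : Type) (r : seq I) (P : pred I) (F : I -> cochain R M) :
  component d (\sum_(i <- r | P i) F i) = \sum_(i <- r | P i) component d (F i).
Proof. exact: (raddf_sum (component d)). Qed.

Lemma component_mulrz d c m : component d (c *~ m) = component d c *~ m.
Proof. exact: (raddfMz (component d)). Qed.

Lemma component_coboundary d c : component d.+1 (coboundary c) = coboundary (component d c).
Proof.
apply/cochainP => -[//|e] s; rewrite componentE eqSS.
rewrite -[RHS]/(\sum_(i < e.+2) (-1) ^+ i * component d c e (face s i)).
case ed: (e == d); first by apply: eq_bigr => i _; rewrite componentE ed.
by rewrite big1 // => i _; rewrite componentE ed mulr0.
Qed.

Lemma component0_coboundary c : component 0 (coboundary c) = 0.
Proof. by apply/cochainP => -[|e] s. Qed.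

Lemma component_vanish A d c : vanish A c -> vanish A (component d c).
Proof. by move=> h e s sA; rewrite componentE h // if_same. Qed.

Lemma component_cocyc A d c : cocyc A c -> cocyc A (component d c).
Proof. by move=> h; rewrite /cocyc -component_coboundary; exact: component_vanish. Qed.

Lemma component_cohom A d c c' : cohom A c c' -> cohom A (component d c) (component d c').
Proof.
move=> [e he]; exists (if d is d'.+1 then component d' e else 0); case: d => [|d].
  rewrite coboundary0 -(component0_coboundary e) -!componentB; exact: component_vanish.
rewrite -component_coboundary -!componentB; exact: component_vanish.
Qed.

Lemma homogeneous1 : homogeneous_cochain 0 (1 : cochain R M).
Proof. by move=> [|e] s. Qed.

Lemma homogeneousM p q c (e : cochain R M) : homogeneous_cochain p c -> homogeneous_cochain q e ->
  homogeneous_cochain (p + q) (c * e).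
Proof.
move=> hc he d s dpq; rewrite [LHS]big1 // => i _.
have [ip|/eqP ip] := eqVneq (i : nat) p; last by rewrite hc ?mul0r.
by rewrite he ?mulr0 // => dq; apply: dpq; rewrite -ip -dq subnKC // -ltnS.
Qed.

Lemma homogeneousD p c (e : cochain R M) : homogeneous_cochain p c -> homogeneous_cochain p e ->
  homogeneous_cochain p (c + e).
Proof. by move=> hc he d s dp; rewrite cochainD hc // he. Qed.

End Projection.

Lemma pull_homogeneous (R : realType) (X Y : topologicalType) (f : continuousType X Y) p
    (c : cochain R Y) : homogeneous_cochain p c -> homogeneous_cochain p (pull_cochain f c).
Proof. by move=> hc d s dp; exact: hc. Qed.

Section ProductMaps.
Variables (T U V : topologicalType).

Lemma continuous_fst : continuous (@fst T U).
Proof. by move=> ?; exact: cvg_fst. Qed.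

Lemma continuous_snd : continuous (@snd T U).
Proof. by move=> ?; exact: cvg_snd. Qed.

Definition fst_map : continuousType (T * U)%type T := mkcts continuous_fst.
Definition snd_map : continuousType (T * U)%type U := mkcts continuous_snd.

Lemma continuous_compose (W : topologicalType) (f : T -> U) (g : U -> W) :
  continuous f -> continuous g -> continuous (fun x => g (f x)).
Proof. by move=> cf cg x; apply: continuous_comp; [exact: cf|exact: cg]. Qed.

Lemma open_setX (A : set T) (B : set U) : open A -> open B -> open (A `*` B).
Proof.
move=> oA oB; rewrite (_ : A `*` B = (fst @^-1` A) `&` (snd @^-1` B)) //.
apply: openI; [move/continuousP: continuous_fst|move/continuousP: continuous_snd]; exact.
Qed.

End ProductMaps.

(** * Punctured Euclidean spaces *)

Section PuncturedSpace.
Variable R : realType.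

Definition nz n := [set y : 'rV[R]_n | y != 0].

Definition tail n (y : 'rV[R]_n.+1) : 'rV[R]_n := \row_j y 0 (lift ord0 j).

Definition econs n (r : R) (y : 'rV[R]_n) : 'rV[R]_n.+1 :=
  \row_j (if unlift ord0 j is Some i then y 0 i else r).

Lemma econsK n r (y : 'rV[R]_n) : tail (econs r y) = y.
Proof. by apply/rowP => j; rewrite !mxE liftK. Qed.

Lemma econs0 n r (y : 'rV[R]_n) : econs r y 0 0 = r.
Proof. by rewrite mxE unlift_none. Qed.

Lemma econsE n (y : 'rV[R]_n.+1) : econs (y 0 0) (tail y) = y.
Proof. by apply/rowP => j; rewrite mxE; case: unliftP => [i ->|->]; rewrite ?mxE. Qed.

Lemma tail_continuous n : continuous (@tail n).
Proof.
apply: continuous_entries => i j; under eq_fun do rewrite mxE; exact: coord_continuous.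
Qed.

Definition tail_map n : continuousType 'rV[R]_n.+1 'rV[R]_n := mkcts (@tail_continuous n).

Lemma continuous_row_entry (T : topologicalType) m n (f : T -> 'M[R]_(m, n)) i j :
  continuous f -> continuous (fun x => f x i j).
Proof.
move=> cf; apply: (continuous_compose (g := fun M : 'M[R]_(m, n) => M i j)) cf _.
exact: coord_continuous.
Qed.

Lemma continuous_econs (T : topologicalType) n (r : T -> R) (f : T -> 'rV[R]_n) :
  continuous r -> continuous f -> continuous (fun x => econs (r x) (f x)).
Proof.
move=> cr cf; apply: continuous_entries => i j; under eq_fun do rewrite mxE.
by case: unliftP => [k _|_] //; exact: continuous_row_entry.
Qed.

(** For [s] equal to 1 or -1, the complement of a closed half of the first axis. It is open and
    star-shaped about [econs s 0]; the two cover the punctured space, and they meet in a line times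
    a punctured space of one dimension less. *)
Definition half n (s : R) := [set y : 'rV[R]_n.+1 | 0 < s * y 0 0 \/ tail y != 0].

Lemma open_nz n : open (@nz n).
Proof.
rewrite (_ : @nz n = \bigcup_(i in setT) [set y : 'rV[R]_n | y 0 i != 0]).
  apply: bigcup_open => i _.
  apply: (@open_comp _ _ (fun y : 'rV[R]_n => y 0 i) [set r | r != 0]); last exact: open_neq.
  by move=> y _; exact: coord_continuous.
apply/seteqP; split=> y /=.
  move=> /eqP y0; apply: contrapT => h; apply: y0; apply/rowP => i; rewrite mxE.
  by apply/eqP/negPn/negP => yi; apply: h; exists i.
by move=> [i _]; apply: contraNneq => ->; rewrite mxE.
Qed.

Lemma open_half n s : open (@half n s).
Proof.
rewrite (_ : @half n s = [set y : 'rV[R]_n.+1 | 0 < s * y 0 0] `|` (@tail n @^-1` @nz n)) //.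
apply: openU; last by move/continuousP: (@tail_continuous n); apply; exact: open_nz.
apply: (@open_comp _ _ (fun y : 'rV[R]_n.+1 => s * y 0 0) [set r | 0 < r]); last exact: open_gt.
move=> y _; apply: (@continuous_mulr R _ (fun=> s) (fun y : 'rV[R]_n.+1 => y 0 0)).
  exact: cst_continuous.
exact: coord_continuous.
Qed.

Lemma row_eq0 n (y : 'rV[R]_n.+1) : (y == 0) = (y 0 0 == 0) && (tail y == 0).
Proof.
apply/eqP/andP => [->|[/eqP y0 /eqP yt]].
  by rewrite mxE eqxx; split=> //; apply/eqP/rowP => j; rewrite !mxE.
rewrite -(econsE y) y0 yt; apply/rowP => j; rewrite !mxE.
by case: unliftP => [i _|_]; rewrite ?mxE.
Qed.

Lemma half_cover n : half 1 `|` half (-1) = @nz n.+1.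
Proof.
apply/seteqP; split=> y; rewrite /half /nz /= row_eq0 negb_and mul1r mulN1r oppr_gt0.
  by case=> -[h|->]; rewrite ?orbT // ?(gt_eqF h) ?(lt_eqF h).
by move=> /orP[|h]; [rewrite neq_lt => /orP[]; tauto|tauto].
Qed.

Lemma half_cap n : half 1 `&` half (-1) = [set y : 'rV[R]_n.+1 | tail y != 0].
Proof.
apply/seteqP; split=> y; rewrite /half /= mul1r mulN1r oppr_gt0; last by move=> ?; split; right.
by move=> [[h|//] [h'|//]]; move: (lt_trans h h'); rewrite ltxx.
Qed.

Section ProductWithBase.
Variables (P : topologicalType) (B : set P) (oB : open B) (n : nat).
Local Notation M := (P * 'rV[R]_n.+1)%type.
Local Notation p := (fst_map P 'rV[R]_n.+1).

Lemma free_half (s : R) : s * s = 1 ->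
  free_over p B (B `*` @half n s) 1 (fun=> 1 : cochain R M).
Proof.
move=> ss; pose e : 'rV[R]_n.+1 := econs s 0.
have cg : continuous (fun x : P => (x, e)).
  by apply: continuous_pair; [move=> ?; exact: cvg_id|move=> ?; exact: cst_continuous].
pose g : continuousType P M := mkcts cg.
have -> : (fun=> 1 : cochain R M) = (fun _ : nat => pull_cochain p 1).
  by apply/funext => _; rewrite pull1.
have cH : continuous (fun z : R * M => (z.2.1, econs ((1 - z.1) * s + z.1 * z.2.2 0 0) (z.1 *: tail z.2.2))).
  have c1 : continuous (fun z : R * M => z.1) by exact: continuous_fst.
  have c2 : continuous (fun z : R * M => z.2.1).
    by apply: continuous_compose; [exact: continuous_snd|exact: continuous_fst].
  have c3 : continuous (fun z : R * M => z.2.2).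
    by apply: continuous_compose; [exact: continuous_snd|exact: continuous_snd].
  apply: continuous_pair => //; apply: continuous_econs.
    apply: continuous_addr; apply: continuous_mulr => //.
    - by apply: continuous_addr; [exact: cst_continuous|exact: continuous_oppr].
    - exact: cst_continuous.
    - exact: continuous_row_entry.
  apply: continuous_entries => i j; under eq_fun do rewrite !mxE.
  by apply: continuous_mulr => //; exact: continuous_row_entry.
apply: (@free_transport R M P P p (idfun : continuousType P P) B _ B p g _ snd _ _ _ _ cH) => //=.
- by move=> x [].
- by move=> x Bx; split=> //; left; rewrite /e econs0 ss ltr01.
- move=> t [x y] /andP[t0 t1] [/= Bx hy]; split=> //=.
  rewrite /half /= econs0 econsK mulrDr mulrCA ss mulr1 mulrCA.
  case: hy => hy.
    left; have := mulr_ge0 t0 (ltW hy); move: t1; rewrite le_eqVlt => /orP[/eqP ->|t1].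
      by rewrite subrr add0r mul1r.
    lra.
  have [->|tn0] := eqVneq t 0; first by left; rewrite mul0r addr0 subr0 ltr01.
  by right; rewrite scaler_eq0 negb_or tn0.
- by move=> [x y]; rewrite /= subr0 mul1r mul0r addr0 scale0r.
- by move=> [x y]; rewrite /= subrr mul0r add0r mul1r scale1r econsE.
- exact: continuous_snd.
- exact: free_id.
Qed.

(** Scaling the first coordinate to zero is a homotopy over the base that stays in the set where
    [tail] is nonzero. *)
Lemma free_tail (a : cochain R 'rV[R]_n) :
  free_over (fst_map P 'rV[R]_n) B (B `*` @nz n) 2 (unit_and (pull_cochain (snd_map P 'rV[R]_n) a)) ->
  free_over p B (B `*` [set y : 'rV[R]_n.+1 | tail y != 0]) 2
    (unit_and (pull_cochain (snd_map P 'rV[R]_n.+1) (pull_cochain (@tail_map n) a))).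
Proof.
move=> fa.
have ct : continuous (fun z : M => (z.1, tail z.2)).
  apply: continuous_pair; first exact: continuous_fst.
  by apply: continuous_compose; [exact: continuous_snd|exact: tail_continuous].
have cg : continuous (fun z : P * 'rV[R]_n => (z.1, econs 0 z.2)).
  apply: continuous_pair; first exact: continuous_fst.
  by apply: continuous_econs; [exact: cst_continuous|exact: continuous_snd].
pose f : continuousType M (P * 'rV[R]_n)%type := mkcts ct.
pose g : continuousType (P * 'rV[R]_n)%type M := mkcts cg.
rewrite (_ : unit_and _ = (fun i => pull_cochain f (unit_and (pull_cochain (snd_map P 'rV[R]_n) a) i))); last first.
  apply/funext => -[|i] /=; first by rewrite pull1.
  by rewrite !pull_comp; exact: eq_pull.
have cH : continuous (fun z : R * M => (z.2.1, econs (z.1 * z.2.2 0 0) (tail z.2.2))).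
  have c3 : continuous (fun z : R * M => z.2.2).
    by apply: continuous_compose; [exact: continuous_snd|exact: continuous_snd].
  apply: continuous_pair.
    by apply: continuous_compose; [exact: continuous_snd|exact: continuous_fst].
  apply: continuous_econs.
    by apply: continuous_mulr; [exact: continuous_fst|exact: continuous_row_entry].
  by apply: continuous_compose c3 _; exact: tail_continuous.
apply: (@free_transport R _ _ P p (fst_map P 'rV[R]_n) B _ (B `*` @nz n) f g _ snd _ _ _ _ cH _ _ _ _ _ _ _ _ _ fa) => //=.
- by move=> [x y] [/= Bx y0]; split=> //=; rewrite econsK.
- by move=> x [].
- by move=> t [x y] _ [/= Bx y0]; split=> //=; rewrite econsK.
- by move=> [x y]; rewrite /= mul0r.
- by move=> [x y]; rewrite /= mul1r econsE.
- exact: continuous_snd.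
- by move=> [x y]; congr pair; rewrite econsK.
Qed.

End ProductWithBase.

End PuncturedSpace.

(** * Evaluation on the fundamental cycle *)

Section FundamentalCycle.
Variable R : realType.

Local Notation idm T := (idfun : continuousType T T).
Local Notation rcev n c := (cev (convex_row R n) c (idm 'rV[R]_n)).

Definition verts n : seq 'rV[R]_n := mkseq (vertex R n) n.+1.

(* The value of a cochain on the boundary of the simplex with vertices [verts n]. *)
Definition cycle_eval n (c : cochain R 'rV[R]_n) : int := ldelta (rcev n c) (verts n).

Lemma cevB (D X : topologicalType) (C : convex R D) (g : continuousType D X)
    (c c' : cochain R X) l : cev C (c - c') g l = cev C c g l - cev C c' g l.
Proof. by case: l => [|x l]; rewrite /= ?subr0 // cochainD cochainN. Qed.

Lemma eq_cev n (A : set 'rV[R]_n) (c c' : cochain R 'rV[R]_n) l : vanish A (c - c') ->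
  (forall p (x : 'rV[R]_n) (t : stdsimplex R p), size l = p.+1 -> A (lin_fun (nth x l) t)) ->
  rcev n c l = rcev n c' l.
Proof.
case: l => [//|x l] h lA; apply/eqP; rewrite -subr_eq0 -cevB; apply/eqP.
by apply: h => t; exact: lA.
Qed.

Lemma facet_lin n x i (il : (i < n.+2)%N) (t : stdsimplex R n) :
  lin_fun (nth x (ldel i (verts n.+1))) t = facet_point (Ordinal il) t.
Proof.
apply: eq_bigr => j _; congr (_ *: _).
rewrite /ldel nth_cat size_take size_mkseq il /bump.
case: leqP => ij; last by rewrite nth_take // nth_mkseq // (leq_trans ij) // ltnW.
have jn := ltn_ord j; have e : (i.+1 + (j - i) = j.+1)%N by lia.
by rewrite nth_drop e nth_mkseq // ltnS.
Qed.

(** The facets avoid the origin, so on each of them [c - c'] equals [coboundary e], and the total is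
    a double [ldelta]. *)
Lemma cycle_eval_cohom n (c c' : cochain R 'rV[R]_n) : (0 < n)%N ->
  cohom (@nz R n) c c' -> cycle_eval c = cycle_eval c'.
Proof.
move=> n0 [e he]; apply/eqP; rewrite -subr_eq0; apply/eqP.
rewrite /cycle_eval -ldeltaB.
transitivity (ldelta (ldelta (rcev n e)) (verts n)); last exact: ldeltaK.
apply: eq_ldelta => i il; rewrite -cevB -cev_delta; apply: (eq_cev he) => p x t sl.
rewrite size_ldel // size_mkseq /= in sl.
rewrite size_mkseq in il.
case: n n0 c c' e he x il sl => [//|n] n0 c c' e he x il [np]; subst p.
by rewrite /nz /= facet_lin; exact: facet_point_neq0.
Qed.

Lemma tail_lin n p (f : nat -> 'rV[R]_n.+1) (t : stdsimplex R p) :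
  tail (lin_fun f t) = lin_fun (fun j => tail (f j)) t.
Proof.
apply/rowP => j; rewrite mxE /lin_fun !summxE; apply: eq_bigr => i _.
by rewrite !mxE.
Qed.

(** Vertex 1 is the first unit vector; forgetting the first coordinate sends the other vertices to
    those of the simplex one dimension lower. This is the source of the recursion for
    [cycle_eval]. *)
Lemma tail_verts n : map (@tail R n) (ldel 1 (verts n.+1)) = verts n.
Proof.
rewrite /ldel /verts /mkseq /= drop0; congr cons.
  by apply/rowP => j; rewrite !mxE.
rewrite (iotaDl 1 1) -!map_comp; apply/eq_in_map => -[|i] //=.
  by rewrite mem_iota.
by move=> _; apply/rowP => j; rewrite !mxE lift0 eqSS.
Qed.

Section Weights.
Variables (n : nat) (i : nat) (il : (i < n.+2)%N) (t : stdsimplex R n).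

Let w m : R := \sum_(j < n.+1 | bump i j == m) val t 0 j.

Let facet_coord (j : 'I_n.+1) : facet_point (Ordinal il) t 0 j = w j.+1 - w 0.
Proof.
rewrite /facet_point summxE /w [X in X - _]big_mkcond [X in _ - X]big_mkcond -sumrB.
apply: eq_bigr => l _; rewrite mxE /=; case: (bump i l) => [|m] /=.
  by rewrite mxE sub0r mulrN1.
by rewrite mxE eqSS /= subr0 eq_sym; case: eqP; rewrite ?mulr1 ?mulr0.
Qed.

Let w_ge0 m : 0 <= w m.
Proof. by apply: sumr_ge0 => j _; exact: simplex_ge0. Qed.

Let w_del : w i = 0.
Proof. by rewrite /w big_pred0 // => j; rewrite /bump; lia. Qed.

Let w_neq0 : (forall m, (m < n.+2)%N -> w m = 0) -> False.
Proof.
move=> w0; have := simplex_sum t.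
rewrite (partition_big (fun j : 'I_n.+1 => lift (Ordinal il) j) predT) //=.
rewrite big1 => [/eqP|m _]; first by rewrite eq_sym oner_eq0.
by rewrite -[RHS](w0 m).
Qed.

Let tail_coord m : tail (facet_point (Ordinal il) t) = 0 -> (0 < m <= n)%N -> w m.+1 = w 0.
Proof.
case: m => [//|m] t0 /= mn; move/rowP/(_ (Ordinal mn)): t0.
by rewrite !mxE facet_coord lift0 /= => /eqP; rewrite subr_eq0 => /eqP.
Qed.

(** At a point of the first axis all weights except [w 1] coincide. In the facet opposite to vertex
    1 one has [w 1 = 0], so the first coordinate is [- w 0 < 0]; in any other facet the common
    weight is zero, and the first coordinate is [w 1 > 0]. *)
Lemma facet_half : half (if i == 1%N then -1 else 1) (facet_point (Ordinal il) t).
Proof.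
rewrite /half /=; have [t0|] := eqVneq (tail (facet_point (Ordinal il) t)) 0; last by right.
left; rewrite facet_coord /=.
have wt m : (0 < m <= n)%N -> w m.+1 = w 0 by exact: tail_coord.
case: eqP => [i1|i1].
  have w1 : w 1 = 0 by have := w_del; rewrite i1.
  rewrite w1 mulN1r opprB subr0 lt_def w_ge0 andbT; apply/eqP => w0.
  by apply: w_neq0 => -[//|[//|m]] mn; rewrite wt ?w0 //; lia.
have w0 : w 0 = 0.
  move: i1 w_del il; case: (i) => [|[|m]] // _ wm mn; by rewrite -(wt m.+1) //; lia.
rewrite w0 mul1r subr0 lt_def w_ge0 andbT; apply/eqP => w1.
by apply: w_neq0 => -[//|[//|m]] mn; rewrite wt ?w0 //; lia.
Qed.

End Weights.

(** [z] is [coboundary u] on every facet but the one opposite to vertex 1, where it is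
    [coboundary v]. As [coboundary u] has total 0, only that facet contributes; its sign -1 turns
    [v - u] into [u - v], which is the pullback of [a] on its boundary. *)
Lemma cycle_eval_suspension n (a : cochain R 'rV[R]_n) (z u v : cochain R 'rV[R]_n.+1) :
  (0 < n)%N -> vanish (@half R n 1) (z - coboundary u) -> vanish (@half R n (-1)) (z - coboundary v) ->
  vanish [set y : 'rV[R]_n.+1 | tail y != 0] (u - v - pull_cochain (@tail_map R n) a) ->
  cycle_eval z = cycle_eval a.
Proof.
move=> n0 zu zv uv.
have ev_tail : ldelta (rcev n.+1 (pull_cochain (@tail_map R n) a)) (ldel 1 (verts n.+1)) = cycle_eval a.
  rewrite /cycle_eval -(tail_verts n) ldelta_map; apply: eq_ldelta => j jl.
  rewrite cev_pull; case: (ldel j _) => [//|x l]; rewrite /= size_map; congr (a _ _).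
  apply/continuousEP => t; rewrite -[LHS]/(tail (lin_fun _ t)) tail_lin.
  apply: eq_lin => k kl; exact/esym/(@nth_map _ x _ (tail x) (@tail R n) k (x :: l)).
have half_facet i x (t : stdsimplex R n) : (i < n.+2)%N ->
    half (if i == 1%N then -1 else 1) (lin_fun (nth x (ldel i (verts n.+1))) t).
  by move=> il; rewrite facet_lin; exact: facet_half.
have fac i s c c' : (i < n.+2)%N -> (if i == 1%N then -1 else 1) = s :> R ->
    vanish (@half R n s) (c - c') ->
    rcev n.+1 c (ldel i (verts n.+1)) = rcev n.+1 c' (ldel i (verts n.+1)).
  move=> il <- h; apply: (eq_cev h) => p x t.
  by rewrite size_ldel size_mkseq // => -[np]; subst p; exact: half_facet.
have key : ldelta (fun l => rcev n.+1 z l - rcev n.+1 (coboundary u) l) (verts n.+1) = cycle_eval a.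
  rewrite ldeltaE size_mkseq -ev_tail big_nat_recl // big_nat_recl //.
  rewrite (fac 0%N _ _ _ _ erefl zu) // subrr mulr0 add0r big1_seq ?addr0; last first.
    move=> i; rewrite mem_index_iota => /andP[_ /andP[_ id]].
    by rewrite (fac _ _ _ _ _ _ zu) ?subrr ?mulr0.
  rewrite (fac 1%N _ _ _ _ erefl zv) // expr1 mulN1r opprB -cevB -coboundaryB.
  rewrite [LHS]cev_delta; apply: eq_ldelta => j jl; apply: (eq_cev uv) => p x t sl /=.
  have s1 : size (ldel 1 (verts n.+1)) = n.+1 by rewrite size_ldel size_mkseq.
  rewrite size_ldel // s1 /= in sl.
  rewrite s1 in jl.
  have -> : tail (lin_fun (nth x (ldel j (ldel 1 (verts n.+1)))) t) =
      lin_fun (nth (tail x) (ldel j (verts n))) t.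
    rewrite tail_lin -(tail_verts n) -map_ldel; apply: eq_lin => k kl.
    by apply/esym/(@nth_map _ x _ (tail x)); rewrite size_ldel ?s1 // /= sl ltnS.
  clear -jl sl; case: n x jl sl => [//|n] x jl [np]; subst p.
  by rewrite facet_lin; exact: facet_point_neq0.
rewrite -key ldeltaB -[LHS]subr0; congr (_ - _).
rewrite -[LHS](ldeltaK (rcev n.+1 u) (verts n.+1)); apply: eq_ldelta => i il.
by rewrite cev_delta.
Qed.

End FundamentalCycle.

(** * The generator of the cohomology of a punctured space *)

Section Zeta.
Variable R : realType.

Lemma continuous_opp_row n : continuous (fun y : 'rV[R]_n => - y).
Proof.
apply: continuous_entries => i j; under eq_fun do rewrite mxE.
by apply: continuous_oppr; exact: coord_continuous.
Qed.

Definition antipode n : continuousType 'rV[R]_n 'rV[R]_n := mkcts (@continuous_opp_row n).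

(* [z] generates the cohomology of the punctured space over any base. For [n = 0] the
   antipode swaps the two components, whence the correction by the constant [m]. *)
Record is_zeta n (z : cochain R 'rV[R]_n.+1) : Prop := IsZeta {
  zeta_homogeneous : homogeneous_cochain n z;
  zeta_cocyc : cocyc (@nz R n.+1) z;
  zeta_eval : cycle_eval z = 1;
  zeta_antipode : exists m : int, ((0 < n)%N -> m = 0) /\
    cohom (@nz R n.+1) (pull_cochain (@antipode n.+1) z) (z *~ (-1) ^+ n.+1 + 1 *~ m);
  zeta_free : forall (P : topologicalType) (B : set P), open B ->
    free_over (fst_map P 'rV[R]_n.+1) B (B `*` @nz R n.+1) 2
      (unit_and (pull_cochain (snd_map P 'rV[R]_n.+1) z)) }.

Lemma half_antipode n s (y : 'rV[R]_n.+1) : half s y -> half (- s) (- y).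
Proof.
rewrite /half /= mxE mulrNN.
by have -> : tail (- y) = - tail y; [apply/rowP => j; rewrite !mxE|rewrite oppr_eq0].
Qed.

Lemma setX_half_cover (P : topologicalType) (B : set P) n :
  (B `*` @half R n 1) `|` (B `*` @half R n (-1)) = B `*` @nz R n.+1.
Proof.
rewrite -half_cover; apply/seteqP; split=> x /=; first by move=> [[? ?]|[? ?]]; tauto.
by move=> [? [?|?]]; tauto.
Qed.

Lemma setX_half_cap (P : topologicalType) (B : set P) n :
  (B `*` @half R n 1) `&` (B `*` @half R n (-1)) = B `*` [set y : 'rV[R]_n.+1 | tail y != 0].
Proof.
by rewrite -half_cap; apply/seteqP; split=> x /=; tauto.
Qed.

Lemma vanish_empty (M : topologicalType) (A : set M) (c : cochain R M) :
  (forall x, ~ A x) -> vanish A c.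
Proof. by move=> A0 d s sA; case: (A0 _ (sA (svert R d 0))). Qed.

Lemma coboundary1 (M : topologicalType) : coboundary 1 = 0 :> cochain R M.
Proof. by apply/cocycleP; exact: rpred1. Qed.

(** On the punctured line, [z] is 1 on the positive half and 0 on the negative half. [vertex R 1 1]
    is the point 1 and [vertex R 1 0] the point -1, so the evaluation is [1 - 0]. *)
Lemma zeta_base : exists z : cochain R 'rV[R]_1, is_zeta z.
Proof.
have no_tail (y : 'rV[R]_1) : ~ tail y != 0.
  by move=> /negP; apply; apply/eqP/rowP => -[].
have [z0 [z0X zU zV]] : exists z : cochain R 'rV[R]_1, [/\ cocyc (half 1 `|` half (-1)) z,
    vanish (@half R 0 1) (z - 1) & vanish (@half R 0 (-1)) (z - 0)].
  apply: mv_glue; [exact: open_half|exact: open_half|exact: cocyc1|exact: cocyc0|].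
  by rewrite half_cap; apply: vanish_empty => y; exact: no_tail.
pose z := component 0 z0.
have {}zU : vanish (@half R 0 1) (z - 1).
  by rewrite -(component_id (@homogeneous1 R _)) -componentB; exact: component_vanish.
have {}zV : vanish (@half R 0 (-1)) z.
  by apply: component_vanish; rewrite subr0 in zV.
have zX : cocyc (@nz R 1) z by apply: component_cocyc; rewrite -half_cover.
have aU : vanish (@half R 0 1) (pull_cochain (@antipode 1) z).
  by apply: pull_vanish zV => y /half_antipode.
have aV : vanish (@half R 0 (-1)) (pull_cochain (@antipode 1) z - 1).
  rewrite -(pull1 _ (@antipode 1)) -pullB; apply: pull_vanish zU => y /half_antipode.
  by rewrite opprK.
exists z; split=> //.
- exact: component_homogeneous.
- have t1 (t : stdsimplex R 0) : val t 0 0 = 1 by have := simplex_sum t; rewrite big_ord1.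
  have -> : cycle_eval z = cev (convex_row R 1) z idfun [:: vertex R 1 1] -
      cev (convex_row R 1) z idfun [:: vertex R 1 0].
    by rewrite /cycle_eval /= subr0.
  rewrite (eq_cev zU (l := [:: vertex R 1 1])) => [|p x t [] ?]; last first.
    by subst p; left; rewrite mul1r /lin_fun big_ord1 !mxE mulr1 t1.
  rewrite (eq_cev (c' := 0) (A := @half R 0 (-1)) _ (l := [:: vertex R 1 0])) //.
    by rewrite subr0.
  by move=> p x t [] ?; subst p; left; rewrite mulN1r /lin_fun big_ord1 !mxE mulrN1 opprK t1.
(* The antipode exchanges the half-lines and pulls [z] back to [1 - z]. *)
- exists 1; split=> //; apply/cohom_subr; rewrite -half_cover.
  have e : pull_cochain (@antipode 1) z - (z *~ (-1) ^+ 1 + 1 *~ 1) = pull_cochain (@antipode 1) z + z - 1.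
    by rewrite expr1 mulrN1z mulr1z opprD opprK addrA.
  rewrite e; apply: (@mv_exact _ _ _ _ (@open_half R 0 1) (@open_half R 0 (-1)) _ 0 0).
  + rewrite half_cover; apply: cocycB; last exact: cocyc1.
    apply: cocycD => //; apply: pull_cocyc zX => y; rewrite /nz /= oppr_eq0 //.
  + move=> d s sU; move: (aU d s sU) (zU d s sU).
    by rewrite coboundary0 !(cochainD, cochainN, cochain0); lia.
  + move=> d s sV; move: (aV d s sV) (zV d s sV).
    by rewrite coboundary0 !(cochainD, cochainN, cochain0); lia.
  + by rewrite subrr; exact: vanish0.
- move=> P B oB; set p := fst_map _ _; set sz := pull_cochain _ z.
  have oU := open_setX oB (@open_half R 0 1); have oV := open_setX oB (@open_half R 0 (-1)).
  have fU := @free_half R P B 0 1 (mulr1 1).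
  have fV := @free_half R P B 0 (-1) (etrans (mulrNN 1 1) (mulr1 1)).
  have szU : vanish (B `*` @half R 0 1) (sz - 1).
    by rewrite -(pull1 _ (snd_map P _)) -pullB; apply: pull_vanish zU => x [].
  have szV : vanish (B `*` @half R 0 (-1)) sz by apply: pull_vanish zV => x [].
  have pX x : (B `*` @nz R 1) x -> B (p x) by case.
  have pU x : (B `*` @half R 0 1) x -> B (p x) by case.
  have pV x : (B `*` @half R 0 (-1)) x -> B (p x) by case.
  have UX : B `*` @half R 0 1 `<=` B `*` @nz R 1 by rewrite -setX_half_cover => x; left.
  have VX : B `*` @half R 0 (-1) `<=` B `*` @nz R 1 by rewrite -setX_half_cover => x; right.
  have szX : cocyc (B `*` @nz R 1) sz by apply: pull_cocyc zX => x [].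
  apply: free2I => // [c hc|g h hg hh gh].
    have [g hg [w hw]] := free1_span erefl fU (cocyc_sub UX hc).
    have [g' hg' [w' hw']] := free1_span erefl fV (cocyc_sub VX hc).
    (* On the negative half [z] vanishes and [c] is [g']; on the positive half [z] is 1 and [c] is
       [g]. *)
    exists g', (g - g'); split=> //; first exact: cocycB.
    apply/cohom_subr; rewrite -setX_half_cover.
    apply: (@mv_exact _ _ _ _ oU oV _ w w').
    + rewrite setX_half_cover; apply: cocycB => //; apply: cocycD; first exact: (pull_cocyc pX hg').
      by apply: cocycM => //; apply: (pull_cocyc pX); exact: cocycB.
    + have h1 := vanishMr (pull_cochain p (g - g')) szU.
      move=> d s sU; move: (hw d s sU) (h1 d s sU).
      rewrite mulrBr mulr1 pullB !(cochainD, cochainN) => h2 h3; lra.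
    + have h1 := vanishMr (pull_cochain p (g - g')) szV.
      move=> d s sV; move: (hw' d s sV) (h1 d s sV).
      rewrite !(cochainD, cochainN) => h2 h3; lra.
    + rewrite setX_half_cap; apply: vanish_empty => x [_]; exact: no_tail.
  have g0 : cohom B g 0.
    apply: (free1_indep erefl fV) => //; apply: cohom_trans (cohom_sub VX gh).
    by apply: cohom_sym; apply: cohom_vanish; rewrite addrC addKr; exact: vanishMr.
  split=> //.
  have gh0 : cohom B (g + h) 0.
    apply: (free1_indep erefl fU) => //; first exact: cocycD.
    apply: cohom_trans (cohom_sub UX gh); apply: cohom_sym; apply: cohom_vanish.
    rewrite pullD opprD addrACA subrr add0r -[X in _ - X]mulr1 -mulrBr; exact: vanishMr.
  by have := cohomB gh0 g0; rewrite addrC addKr subr0.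
Qed.

Lemma cochain_mulrz (M : topologicalType) (c : cochain R M) (m : int) d (s : simplex R M d) :
  (c *~ m) d s = c d s * m.
Proof.
have nat (k : nat) : (c *+ k) d s = c d s * k.
  by elim: k => [|k IH]; rewrite ?mulr0 // mulrS cochainD IH; ring.
by case: m => k; [exact: nat|rewrite NegzE mulrNz cochainN [X in - X]nat mulrN].
Qed.

Lemma coboundary_mulrz (M : topologicalType) (c : cochain R M) (m : int) :
  coboundary (c *~ m) = coboundary c *~ m.
Proof. exact: (raddfMz (@coboundary R M)). Qed.

Lemma cycle_eval_mulrz n (c : cochain R 'rV[R]_n) (m : int) :
  cycle_eval (c *~ m) = cycle_eval c * m.
Proof.
rewrite /cycle_eval !ldeltaE mulr_suml; apply: eq_bigr => i _.
by rewrite -mulrA; congr (_ * _); case: ldel => [|y l]; rewrite /= ?mul0r // cochain_mulrz.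
Qed.

(** The suspension of [a], with primitives [u] on one half and 0 on the other: their difference on
    the overlap is the pullback of [a]. *)
Lemma zeta_succ n (a : cochain R 'rV[R]_n.+1) : is_zeta a ->
  exists z : cochain R 'rV[R]_n.+2, is_zeta z.
Proof.
move=> [ha za ea [m [_ [e he]]] fa].
pose u := pull_cochain (@tail_map R n.+1) a.
have uW : cocyc [set y : 'rV[R]_n.+2 | tail y != 0] u by apply: pull_cocyc za.
have [z0 [z0X zU zV]] : exists z : cochain R 'rV[R]_n.+2, [/\ cocyc (half 1 `|` half (-1)) z,
    vanish (@half R n.+1 1) (z - coboundary u) & vanish (@half R n.+1 (-1)) (z - 0)].
  apply: mv_glue; [exact: open_half|exact: open_half|exact: cocyc_coboundary|exact: cocyc0|].
  by rewrite half_cap subr0; exact: uW.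
pose z := component n.+1 z0.
have {}zU : vanish (@half R n.+1 1) (z - coboundary u).
  have -> : coboundary u = component n.+1 (coboundary u).
    by rewrite component_coboundary component_id //; exact: pull_homogeneous.
  by rewrite -componentB; exact: component_vanish.
have {}zV : vanish (@half R n.+1 (-1)) z.
  by apply: component_vanish; rewrite subr0 in zV.
have zX : cocyc (@nz R n.+2) z by apply: component_cocyc; rewrite -half_cover.
have aU : vanish (@half R n.+1 1) (pull_cochain (@antipode n.+2) z).
  by apply: pull_vanish zV => y /half_antipode.
have aV : vanish (@half R n.+1 (-1)) (pull_cochain (@antipode n.+2) z - coboundary (pull_cochain (@antipode n.+2) u)).
  rewrite pull_coboundary -pullB; apply: pull_vanish zU => y /half_antipode.
  by rewrite opprK.
have zV' : vanish (@half R n.+1 (-1)) (z - coboundary 0) by rewrite coboundary0 subr0.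
exists z; split=> //.
- exact: component_homogeneous.
- rewrite (@cycle_eval_suspension _ _ a _ u 0) //.
  by rewrite subr0 subrr; exact: vanish0.
- exists 0; split=> //; rewrite mulr0z addr0; apply/cohom_subr; rewrite -half_cover.
  set eps : int := (-1) ^+ n.+1.
  have -> : (-1) ^+ n.+2 = - eps :> int by rewrite exprS mulN1r.
  rewrite mulrNz opprK.
  (* The antipode exchanges the halves, so the primitive is [u *~ eps] on one and the pullback of
     [u] on the other. By the antipode property of [a] they differ on the overlap by [1 *~ m] and a
     coboundary. Both are cocycles on the first half and may be added there, so the constant [m]
     does not survive suspension. *)
  apply: (@mv_exact _ _ _ _ (@open_half R n.+1 1) (@open_half R n.+1 (-1)) _
    (u *~ eps + 1 *~ m + coboundary (pull_cochain (@tail_map R n.+1) e))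
    (pull_cochain (@antipode n.+2) u)).
  + rewrite half_cover; apply: cocycD; last exact: cocyc_mulrz.
    by apply: pull_cocyc zX => y; rewrite /nz /= oppr_eq0.
  + rewrite !coboundaryD !coboundary_mulrz coboundary1 mul0rz coboundaryK !addr0.
    move=> d s sU; move: (aU d s sU) (zU d s sU).
    rewrite !(cochainD, cochainN, cochain_mulrz) => -> /eqP; rewrite subr_eq0 => /eqP ->.
    by rewrite add0r subrr.
  + move=> d s sV; move: (aV d s sV) (zV d s sV).
    rewrite !(cochainD, cochainN, cochain_mulrz) => h ->.
    by rewrite mul0r addr0.
  + rewrite half_cap.
    have h1 : vanish [set y : 'rV[R]_n.+2 | tail y != 0] (pull_cochain (@tail_map R n.+1)
       (pull_cochain (@antipode n.+1) a - (a *~ eps + 1 *~ m) - coboundary e)).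
      by apply: pull_vanish he.
    have -> : pull_cochain (@antipode n.+2) u = pull_cochain (@tail_map R n.+1) (pull_cochain (@antipode n.+1) a).
      rewrite !pull_comp; apply: eq_pull => y.
      by apply/rowP => j; rewrite !mxE.
    rewrite !pullB pullD !pull_mulrz pull1 -pull_coboundary -/u in h1.
    move=> d s sW; move: (h1 d s sW).
    rewrite !(cochainD, cochainN) => h2; lra.
- move=> P B oB; set p := fst_map _ _; pose sz := @pull_cochain R _ _ (snd_map P 'rV[R]_n.+2).
  have oU := open_setX oB (@open_half R n.+1 1); have oV := open_setX oB (@open_half R n.+1 (-1)).
  have fU := @free_half R P B n.+1 1 (mulr1 1).
  have fV := @free_half R P B n.+1 (-1) (etrans (mulrNN 1 1) (mulr1 1)).
  rewrite -setX_half_cover.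
  apply: (@free_suspension R _ P p B _ _ oU oV _ _ _ erefl fU fV (sz u) (sz z) (sz u) (sz 0)).
  + by move=> x [].
  + by move=> x [].
  + by rewrite setX_half_cap; apply: free_tail; exact: fa.
  + by rewrite setX_half_cover; apply: pull_cocyc zX => x [].
  + by rewrite pull_coboundary -pullB; apply: pull_vanish zU => x [].
  + by rewrite pull_coboundary -pullB; apply: pull_vanish zV' => x [].
  + by rewrite /sz pull0 subr0 subrr; exact: vanish0.
Qed.

Lemma zeta_exists n : exists z : cochain R 'rV[R]_n.+1, is_zeta z.
Proof. by elim: n => [|n [z /zeta_succ//]]; exact: zeta_base. Qed.

End Zeta.

(** * Configuration spaces *)

Section ConfigurationFibration.
Variables (R : realType) (k n : nat).
Local Notation P := 'M[R]_(k, n.+1).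
Local Notation Y := 'rV[R]_n.+1.
Local Notation M := (P * Y)%type.

Lemma open_row_neq (T : topologicalType) (f g : T -> Y) :
  continuous f -> continuous g -> open [set x | f x != g x].
Proof.
move=> cf cg.
have c : continuous (fun x => f x - g x).
  apply: continuous_entries => i j; under eq_fun do rewrite !mxE.
  by apply: continuous_addr; [|apply: continuous_oppr]; exact: continuous_row_entry.
rewrite (_ : [set x | _] = (fun x => f x - g x) @^-1` @nz R n.+1).
  by move/continuousP: c; apply; exact: open_nz.
by apply/seteqP; split=> x; rewrite /nz /= subr_eq0.
Qed.

Lemma continuous_row (T : topologicalType) m l (f : T -> 'M[R]_(m, l)) i :
  continuous f -> continuous (fun x => row i (f x)).
Proof.
move=> cf; apply: continuous_entries => a b; under eq_fun do rewrite mxE.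
exact: continuous_row_entry.
Qed.

Lemma open_forall (T : topologicalType) (I : finType) (A : I -> set T) :
  (forall i, open (A i)) -> open [set x | forall i, A i x].
Proof.
move=> oA; rewrite openE => x Ax; apply: filter_forall => i.
exact: open_nbhs_nbhs.
Qed.

Lemma open_imply (T : topologicalType) (b : bool) (A : set T) :
  open A -> open [set x | b -> A x].
Proof.
case: b => oA; last by rewrite (_ : [set x | _] = setT); [exact: openT|apply/seteqP].
by rewrite (_ : [set x | _] = A) //; apply/seteqP; split=> x /=; [apply|].
Qed.

Lemma open_conf : open (conf R k n.+1).
Proof.
rewrite (_ : conf R k n.+1 = [set x | forall ij : 'I_k * 'I_k, ij.1 != ij.2 -> row ij.1 x != row ij.2 x]).
  apply: open_forall => -[i j]; apply: (@open_imply _ _ ([set x : P | row i x != row j x])).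
  by apply: open_row_neq; apply: continuous_row => x; exact: cvg_id.
by apply/seteqP; split=> x h => [[i j]|i j ij]; [exact: h|exact: (h (i, j))].
Qed.

(** Interpolates between the product of [conf] with the whole space, for [j = 0], and the
    configurations with one more point, for [j = k]. *)
Definition avoid (j : nat) : set M :=
  [set z | conf R k n.+1 z.1 /\ forall i : 'I_k, (i < j)%N -> z.2 != row i z.1].

Let c_fst : continuous (fun z : M => z.1) := @continuous_fst _ _.
Let c_snd : continuous (fun z : M => z.2) := @continuous_snd _ _.

Lemma open_avoid j : open (avoid j).
Proof.
rewrite (_ : avoid j = fst @^-1` conf R k n.+1 `&`
    [set z : M | forall i : 'I_k, (i < j)%N -> z.2 != row i z.1]) //.
apply: openI; first by move/continuousP: c_fst; apply; exact: open_conf.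
apply: open_forall => i; apply: (@open_imply _ _ ([set z : M | z.2 != row i z.1])).
by apply: open_row_neq => //; exact: continuous_row.
Qed.

Section Ball.
Variable j : 'I_k.

(** The ball of this radius about row [j] contains no other row. The cap 1 gives a value when there
    is no other row. *)
Definition radius (x : P) : R := \big[Num.min/1]_(i | i != j) `|row i x - row j x|.

Lemma radius_gt0 x : conf R k n.+1 x -> 0 < radius x.
Proof.
by move=> cx; apply: lt_bigmin => // i ij; rewrite normr_gt0 subr_eq0; exact: cx.
Qed.

Lemma radius_le x i : i != j -> radius x <= `|row i x - row j x|.
Proof. by move=> ij; exact: bigmin_le_cond. Qed.

Lemma continuous_subrow (T : topologicalType) (f g : T -> Y) :
  continuous f -> continuous g -> continuous (fun x => f x - g x).
Proof.
move=> cf cg; apply: continuous_entries => i l; under eq_fun do rewrite !mxE.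
by apply: continuous_addr; [|apply: continuous_oppr]; exact: continuous_row_entry.
Qed.

Lemma continuous_addrow (T : topologicalType) (f g : T -> Y) :
  continuous f -> continuous g -> continuous (fun x => f x + g x).
Proof.
move=> cf cg; apply: continuous_entries => i l; under eq_fun do rewrite !mxE.
by apply: continuous_addr; exact: continuous_row_entry.
Qed.

Lemma continuous_scalerow (T : topologicalType) (f : T -> R) (g : T -> Y) :
  continuous f -> continuous g -> continuous (fun x => f x *: g x).
Proof.
move=> cf cg; apply: continuous_entries => i l; under eq_fun do rewrite !mxE.
by apply: continuous_mulr => //; exact: continuous_row_entry.
Qed.

Lemma continuous_norm_row (T : topologicalType) (f : T -> Y) :
  continuous f -> continuous (fun x => `|f x|).
Proof.
by move=> cf; apply: continuous_compose cf _; exact: norm_continuous.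
Qed.

Lemma radius_continuous : continuous radius.
Proof.
rewrite /radius; apply: continuous_big => [|i _].
  rewrite (_ : (fun _ => _) = fun z : R * R => (z.1 + z.2 - `|z.1 - z.2|) * 2^-1); last first.
    by apply/funext => z; rewrite minr_absE.
  have cf := @continuous_fst R R; have cs := @continuous_snd R R.
  apply: continuous_mulr; last exact: cst_continuous.
  apply: continuous_addr; first exact: continuous_addr.
  apply/continuous_oppr/continuous_normr/continuous_addr => //; exact: continuous_oppr.
apply: continuous_norm_row; apply: continuous_subrow; apply: continuous_row => x; exact: cvg_id.
Qed.

Definition near_row : set M := [set z | conf R k n.+1 z.1 /\ `|z.2 - row j z.1| < radius z.1].

Let c_diff : continuous (fun z : M => z.2 - row j z.1).
Proof. by apply: continuous_subrow => //; exact: continuous_row. Qed.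

Let c_radius : continuous (fun z : M => radius z.1).
Proof. by apply: continuous_compose c_fst _; exact: radius_continuous. Qed.

Lemma open_near_row : open near_row.
Proof.
rewrite (_ : near_row = fst @^-1` conf R k n.+1 `&`
    [set z : M | `|z.2 - row j z.1| - radius z.1 < 0]).
  apply: openI; first by move/continuousP: c_fst; apply; exact: open_conf.
  apply: (@open_comp _ _ (fun z : M => `|z.2 - row j z.1| - radius z.1) [set r | r < 0]); last exact: open_lt.
  move=> z _; move: z; apply: continuous_addr; [exact: continuous_norm_row|exact: continuous_oppr].
by apply/seteqP; split=> z [h1 h2]; split=> //; move: h2; rewrite /= subr_lt0.
Qed.

Lemma avoid_cover : avoid j.+1 `|` near_row = avoid j.
Proof.
apply/seteqP; split=> z /=.
  case=> -[cz h]; split=> // i ij; first by apply: h; exact: ltnW.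
  have ij' : i != j by rewrite -val_eqE neq_ltn ij.
  apply: contraTneq h => ->; rewrite -leNgt.
  exact: radius_le.
move=> [cz h]; have [e|ne] := eqVneq z.2 (row j z.1).
  by right; split=> //; rewrite e subrr normr0; exact: radius_gt0.
left; split=> // i; rewrite ltnS leq_eqVlt => /orP[/eqP/val_inj ->//|]; exact: h.
Qed.

Lemma avoid_cap : avoid j.+1 `&` near_row =
  [set z : M | conf R k n.+1 z.1 /\ 0 < `|z.2 - row j z.1| < radius z.1].
Proof.
apply/seteqP; split=> z /=.
  by move=> [[cz h] [_ h']]; split=> //; rewrite h' andbT normr_gt0 subr_eq0; exact: h.
move=> [cz /andP[h0 h]]; split; split=> // i.
rewrite ltnS leq_eqVlt => /orP[/eqP/val_inj ->|ij]; first by rewrite -subr_eq0 -normr_gt0.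
have ij' : i != j by rewrite -val_eqE neq_ltn ij.
by apply: contraTneq h => ->; rewrite -leNgt; exact: radius_le.
Qed.

Lemma continuous_displacement : continuous (fun z : M => z.2 - row j z.1).
Proof. exact: c_diff. Qed.

Definition displacement : continuousType M Y := mkcts continuous_displacement.

Local Notation p := (fst_map P Y).

Lemma free_near_row : free_over p (conf R k n.+1) near_row 1 (fun=> 1 : cochain R M).
Proof.
have cg : continuous (fun x : P => (x, row j x)).
  by apply: continuous_pair; [move=> ?; exact: cvg_id|apply: continuous_row => ?; exact: cvg_id].
pose g : continuousType P M := mkcts cg.
have -> : (fun=> 1 : cochain R M) = (fun _ : nat => pull_cochain p 1).
  by apply/funext => _; rewrite pull1.
have c1 : continuous (fun z : R * M => z.2.1).
  by apply: continuous_compose; [exact: continuous_snd|exact: continuous_fst].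
have cH : continuous (fun z : R * M => (z.2.1, row j z.2.1 + z.1 *: (z.2.2 - row j z.2.1))).
  apply: continuous_pair => //; apply: continuous_addrow; first exact: continuous_row.
  apply: continuous_scalerow; first exact: continuous_fst.
  by apply: continuous_compose c_diff; exact: continuous_snd.
apply: (@free_transport R M P P p (idfun : continuousType P P) (conf R k n.+1) _ (conf R k n.+1) p g _ snd _ _ _ _ cH) => //=.
- by move=> x [].
- by move=> x cx; split=> //=; rewrite subrr normr0; exact: radius_gt0.
- move=> t [x y] /andP[t0 t1] [/= cx h]; split=> //=.
  rewrite addrAC subrr add0r normrZ ger0_norm //; apply: le_lt_trans h.
  by rewrite ler_piMl.
- by move=> [x y]; congr pair; rewrite scale0r addr0.
- by move=> [x y]; congr pair; rewrite /= scale1r addrC subrK.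
- exact: continuous_snd.
- exact: free_id.
Qed.

Lemma free_near_row_punctured (z : cochain R Y) : is_zeta z ->
  free_over p (conf R k n.+1) (avoid j.+1 `&` near_row) 2 (unit_and (pull_cochain displacement z)).
Proof.
move=> hz; have fz := zeta_free hz open_conf; rewrite avoid_cap.
have c2 (T : topologicalType) (r t : T -> R) (w : T -> Y) : continuous r -> continuous t -> continuous w ->
    continuous (fun x => ((1 - t x) * (r x * (1 + `|w x|)^-1) + t x) *: w x).
  move=> cr ct cw; apply: continuous_scalerow => //; apply: continuous_addr => //.
  apply: continuous_mulr.
    by apply: continuous_addr; [exact: cst_continuous|exact: continuous_oppr].
  apply: continuous_mulr => // x.
  apply: (@continuousV R T (fun x => 1 + `|w x|)); first by rewrite gt_eqF // ltr_pwDl.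
  move: x; apply: continuous_addr; [exact: cst_continuous|exact: continuous_norm_row].
have cf : continuous (fun z : M => (z.1, z.2 - row j z.1)) by exact: continuous_pair.
(* [h 0] shrinks the whole space radially into the ball of radius [radius x], and [h 1] is the
   identity. It provides the inverse [g] as well as both homotopies. *)
pose h t (x : P) (w : Y) : Y := ((1 - t) * (radius x * (1 + `|w|)^-1) + t) *: w.
have cg : continuous (fun z : M => (z.1, row j z.1 + h 0 z.1 z.2)).
  apply: continuous_pair => //; apply: continuous_addrow; first exact: continuous_row.
  by apply: c2 => //; exact: cst_continuous.
have c1 : continuous (fun z : R * M => z.2.1).
  by apply: continuous_compose; [exact: continuous_snd|exact: continuous_fst].
have c3 : continuous (fun z : R * M => z.2.2).
  by apply: continuous_compose; [exact: continuous_snd|exact: continuous_snd].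
have c4 : continuous (fun z : R * M => radius z.2.1).
  by apply: continuous_compose c1 _; exact: radius_continuous.
have c5 : continuous (fun z : R * M => z.1) by exact: continuous_fst.
have cH : continuous (fun z : R * M => (z.2.1, row j z.2.1 + h z.1 z.2.1 (z.2.2 - row j z.2.1))).
  apply: continuous_pair => //; apply: continuous_addrow; first exact: continuous_row.
  by apply: c2 => //; apply: continuous_subrow => //; exact: continuous_row.
have cK : continuous (fun z : R * M => (z.2.1, h z.1 z.2.1 z.2.2)).
  by apply: continuous_pair => //; exact: c2.
pose f : continuousType M M := mkcts cf.
pose g : continuousType M M := mkcts cg.
rewrite (_ : unit_and _ = (fun i => pull_cochain f (unit_and (pull_cochain (snd_map P Y) z) i))); last first.
  apply/funext => -[|i] /=; first by rewrite pull1.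
  by rewrite pull_comp; exact: eq_pull.
have h1 x w : h 1 x w = w by rewrite /h subrr mul0r add0r scale1r.
have h_gt0 t x (w : Y) : conf R k n.+1 x -> 0 <= t <= 1 -> w != 0 ->
    0 < (1 - t) * (radius x * (1 + `|w|)^-1) + t.
  move=> cx /andP[t0 t1] w0.
  have q0 : 0 < radius x * (1 + `|w|)^-1.
    by rewrite divr_gt0 ?radius_gt0 // ltr_pwDl.
  move: t0; rewrite le_eqVlt => /orP[/eqP <-|t0]; first by rewrite subr0 mul1r addr0.
  by apply: ltr_wpDl => //; rewrite mulr_ge0 ?subr_ge0 // ltW.
have h_neq0 t x (w : Y) : conf R k n.+1 x -> 0 <= t <= 1 -> w != 0 -> h t x w != 0.
  by move=> cx t01 w0; rewrite scaler_eq0 negb_or w0 andbT gt_eqF // h_gt0.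
have h0_lt x (w : Y) : conf R k n.+1 x -> w != 0 -> `|h 0 x w| < radius x.
  move=> cx w0; rewrite normrZ gtr0_norm ?h_gt0 ?lexx ?ler01 // subr0 mul1r addr0.
  rewrite -mulrA gtr_pMr ?radius_gt0 // mulrC ltr_pdivrMr ?ltr_pwDl //.
  by rewrite mul1r ltrDr.
have h_lt t x (w : Y) : conf R k n.+1 x -> 0 <= t <= 1 -> w != 0 -> `|w| < radius x ->
    `|h t x w| < radius x.
  move=> cx /andP[t0 t1] w0 wr.
  have -> : h t x w = (1 - t) *: h 0 x w + t *: w.
    by rewrite /h subr0 mul1r addr0 scalerA -scalerDl.
  have := h0_lt x w cx w0; move: (h 0 x w) => q qr.
  apply: le_lt_trans (ler_normD _ _) _; rewrite !normrZ !ger0_norm ?subr_ge0 //.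
  move: t0; rewrite le_eqVlt => /orP[/eqP <-|t0]; first by rewrite subr0 mul1r mul0r addr0.
  have := ler_wpM2l (_ : 0 <= 1 - t) (ltW qr); rewrite subr_ge0 => /(_ t1) a1.
  by have := wr; rewrite -(ltr_pM2l t0) => a2; lra.
apply: (@free_transport R _ _ P p p (conf R k n.+1) _ (conf R k n.+1 `*` @nz R n.+1) f g _ _ _ _ _ _ cH _ _ _ cK _ _ _ _ _ fz) => //=.
- by move=> [x y] [/= cx /andP[h0 hr]]; split=> //=; rewrite /nz /= -normr_gt0.
- move=> [x w] [/= cx w0]; split=> //=.
  by rewrite addrAC subrr add0r h0_lt // normr_gt0 h_neq0 // lexx ler01.
- by move=> x [].
- move=> t [x y] t01 [/= cx /andP[h0 hr]]; split=> //=.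
  have w0 : y - row j x != 0 by rewrite -normr_gt0.
  by rewrite addrAC subrr add0r h_lt // normr_gt0 h_neq0.
- by move=> [x y]; congr pair; rewrite h1 addrC subrK.
- by move=> t [x w] t01 [/= cx w0]; split=> //=; exact: h_neq0.
- by move=> [x w]; congr pair; rewrite /= addrAC subrr add0r.
- by move=> [x w]; congr pair; rewrite h1.
Qed.

End Ball.

Variables (z : cochain R Y) (hz : is_zeta z).
Local Notation p := (fst_map P Y).

Definition fiber_class (i : nat) : cochain R M :=
  if i is i'.+1 then if insub i' is Some j then pull_cochain (displacement j) z else 0 else 1.

Lemma fiber_classS (j : 'I_k) : fiber_class j.+1 = pull_cochain (displacement j) z.
Proof. by rewrite /= insubT // => jk; congr (pull_cochain (displacement _) z); exact: val_inj. Qed.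

Lemma free_avoid j : (j <= k)%N -> free_over p (conf R k n.+1) (avoid j) j.+1 fiber_class.
Proof.
elim: j => [_|j IH jk].
  have cg : continuous (fun x : P => (x, 0 : Y)).
    by apply: continuous_pair; [move=> ?; exact: cvg_id|exact: cst_continuous].
  pose g : continuousType P M := mkcts cg.
  apply: (@eq_free _ _ _ _ _ _ _ (fun=> pull_cochain p 1)) => [[|//] _|x []//|].
    by rewrite pull1; exact: cohom_refl.
  have cH : continuous (fun z : R * M => (z.2.1, z.1 *: z.2.2)).
    apply: continuous_pair; last apply: continuous_scalerow.
    - by apply: continuous_compose; [exact: continuous_snd|exact: continuous_fst].
    - exact: continuous_fst.
    - by apply: continuous_compose; [exact: continuous_snd|exact: continuous_snd].
  apply: (@free_transport R M P P p (idfun : continuousType P P) (conf R k n.+1) _ (conf R k n.+1) p g _ snd _ _ _ _ cH) => //=.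
  - by move=> x [].
  - by move=> t x _ [].
  - by move=> [x y]; congr pair; rewrite scale0r.
  - by move=> [x y]; congr pair; rewrite /= scale1r.
  - exact: continuous_snd.
  - exact: free_id.
pose oj : 'I_k := Ordinal jk.
have := IH (ltnW jk); rewrite -(avoid_cover oj) => fX.
apply: (@free_puncture R M P p _ _ _ (@open_avoid oj.+1) (@open_near_row oj) _ _ (fun=> 1) erefl _ _ _ fX).
- by move=> x [].
- by move=> x [].
- exact: free_near_row.
- by rewrite (fiber_classS oj); exact: free_near_row_punctured.
- rewrite (fiber_classS oj); apply: pull_cocyc (zeta_cocyc hz) => x [_ h].
  by rewrite /nz /= subr_eq0; exact: h.
Qed.

End ConfigurationFibration.

Section GaussClasses.
Variables (R : realType) (n : nat) (z : cochain R 'rV[R]_n.+1) (hz : is_zeta z).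
Local Notation Y := 'rV[R]_n.+1.

Lemma continuous_difference k (a b : 'I_k) : continuous (fun x : 'M[R]_(k, n.+1) => row b x - row a x).
Proof. by apply: continuous_subrow; apply: continuous_row => x; exact: cvg_id. Qed.

Definition difference k (a b : 'I_k) : continuousType 'M[R]_(k, n.+1) Y :=
  mkcts (@continuous_difference k a b).

Definition gclass k (a b : 'I_k) : cochain R 'M[R]_(k, n.+1) := pull_cochain (difference a b) z.

Lemma gclass_cocyc k (a b : 'I_k) : a != b -> cocyc (conf R k n.+1) (gclass a b).
Proof.
move=> ab; apply: pull_cocyc (zeta_cocyc hz) => x cx.
by rewrite /nz /= subr_eq0 eq_sym; exact: cx.
Qed.

Lemma gclass_homogeneous k (a b : 'I_k) : homogeneous_cochain n (gclass a b).
Proof. exact: pull_homogeneous (zeta_homogeneous hz). Qed.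

Lemma continuous_rowsub k l (f : 'I_l -> 'I_k) :
  continuous (fun x : 'M[R]_(k, n.+1) => rowsub f x : 'M[R]_(l, n.+1)).
Proof.
apply: continuous_entries => i j; under eq_fun do rewrite mxE.
exact: coord_continuous.
Qed.

Definition select k l (f : 'I_l -> 'I_k) : continuousType 'M[R]_(k, n.+1) 'M[R]_(l, n.+1) :=
  mkcts (@continuous_rowsub k l f).

Lemma row_select k l (f : 'I_l -> 'I_k) x i : row i (select f x) = row (f i) x.
Proof. by apply/rowP => j; rewrite !mxE. Qed.

Lemma conf_select k l (f : 'I_l -> 'I_k) x : injective f ->
  conf R k n.+1 x -> conf R l n.+1 (select f x).
Proof. by move=> fi cx i j ij; rewrite !row_select; apply: cx; rewrite (inj_eq fi). Qed.

Lemma pull_select k l (f : 'I_l -> 'I_k) a b :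
  pull_cochain (select f) (gclass a b) = gclass (f a) (f b).
Proof.
rewrite pull_comp; apply: eq_pull => x.
exact: (congr2 (fun u v => u - v) (row_select f x b) (row_select f x a)).
Qed.

Section Forget.
Variable k : nat.
Local Notation lift0 := (lift (ord0 : 'I_k.+1)).
Local Notation forget := (select lift0).

Definition first_class (j : 'I_k.+1) : cochain R 'M[R]_(k.+1, n.+1) :=
  if unlift ord0 j is Some i then gclass (lift0 i) ord0 else 1.

Lemma free_forget : free_over forget (conf R k n.+1) (conf R k.+1 n.+1) k.+1
  (fun i => first_class (inord i)).
Proof.
pose P := 'M[R]_(k, n.+1); pose M := (P * Y)%type.
have cid (T : topologicalType) : continuous (fun x : T => x) by move=> x; exact: cvg_id.
have cf : continuous (fun x : 'M[R]_(k.+1, n.+1) => (forget x, row ord0 x)).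
  by apply: continuous_pair; [exact: continuous_rowsub|exact: continuous_row].
have cg : continuous (fun z : M => \matrix_(i < k.+1, j < n.+1) (if unlift ord0 i is Some i' then z.1 i' j else z.2 0 j)).
  apply: continuous_entries => i j; under eq_fun do rewrite mxE.
  case: (unlift _ _) => [i'|]; apply: continuous_row_entry; [exact: continuous_fst|exact: continuous_snd].
pose f : continuousType 'M[R]_(k.+1, n.+1) M := mkcts cf.
pose g : continuousType M 'M[R]_(k.+1, n.+1) := mkcts cg.
have row0 x y : row ord0 (g (x, y)) = y by apply/rowP => j; rewrite !mxE unlift_none.
have rowl x y i : row (lift0 i) (g (x, y)) = row i x by apply/rowP => j; rewrite !mxE liftK.
have fg x : f (g x) = x.
  case: x => x y; congr pair; last exact: row0.
  by apply/row_matrixP => i; rewrite row_select rowl.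
have gf x : g (f x) = x.
  apply/row_matrixP => i; rewrite (_ : f x = (forget x, row ord0 x)) //.
  by case: (unliftP ord0 i) => [j ->|->]; rewrite ?row0 ?rowl ?row_select.
have cs (T : topologicalType) : continuous (fun z : R * T => z.2) by exact: continuous_snd.
have fA x : conf R k.+1 n.+1 x -> @avoid R k n k (f x).
  move=> cx; split=> [|i _]; first by apply: conf_select cx; exact: lift_inj.
  by rewrite row_select; apply: cx; exact: neq_lift.
have gA x : @avoid R k n k x -> conf R k.+1 n.+1 (g x).
  case: x => x y [/= cx cy] i j.
  case: (unliftP ord0 i) => [i' ->|->]; case: (unliftP ord0 j) => [j' ->|->] ij; rewrite ?row0 ?rowl.
  - by apply: cx; apply: contraNneq ij => ->.
  - by rewrite eq_sym; exact: cy.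
  - exact: cy.
  - by rewrite eqxx in ij.
have F := free_avoid hz (leqnn k).
apply: (@eq_free _ _ _ _ _ _ _ (fun i => pull_cochain f (fiber_class k z i))); last first.
(* [f] and [g] are inverse homeomorphisms, so both homotopies are constant: [snd]. *)
- apply: (@free_transport R _ M P forget (fst_map P Y) (conf R k n.+1) _ (@avoid R k n k) f g snd snd _ _ _ _ _ _ _ _ _ _ _ _ _ _ F) => //.
  by move=> x [].
- by move=> x cx; apply: conf_select cx; exact: lift_inj.
move=> [|i] ik.
  by rewrite /first_class (_ : inord 0 = ord0) ?unlift_none ?pull1; [exact: cohom_refl|exact/val_inj/inordK].
have ik' : (i < k)%N by [].
rewrite (fiber_classS z (Ordinal ik')) /first_class (_ : inord i.+1 = lift0 (Ordinal ik')); last first.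
  by apply: val_inj; rewrite /= inordK.
rewrite liftK pull_comp; apply: cohom_vanish.
rewrite (_ : pull_cochain _ z = gclass (lift0 (Ordinal ik')) ord0) ?subrr; first exact: vanish0.
apply: eq_pull => x.
exact: (congr1 (fun u => _ - u) (row_select lift0 x (Ordinal ik'))).
Qed.

End Forget.
End GaussClasses.

(** * Bases over the integers *)

Section IntegralBases.
Variable R : realType.

(* The cohomology of [A] is a free abelian group on the classes of the [m i]. *)
Record int_basis (M : topologicalType) (A : set M) (I : finType) (m : I -> cochain R M) : Prop := IntBasis {
  basis_cocyc : forall i, cocyc A (m i);
  basis_span : forall c, cocyc A c -> exists x : I -> int, cohom A c (\sum_i m i *~ x i);
  basis_indep : forall x : I -> int, cohom A (\sum_i m i *~ x i) 0 -> forall i, x i = 0 }.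

Lemma int_basis_free (M P : topologicalType) (p : continuousType M P) (B : set P) (A : set M)
    (I : finType) (m : I -> cochain R P) r (a : 'I_r -> cochain R M) (a' : nat -> cochain R M) :
  (forall x, A x -> B (p x)) -> (forall j : 'I_r, a j = a' j) ->
  free_over p B A r a' -> int_basis B m ->
  int_basis A (fun ij : I * 'I_r => pull_cochain p (m ij.1) * a ij.2).
Proof.
move=> pAB aa [za sp ind] [zm msp mind].
have pm (x : I -> int) : pull_cochain p (\sum_i m i *~ x i) = \sum_i pull_cochain p (m i) *~ x i.
  by rewrite (raddf_sum (pull_cochain p)); apply: eq_bigr => i _; rewrite /= pull_mulrz.
have onA (c : cochain R P) : cocyc B c -> cocyc A (pull_cochain p c) by move=> hc; exact: (pull_cocyc pAB hc).
have sumE (x : I * 'I_r -> int) : \sum_ij (pull_cochain p (m ij.1) * a ij.2) *~ x ij =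
    \sum_(j < r) pull_cochain p (\sum_i m i *~ x (i, j)) * a' j.
  rewrite (eq_bigr (fun ij => (pull_cochain p (m ij.1) * a ij.2) *~ x (ij.1, ij.2))) => [|[]//].
  rewrite -(pair_bigA _ (fun i j => (pull_cochain p (m i) * a j) *~ x (i, j))) exchange_big /=.
  apply: eq_bigr => j _; rewrite pm mulr_suml; apply: eq_bigr => i _.
  by rewrite aa mulrzAl.
split.
- by move=> [i j] /=; apply: cocycM; [exact: onA|rewrite aa; exact: za].
- move=> c /sp[beta [hb h]].
  have /choice[x hx] : forall j : 'I_r, exists x : I -> int, cohom B (beta j) (\sum_i m i *~ x i).
    by move=> j; exact: msp.
  exists (fun ij => x ij.2 ij.1); apply: cohom_trans h _; rewrite sumE.
  apply: cohom_sum => j _; apply: cohomMr; first exact: za.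
  exact: (pull_cohom pAB (hx j)).
- move=> x; rewrite sumE => h [i j].
  (* [free_indep] expects a family indexed by all natural numbers; it is continued by zero. *)
  pose beta (l : nat) := if insub l is Some j then \sum_i m i *~ x (i, j) else 0.
  have hb l : cocyc B (beta l).
    rewrite /beta; case: insubP => [j' _ _|_]; last exact: cocyc0.
    by apply: cocyc_sum => i' _; exact: cocyc_mulrz.
  have hE : \sum_(j < r) pull_cochain p (\sum_i m i *~ x (i, j)) * a' j = \sum_(j < r) pull_cochain p (beta j) * a' j.
    by apply: eq_bigr => j' _; rewrite /beta valK.
  rewrite hE in h; have := ind _ hb h j (ltn_ord j); rewrite /beta valK.
  by move=> /mind/(_ i).
Qed.

Lemma sum_alternating d (x : int) : \sum_(i < d) (-1) ^+ i * x = if odd d then x else 0.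
Proof.
elim: d => [|d IH]; first by rewrite big_ord0.
rewrite big_ord_recr IH /= -signr_odd; case: odd; rewrite ?expr1 ?expr0; ring.
Qed.

(** There is one simplex in each degree, and the coboundary from degree [d] is an alternating sum of
    [d + 2] equal terms: the identity for [d] odd, zero for [d] even. *)
Lemma int_basis_point (M : topologicalType) (A : set M) (pt : M) :
  (forall x y : M, x = y) -> A pt -> int_basis A (fun _ : unit => 1 : cochain R M).
Proof.
move=> Mpt Apt.
have all_A x : A x by rewrite (Mpt x pt).
have s0 d : simplex R M d by exact: mkcts (@cst_continuous (stdsimplex R d) M pt).
have sE d (s s' : simplex R M d) : s = s' by apply/continuousEP => t; exact: Mpt.
have dE (c : cochain R M) d (s : simplex R M d.+1) : coboundary c d.+1 s = if odd d then c d (s0 d) else 0.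
  rewrite -[LHS]/(\sum_(i < d.+2) (-1) ^+ i * c d (face s i)).
  under eq_bigr do rewrite (sE _ (face s _) (s0 d)).
  by rewrite sum_alternating /= negbK.
have c0 (c : cochain R M) d (s : simplex R M d) : cocyc A c -> odd d -> c d s = 0.
  move=> hc od; have := hc d.+1 (s0 d.+1) (fun t => all_A _).
  by rewrite dE od (sE _ s (s0 d)).
have su (F : unit -> cochain R M) : \sum_i F i = F tt.
  by rewrite (bigD1 tt) //= big1 ?addr0 // => -[].
split=> [_|c hc|x [e he] []].
- exact: cocyc1.
- exists (fun=> c 0%N (s0 0%N)); rewrite su.
  (* The primitive is [c] shifted down by one, placed in the odd degrees where the coboundary is the
     identity. *)
  have eb : exists N, forall d (s : simplex R M d), (N <= d)%N -> (if odd d then c d.+1 (s0 d.+1) else 0) = 0.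
    by have [N cN] := cochain_boundP c; exists N => d s Nd; case: odd; rewrite // cN // ltnW.
  exists (mk_cochain eb) => d s _; rewrite !cochainD !cochainN cochain_mulrz.
  case: d s => [|d] s; first by rewrite (sE _ s (s0 0%N)) mul1r subrr subr0.
  rewrite dE mul0r subr0 -[mk_cochain eb d (s0 d)]/(if odd d then c d.+1 (s0 d.+1) else 0).
  case od: (odd d); first by rewrite (sE _ s (s0 d.+1)) subrr.
  by rewrite subr0 c0 //= od.
- have := he 0%N (s0 0%N) (fun t => all_A _).
  rewrite su subr0 cochainD cochainN cochain_mulrz mul1r.
  by rewrite subr0.
Qed.

End IntegralBases.

(** * The monomial basis and the Arnold relation *)

(** Each added point contributes a choice between no factor and a Gauss class to one of the points
    already there; in all there are [k!] indices. *)
Fixpoint idx (k : nat) : finType :=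
  if k is k'.+1 then ((idx k' * 'I_k'.+1)%type : finType) else (unit : finType).

Lemma sign_mulrz (T : pzRingType) (x : T) d : (-1) ^+ d * x = x *~ (-1) ^+ d.
Proof.
elim: d => [|d IH]; first by rewrite !expr0 mul1r mulr1z.
by rewrite !exprS -mulrA IH !mulN1r mulrNz.
Qed.

(* The products of generators [g a b] with increasing second index [b < a]; the
   component of an index at [b] is [ord0] when [b] does not occur. *)
Fixpoint mono (T : pzRingType) (k : nat) : ('I_k -> 'I_k -> T) -> idx k -> T :=
  if k is k'.+1 return ('I_k -> 'I_k -> T) -> idx k -> T then fun g i =>
    mono (fun a b => g (lift ord0 a) (lift ord0 b)) i.1 *
      (if unlift ord0 i.2 is Some j then g (lift ord0 j) ord0 else 1)
  else fun _ _ => 1.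

Fixpoint idx_deg (k : nat) : idx k -> nat :=
  if k is k'.+1 return idx k -> nat then fun i => (idx_deg i.1 + (i.2 != ord0))%N
  else fun=> 0%N.

Lemma mono_morph (T T' : pzRingType) (f : T -> T') k (g : 'I_k -> 'I_k -> T) i :
  f 1 = 1 -> {morph f : x y / x * y} -> f (mono g i) = mono (fun a b => f (g a b)) i.
Proof.
move=> f1 fM; elim: k g i => [|k IH] g i //=.
by rewrite fM IH; case: unlift => [j|]; rewrite ?f1.
Qed.

Lemma eq_mono (T : pzRingType) k (g g' : 'I_k -> 'I_k -> T) i :
  (forall a b, a != b -> g a b = g' a b) -> mono g i = mono g' i.
Proof.
elim: k g g' i => [//|k IH] g g' i gg /=; congr (_ * _).
  by apply: IH => a b ab; rewrite gg // (inj_eq lift_inj).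
by case: unlift => // j; rewrite gg // eq_sym neq_lift.
Qed.

Section Basis.
Variables (R : realType) (n : nat) (z : cochain R 'rV[R]_n.+1) (hz : is_zeta z).
Local Notation Y := 'rV[R]_n.+1.
Local Notation g k := (@gclass R n z k).

Lemma conf_basis k : int_basis (conf R k n.+1) (mono (g k)).
Proof.
elim: k => [|k IH].
  apply: (@int_basis_point _ _ _ (0 : 'M[R]_(0, n.+1))) => [x y|].
    by apply/matrixP => -[].
  by move=> [].
have := int_basis_free (a := @first_class R n z k) _ _ (free_forget hz k) IH.
rewrite (_ : (fun ij => _) = mono (g k.+1)); last first.
  apply/funext => -[i j] /=; congr (_ * _).
  rewrite mono_morph; [|exact: pull1|exact: pullM].
  by apply: eq_mono => a b _; exact: pull_select.
apply=> [x cx|j]; first by apply: conf_select cx; exact: lift_inj.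
by rewrite inord_val.
Qed.

Lemma mono_homogeneous k i : homogeneous_cochain (idx_deg i * n) (mono (g k) i).
Proof.
have key (g' : 'I_k -> 'I_k -> cochain R 'M[R]_(k, n.+1)) :
    (forall a b, homogeneous_cochain n (g' a b)) -> homogeneous_cochain (idx_deg i * n) (mono g' i).
  move: ('M[R]_(k, n.+1) : topologicalType) g' i => X; elim: k => [|k IH] g' i hg' /=.
    exact: homogeneous1.
  rewrite mulnDl; apply: homogeneousM; first by apply: IH => a b; exact: hg'.
  case: (unliftP ord0 i.2) => [j|] ->.
    by rewrite eq_sym neq_lift mul1n; exact: hg'.
  by rewrite eqxx; exact: homogeneous1.
by apply: key => a b; exact: gclass_homogeneous.
Qed.

Lemma homogeneous_span k d c : cocyc (conf R k n.+1) c -> homogeneous_cochain d c ->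
  exists x : idx k -> int, cohom (conf R k n.+1) c
    (\sum_(i | (idx_deg i * n == d)%N) mono (g k) i *~ x i).
Proof.
have [_ sp _] := conf_basis k.
move=> /sp[x hx] hd; exists x; have := component_cohom d hx.
rewrite (component_id hd) component_sum (bigID (fun i => (idx_deg i * n == d)%N)) /=.
rewrite [X in _ + X]big1 => [|i di]; last first.
  by rewrite component_mulrz (component_eq0 (@mono_homogeneous k i)) // mul0rz.
rewrite addr0 (eq_bigr (fun i => mono (g k) i *~ x i)) // => i /eqP di.
by rewrite component_mulrz component_id // -di; exact: mono_homogeneous.
Qed.

Lemma exists_select2 k (a b : 'I_k) : a != b ->
  exists f : 'I_2 -> 'I_k, [/\ injective f, f ord0 = a & f (lift ord0 ord0) = b].
Proof.
move=> ab; exists (fun i => if i == ord0 then a else b); split=> //.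
by case=> [[|[|//]] ?] [[|[|//]] ?] //= h; apply: val_inj => //=; move: ab; rewrite h eqxx.
Qed.

Lemma pull_segment (T : topologicalType) (D : set T) (f0 f1 : continuousType T Y) :
  (forall t x, 0 <= t <= 1 -> D x -> (1 - t) *: f0 x + t *: f1 x != 0) ->
  cohom D (pull_cochain f0 z) (pull_cochain f1 z).
Proof.
move=> h; apply: (@pull_homotopic _ _ _ _ _
  (fun x : R * T => (1 - x.1) *: f0 x.2 + x.1 *: f1 x.2) _ _ _ _ _ _ _ (zeta_cocyc hz)).
- apply: continuous_addrow; apply: continuous_scalerow.
  + apply: continuous_addr; first exact: cst_continuous.
    by apply: continuous_oppr; exact: continuous_fst.
  + by apply: continuous_compose (@cts_fun _ _ f0); exact: continuous_snd.
  + exact: continuous_fst.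
  + by apply: continuous_compose (@cts_fun _ _ f1); exact: continuous_snd.
- by move=> t x t01 Dx; exact: h.
- by move=> x /=; rewrite subr0 scale1r scale0r addr0.
- by move=> x /=; rewrite subrr scale1r scale0r add0r.
Qed.

Hypothesis n_gt0 : (0 < n)%N.

(** The class is pulled back from two points, where the basis monomials have degrees 0 and [n] only;
    nothing lives in degree [n + n], since [n > 0]. *)
Lemma gclass_sqr k a b : a != b -> cohom (conf R k n.+1) (g k a b * g k a b) 0.
Proof.
move=> ab; have [f [fi fa fb]] := exists_select2 ab.
rewrite -fa -fb -pull_select -pullM -(pull0 _ (@select R n k 2 f)).
apply: (pull_cohom (A := conf R 2 n.+1)) => [x|]; first exact: conf_select.
set g2 := g 2 _ _.
have zg : cocyc (conf R 2 n.+1) g2 by exact: gclass_cocyc.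
have hg : homogeneous_cochain n g2 by exact: gclass_homogeneous.
have [x] := @homogeneous_span 2 (n + n) (g2 * g2) (cocycM zg zg) (homogeneousM hg hg).
rewrite big1 // => -[[[] j1] j2] /eqP /=; rewrite (ord1 j1) eqxx add0n.
by case: (_ != _); lia.
Qed.

Lemma antipode_zeta : cohom (@nz R n.+1) (pull_cochain (@antipode R n.+1) z) (z *~ (-1) ^+ n.+1).
Proof. by have [m [/(_ n_gt0) ->]] := zeta_antipode hz; rewrite mulr0z addr0. Qed.

Lemma gclass_sym k a b : a != b -> cohom (conf R k n.+1) (g k a b) (g k b a *~ (-1) ^+ n.+1).
Proof.
move=> ab; rewrite -pull_mulrz.
have -> : g k a b = pull_cochain (@difference R n k b a) (pull_cochain (@antipode R n.+1) z).
  by rewrite pull_comp; apply: eq_pull => x; exact/esym/opprB.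
apply: pull_cohom antipode_zeta => x cx; rewrite /nz /= subr_eq0; exact: cx.
Qed.

(* The test maps below place two points at [0] and [u] and a third one in direction
   [w] close to one of them; they detect the two monomials of degree [2 * n]. *)
Local Notation D := (@nz R n.+1 `*` @nz R n.+1).
Local Notation z1 := (pull_cochain (fst_map Y Y) z).
Local Notation z2 := (pull_cochain (snd_map Y Y) z).

Let hz1 : cocyc D z1. Proof. by apply: pull_cocyc (zeta_cocyc hz) => x []. Qed.
Let hz2 : cocyc D z2. Proof. by apply: pull_cocyc (zeta_cocyc hz) => x []. Qed.

Lemma zeta_mulrz_eq0 (x : int) : cohom (@nz R n.+1) (z *~ x) 0 -> x = 0.
Proof.
move=> /cycle_eval_cohom => /(_ isT).
rewrite cycle_eval_mulrz (zeta_eval hz) mul1r => ->.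
by rewrite /cycle_eval ldeltaE big1 // => i _; case: ldel => [|y l]; rewrite mulr0.
Qed.

(** Freeness of the second factor over the base [nz], with [z *~ x] as coefficient, reduces this to
    one punctured space, where [cycle_eval] detects multiples of [z]. *)
Lemma product_mulrz_eq0 (x : int) : cohom D ((z1 * z2) *~ x) 0 -> x = 0.
Proof.
move=> h; apply: zeta_mulrz_eq0.
have h0 : cocyc (@nz R n.+1) (0 : cochain R Y) by exact: cocyc0.
have hx : cocyc (@nz R n.+1) (z *~ x) by apply: cocyc_mulrz; exact: zeta_cocyc.
have [] // := free2_indep (zeta_free hz (@open_nz R n.+1)) h0 hx.
by rewrite pull0 add0r pull_mulrz mulrzAl.
Qed.

Lemma z1_sqr : cohom D (z1 * z1) 0.
Proof.
pose f : Y * Y -> 'M[R]_(2, n.+1) := fun x => \matrix_(i, j) (if i == ord0 then x.1 0 j else 0).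
have cf : continuous f.
  apply: continuous_entries => i j; under eq_fun do rewrite mxE.
  by case: (i == ord0); [apply: continuous_row_entry; exact: continuous_fst|exact: cst_continuous].
pose fm : continuousType (Y * Y)%type 'M[R]_(2, n.+1) := mkcts cf.
have fE i x : row i (fm x) = if i == ord0 then x.1 else 0.
  by apply/rowP => j; rewrite !mxE; case: eqP; rewrite ?mxE.
have -> : z1 = pull_cochain fm (g 2 (lift ord0 ord0) ord0).
  by rewrite pull_comp; apply: eq_pull => x; rewrite -[RHS]/(row _ (fm x) - row _ (fm x)) !fE subr0.
rewrite -pullM -(pull0 _ fm); apply: (pull_cohom (A := conf R 2 n.+1)); last exact: gclass_sqr.
move=> x [/= x1 _] i j; rewrite !fE.
by case: i => [[|[|//]] ?]; case: j => [[|[|//]] ?] //= _; rewrite // eq_sym.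
Qed.

Lemma z_comm : cohom D (z2 * z1) ((z1 * z2) *~ (-1) ^+ (n * n)).
Proof.
rewrite -sign_mulrz; apply: cohom_cupC => //; exact: pull_homogeneous (zeta_homogeneous hz).
Qed.

Section TestMap.
Variables (p0 : Y * Y -> Y) (cp0 : continuous p0).

Lemma test_continuous : continuous (fun x : Y * Y =>
  \matrix_(i < 3, j < n.+1) (nth 0 [:: p0 x; x.1; 0] i) 0 j : 'M[R]_(3, n.+1)).
Proof.
apply: continuous_entries => i j; under eq_fun do rewrite mxE.
case: i => [[|[|[|//]]] _] /=; last exact: cst_continuous.
  exact: continuous_row_entry.
by apply: continuous_row_entry; exact: continuous_fst.
Qed.

Definition test_map : continuousType (Y * Y)%type 'M[R]_(3, n.+1) := mkcts test_continuous.

Lemma row_test (i : 'I_3) x : row i (test_map x) = nth 0 [:: p0 x; x.1; 0] i.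
Proof. by apply/rowP => j; rewrite !mxE. Qed.

Lemma conf_test x : x.1 != 0 -> p0 x != x.1 -> p0 x != 0 -> conf R 3 n.+1 (test_map x).
Proof.
move=> x1 px p00 i j; rewrite !row_test.
by case: i => [[|[|[|//]]] ?]; case: j => [[|[|[|//]]] ?] //= _; rewrite // eq_sym.
Qed.

End TestMap.

(** A vector in the direction of [x.2], shorter than [x.1]; adding it to [x.1] or subtracting [x.1]
    from it cannot give zero. *)
Definition shrink (x : Y * Y) : Y := (`|x.1| * (1 + `|x.2|)^-1) *: x.2.

Lemma shrink_continuous : continuous shrink.
Proof.
apply: continuous_scalerow; last exact: continuous_snd.
apply: continuous_mulr; first by apply: continuous_norm_row; exact: continuous_fst.
move=> x; apply: (@continuousV R _ (fun x : Y * Y => 1 + `|x.2|)); first by rewrite gt_eqF // ltr_pwDl.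
move: x; apply: continuous_addr; first exact: cst_continuous.
by apply: continuous_norm_row; exact: continuous_snd.
Qed.

Lemma shrink_coef x : D x -> 0 < `|x.1| * (1 + `|x.2|)^-1.
Proof. by move=> [x1 x2]; rewrite divr_gt0 ?normr_gt0 // ltr_pwDl. Qed.

Lemma shrink_neq0 x : D x -> shrink x != 0.
Proof. by move=> Dx; have [_ x2] := Dx; rewrite scaler_eq0 negb_or x2 gt_eqF // shrink_coef. Qed.

Lemma shrink_lt x : D x -> `|shrink x| < `|x.1|.
Proof.
move=> Dx; have [x1 x2] := Dx; rewrite normrZ gtr0_norm ?shrink_coef //.
rewrite -mulrA gtr_pMr ?normr_gt0 // mulrC ltr_pdivrMr ?ltr_pwDl //.
by rewrite mul1r ltrDr.
Qed.

Lemma shrink_far x (t : R) : D x -> 0 <= t <= 1 -> x.1 + t *: shrink x != 0.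
Proof.
move=> Dx /andP[t0 t1]; apply/negP; rewrite addr_eq0 => /eqP.
have := shrink_lt Dx; move: (shrink x) x.1 => v u + x1E; rewrite x1E normrN normrZ ger0_norm // ltNge => /negP; apply.
by rewrite ler_piMl.
Qed.

Let i0 : 'I_3 := ord0.
Let i1 : 'I_3 := lift ord0 ord0.
Let i2 : 'I_3 := lift ord0 (lift ord0 ord0).
Local Notation eps := ((-1) ^+ n.+1 : int).

Lemma pull_test (p0 : Y * Y -> Y) (cp0 : continuous p0) (a b : 'I_3) (f : Y * Y -> Y) (cf : continuous f) :
  (forall x, nth 0 [:: p0 x; x.1; 0] b - nth 0 [:: p0 x; x.1; 0] a = f x) ->
  pull_cochain (test_map cp0) (g 3 a b) = pull_cochain (mkcts cf) z.
Proof.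
move=> h; rewrite pull_comp; apply: eq_pull => x.
by rewrite -[LHS]/(row b (test_map cp0 x) - row a (test_map cp0 x)) !row_test h.
Qed.

Let cfst : continuous (fun x : Y * Y => x.1) := @continuous_fst _ _.
Let csnd : continuous (fun x : Y * Y => x.2) := @continuous_snd _ _.

Lemma shrink_direction : cohom D (pull_cochain (mkcts shrink_continuous) z) z2.
Proof.
rewrite (_ : z2 = pull_cochain (mkcts csnd) z); last exact: eq_pull.
apply: pull_segment => t x /andP[t0 t1] Dx; have [_ x2] := Dx.
rewrite /shrink scalerA -scalerDl scaler_eq0 negb_or x2 andbT gt_eqF //.
move: t0; rewrite le_eqVlt => /orP[/eqP <-|t0]; first by rewrite subr0 mul1r addr0 shrink_coef.
by apply: ltr_wpDl => //; rewrite mulr_ge0 ?subr_ge0 // ltW // shrink_coef.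
Qed.

Definition near_point1 (x : Y * Y) : Y := x.1 + shrink x.

Lemma near_point1_continuous : continuous near_point1.
Proof. by apply: continuous_addrow; [exact: cfst|exact: shrink_continuous]. Qed.

Lemma near_point1_direction : cohom D (pull_cochain (mkcts near_point1_continuous) z) z1.
Proof.
rewrite (_ : z1 = pull_cochain (mkcts cfst) z); last exact: eq_pull.
apply: pull_segment => t x /andP[t0 t1] Dx.
rewrite /near_point1 scalerDr addrAC -scalerDl subrK scale1r.
by apply: shrink_far => //; rewrite subr_ge0 t1 lerBlDr lerDl.
Qed.

Lemma conf_near_point1 x : D x -> conf R 3 n.+1 (test_map near_point1_continuous x).
Proof.
move=> Dx; apply: conf_test; first by case: Dx.
  by rewrite /near_point1 -subr_eq0 addrAC subrr add0r shrink_neq0.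
by have := shrink_far Dx (t := 1); rewrite scale1r; apply; rewrite ler01 lexx.
Qed.

Lemma conf_shrink x : D x -> conf R 3 n.+1 (test_map shrink_continuous x).
Proof.
move=> Dx; apply: conf_test; first by case: Dx.
  by apply: contraTneq (shrink_lt Dx) => ->; rewrite ltxx.
exact: shrink_neq0.
Qed.

Lemma continuous_shrink_sub : continuous (fun x => shrink x - x.1).
Proof. by apply: continuous_subrow; [exact: shrink_continuous|exact: cfst]. Qed.

Lemma shrink_sub_direction : cohom D (pull_cochain (mkcts continuous_shrink_sub) z) (z1 *~ eps).
Proof.
have cN : continuous (fun x : Y * Y => - x.1).
  by apply: continuous_compose cfst _; exact: continuous_opp_row.
apply: (@cohom_trans _ _ _ _ (pull_cochain (mkcts cN) z)).
  apply: pull_segment => t x /andP[t0 t1] Dx.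
  have -> : (1 - t) *: (shrink x - x.1) + t *: - x.1 = - (x.1 + (- (1 - t)) *: shrink x).
    by apply/rowP => j; rewrite !mxE; ring.
  rewrite oppr_eq0; apply/negP; rewrite addr_eq0 scaleNr opprK => /eqP.
  have := shrink_lt Dx; move: (shrink x) x.1 => v u + x1E; rewrite x1E normrZ ger0_norm ?subr_ge0 // ltNge => /negP; apply.
  by rewrite ler_piMl // lerBlDr lerDl.
rewrite (_ : pull_cochain (mkcts cN) z = pull_cochain (fst_map Y Y) (pull_cochain (@antipode R n.+1) z)); last first.
  by rewrite pull_comp; exact: eq_pull.
by rewrite -pull_mulrz; apply: pull_cohom antipode_zeta => x [].
Qed.

(** The total exponent [n * (n + 1) + 1] is odd. This is the cancellation that makes the Arnold
    combination vanish on the test maps. *)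
Lemma sign_cancel : (-1) ^+ (n * n) * eps = -1 :> int.
Proof.
rewrite -exprD -signr_odd (_ : odd _ = true) // !oddD oddM /=.
by case: odd.
Qed.

Lemma eps_sqr : eps * eps = 1.
Proof. by rewrite -exprD addnn -signr_odd odd_double. Qed.

Lemma degree2_span c : cocyc (conf R 3 n.+1) c -> homogeneous_cochain (n + n) c ->
  exists x y : int, cohom (conf R 3 n.+1) c
    ((g 3 i2 i1 * g 3 i1 i0) *~ x + (g 3 i2 i1 * g 3 i2 i0) *~ y).
Proof.
move=> hc hd; have [x hx] := homogeneous_span hc hd.
(* [e] selects the factor [g 3 i2 i1]; [ia] and [ib] complete it by [g 3 i1 i0] and [g 3 i2 i0]. *)
pose e : idx 2 := ((tt, ord0), lift ord0 ord0).
pose ia : idx 3 := (e, lift ord0 ord0); pose ib : idx 3 := (e, lift ord0 (lift ord0 ord0)).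
exists (x ia), (x ib); apply: cohom_trans hx _; apply: cohom_vanish.
rewrite (bigD1 ia) /=; last by apply/eqP; rewrite /=; lia.
rewrite (bigD1 ib) /=; last by rewrite andbC; apply/andP; split=> //; apply/eqP; lia.
rewrite big1 ?addr0 => [|i].
  rewrite !liftK !unlift_none !mul1r.
  by rewrite subrr; exact: vanish0.
case: i => [[[[] j1] j2] j3] /andP[/andP[/eqP /=]].
have -> : j1 = ord0 by exact: ord1.
case: j2 => [[|[|//]] h2]; case: j3 => [[|[|[|//]]] h3] //=; rewrite ?(add0n, addn0) => dn;
  lia.
Qed.

(** The Arnold combination for [i2], [i1], [i0], with [g 3 i0 i2] replaced by [g 3 i2 i0 *~ eps]. *)
Let prod3 : cochain R 'M[R]_(3, n.+1) :=
  g 3 i2 i1 * g 3 i1 i0 + (g 3 i1 i0 * g 3 i2 i0) *~ eps + (g 3 i2 i0 * g 3 i2 i1) *~ eps.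

Let z12 : cochain R (Y * Y)%type := z1 * z2.

(** Under [t1] the two basis monomials become [z1 * z2] and [z1 * z1]; under [t2] they become
    [z1 * z1] up to sign and [z1 * z2]. As [z1 * z1] is exact, the first restriction reads off [x]
    and the second [y]; both restrictions of [prod3] are exact. *)
Lemma prod3_exact : cohom (conf R 3 n.+1) prod3 0.
Proof.
have zc a b : a != b -> cocyc (conf R 3 n.+1) (g 3 a b) by exact: gclass_cocyc.
have hg a b : homogeneous_cochain n (g 3 a b) by exact: gclass_homogeneous.
have hM a b a' b' : homogeneous_cochain (n + n) (g 3 a b * g 3 a' b') by exact: homogeneousM.
have hmul c d m : homogeneous_cochain d c -> homogeneous_cochain d (c *~ m : cochain R 'M[R]_(3, n.+1)).
  by move=> hc e s ed; rewrite cochain_mulrz hc // mul0r.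
have [x [y hxy]] : exists x y : int, cohom (conf R 3 n.+1) prod3
    ((g 3 i2 i1 * g 3 i1 i0) *~ x + (g 3 i2 i1 * g 3 i2 i0) *~ y).
  apply: degree2_span.
    by do 2?[apply: cocycD]; rewrite ?mulrzAl; do ?[apply: cocyc_mulrz]; apply: cocycM; exact: zc.
  do 2?[apply: homogeneousD]; [exact: hM|exact/hmul/hM|exact/hmul/hM].
pose t1 := test_map near_point1_continuous; pose t2 := test_map shrink_continuous.
have a21 (p0 : Y * Y -> Y) (cp0 : continuous p0) : pull_cochain (test_map cp0) (g 3 i2 i1) = z1.
  rewrite (@pull_test _ cp0 _ _ _ cfst) => [|u]; first exact: eq_pull.
  by rewrite /= subr0.
have a10 : cohom D (pull_cochain t1 (g 3 i1 i0)) z2.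
  rewrite (@pull_test _ _ _ _ _ shrink_continuous) => [|u]; first exact: shrink_direction.
  by rewrite /= /near_point1 addrAC subrr add0r.
have a20 : cohom D (pull_cochain t1 (g 3 i2 i0)) z1.
  rewrite (@pull_test _ _ _ _ _ near_point1_continuous) => [|u]; first exact: near_point1_direction.
  by rewrite /= subr0.
have b10 : cohom D (pull_cochain t2 (g 3 i1 i0)) (z1 *~ eps).
  by rewrite (@pull_test _ _ _ _ _ continuous_shrink_sub) => [|u //]; exact: shrink_sub_direction.
have b20 : cohom D (pull_cochain t2 (g 3 i2 i0)) z2.
  rewrite (@pull_test _ _ _ _ _ shrink_continuous) => [|u]; first exact: shrink_direction.
  by rewrite /= subr0.
have zt1 a b : a != b -> cocyc D (pull_cochain t1 (g 3 a b)).
  by move=> /zc; apply: pull_cocyc; exact: conf_near_point1.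
have zt2 a b : a != b -> cocyc D (pull_cochain t2 (g 3 a b)).
  by move=> /zc; apply: pull_cocyc; exact: conf_shrink.
have pullE f : pull_cochain f prod3 = pull_cochain f (g 3 i2 i1) * pull_cochain f (g 3 i1 i0) +
    (pull_cochain f (g 3 i1 i0) * pull_cochain f (g 3 i2 i0)) *~ eps +
    (pull_cochain f (g 3 i2 i0) * pull_cochain f (g 3 i2 i1)) *~ eps :> cochain R (Y * Y)%type.
  by rewrite /prod3 !pullD !pull_mulrz !pullM.
have h1 : cohom D (pull_cochain t1 prod3) 0.
  rewrite pullE a21; apply: (@cohom_trans _ _ _ _ (z12 + (z12 *~ (-1) ^+ (n * n)) *~ eps + (0 : cochain R _) *~ eps)).
    apply: cohomD; first apply: cohomD.
    - exact: cohomMl.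
    - apply: cohom_mulrz; apply: cohom_trans z_comm.
      by apply: cohomM => //; exact: zt1.
    - apply: cohom_mulrz; apply: cohom_trans z1_sqr; exact: cohomMr.
  rewrite -mulrzA sign_cancel mulrN1z subrr add0r mul0rz; exact: cohom_refl.
have h2 : cohom D (pull_cochain t2 prod3) 0.
  rewrite pullE a21; apply: (@cohom_trans _ _ _ _ ((0 : cochain R _) *~ eps + z12 *~ (eps * eps) + (z12 *~ (-1) ^+ (n * n)) *~ eps)).
    apply: cohomD; first apply: cohomD.
    - apply: (@cohom_trans _ _ _ _ ((z1 * z1) *~ eps)); last exact/cohom_mulrz/z1_sqr.
      by rewrite -mulrzAr; exact: cohomMl.
    - rewrite mulrzA; apply: cohom_mulrz; rewrite -mulrzAl.
      by apply: cohomM => //; exact: zt2.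
    - apply: cohom_mulrz; apply: cohom_trans z_comm; exact: cohomMr.
  rewrite eps_sqr mulr1z -mulrzA sign_cancel mulrN1z mul0rz add0r subrr; exact: cohom_refl.
have k1 := pull_cohom conf_near_point1 hxy; have k2 := pull_cohom conf_shrink hxy.
rewrite !pullD !pull_mulrz !pullM !a21 -!/t1 -!/t2 in k1 k2.
have x0 : x = 0.
  apply: product_mulrz_eq0; apply: cohom_trans h1.
  rewrite /prod3 !pullD !pull_mulrz !pullM !a21; apply: cohom_sym; apply: cohom_trans k1 _.
  rewrite -[X in cohom _ _ X]addr0 -[X in cohom _ _ (_ + X)](mul0rz _ y).
  apply: cohomD; apply: cohom_mulrz; first exact: cohomMl.
  by apply: cohom_trans z1_sqr; exact: cohomMl.
have y0 : y = 0.
  apply: product_mulrz_eq0; apply: cohom_trans h2.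
  rewrite /prod3 !pullD !pull_mulrz !pullM !a21; apply: cohom_sym; apply: cohom_trans k2 _.
  rewrite x0 mulr0z add0r; apply: cohom_mulrz; exact: cohomMl.
by move: hxy; rewrite x0 y0 !mulr0z addr0.
Qed.

Lemma gclass_cyc k a b c : a != b -> b != c -> c != a -> cohom (conf R k n.+1)
  (g k a b * g k b c + g k b c * g k c a + g k c a * g k a b) 0.
Proof.
move=> ab bc ca.
pose f : 'I_3 -> 'I_k := fun i => nth c [:: c; b; a] i.
have fi : injective f.
  move=> [[|[|[|//]]] ?] [[|[|[|//]]] ?] //= h; apply: val_inj => //=;
    by move: ab bc ca; rewrite /f /= in h; rewrite h ?eqxx.
have e20 : cohom (conf R 3 n.+1) (g 3 i0 i2) (g 3 i2 i0 *~ eps) by exact: gclass_sym.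
rewrite -[a]/(f i2) -[b]/(f i1) -[c]/(f i0).
rewrite -(pull_select z f i2 i1) -(pull_select z f i1 i0) -(pull_select z f i0 i2) -!pullM -!pullD -(pull0 _ (@select R n k 3 f)).
apply: (pull_cohom (A := conf R 3 n.+1)) => [x|]; first exact: conf_select.
apply: cohom_trans prod3_exact; apply: cohomD; first apply: cohomD.
- exact: cohom_refl.
- by rewrite -mulrzAr; apply: cohomMl => //; exact: gclass_cocyc.
- by rewrite -mulrzAl; apply: cohomMr => //; exact: gclass_cocyc.
Qed.

End Basis.

(** * Passage to cohomology rings of subspaces *)

Section Subspace.
Variables (R : realType) (M : topologicalType) (A : set M).
Implicit Types (c : cochain R M).

Lemma continuous_incl : continuous (fun x : A => val x).
Proof. exact: initial_continuous. Qed.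

Definition incl : continuousType A M := mkcts continuous_incl.

Lemma incl_in (x : A) : A (incl x).
Proof. exact/set_mem/valP. Qed.

Lemma corestrict_continuous d (s : simplex R M d) (sA : lands A s) :
  continuous (fun t => SigSub (mem_set (sA t)) : A).
Proof. by apply: continuous_to_set => t; exact: (@cts_fun _ _ s). Qed.

Definition corestrict d (s : simplex R M d) (sA : lands A s) : simplex R A d :=
  mkcts (@corestrict_continuous d s sA).

Lemma pull_corestrict d (s : simplex R M d) (sA : lands A s) :
  pull_simplex incl (corestrict sA) = s.
Proof. exact/continuousEP. Qed.

Lemma vanishP c : vanish A c <-> pull_cochain incl c = 0.
Proof.
split=> [h|h d s sA].
  by apply/cochainP => d s; apply: h => t; exact: incl_in.
by rewrite -(pull_corestrict sA) -[LHS]/(pull_cochain incl c d (corestrict sA)) h.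
Qed.

(** Extension by zero is a section of the restriction to [A]. Hence cochains on the subspace are the
    ambient cochains modulo [vanish A]. *)
Definition extend (c : cochain R A) : cochain R M.
Proof.
apply: (@mk_cochain _ _ (fun d s => if pselect (lands A s) is left sA then c d (corestrict sA) else 0)).
have [n cn] := cochain_boundP c; exists n => d s nd.
by case: pselect => // sA; rewrite cn.
Defined.

Lemma extendK (c : cochain R A) : pull_cochain incl (extend c) = c.
Proof.
apply/cochainP => d s; rewrite -[LHS]/(if pselect (lands A (pull_simplex incl s)) is left sA
  then c d (corestrict sA) else 0).
case: pselect => [sA|[]]; last by move=> t; exact: incl_in.
by congr (c d _); apply/continuousEP => t; exact: val_inj.
Qed.

Lemma cocycP c : cocyc A c <-> pull_cochain incl c \in cocycle R A.
Proof.
split=> [/vanishP h|/cocycleP h]; first by apply/cocycleP; rewrite pull_coboundary.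
by apply/vanishP; rewrite -pull_coboundary.
Qed.

(* The class of a cochain in the cohomology of the subspace [A]; zero when it is
   not a cocycle there. *)
Definition cls c : cohomology R A :=
  if pselect (pull_cochain incl c \in cocycle R A) is left h then coclass (Cocycles h) else 0.

Lemma clsE c (h : pull_cochain incl c \in cocycle R A) : cls c = coclass (Cocycles h).
Proof.
rewrite /cls; case: pselect => [h'|//]; congr coclass; exact: val_inj.
Qed.

Lemma cls_eq c c' : cocyc A c -> cocyc A c' -> cls c = cls c' <-> cohom A c c'.
Proof.
move=> /cocycP h /cocycP h'; rewrite !clsE; split=> [/qring_eqP[e /= he]|[e /vanishP he]].
  exists (extend e); apply/vanishP; rewrite !pullB -pull_coboundary extendK.
  by rewrite -he subrr.
apply/qring_eqP; exists (pull_cochain incl e); rewrite pull_coboundary.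
by apply/eqP; rewrite -subr_eq0; apply/eqP; rewrite -he !pullB.
Qed.

Lemma cls_surj (h : cohomology R A) : exists2 c, cocyc A c & h = cls c.
Proof.
have [zz ->] : exists zz, h = coclass zz by exists (repr h); rewrite -[LHS]reprK.
have hz : pull_cochain incl (extend (val zz)) \in cocycle R A by rewrite extendK; exact: valP.
exists (extend (val zz)); first exact/cocycP.
by rewrite clsE; congr coclass; apply: val_inj; rewrite /= extendK.
Qed.

Lemma coclass_cls (zz : cocycles R A) c : pull_cochain incl c = val zz -> coclass zz = cls c.
Proof.
move=> e; have h : pull_cochain incl c \in cocycle R A by rewrite e; exact: valP.
by rewrite (clsE h); congr coclass; apply: val_inj; rewrite /= e.
Qed.

Lemma cls1 : cls 1 = 1.
Proof.
have h : pull_cochain incl (1 : cochain R M) \in cocycle R A by rewrite pull1; exact: rpred1.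
rewrite (clsE h) -(rmorph1 (@coclass R A)); congr coclass.
by apply: val_inj; rewrite /= pull1.
Qed.

Lemma clsD c c' : cocyc A c -> cocyc A c' -> cls (c + c') = cls c + cls c'.
Proof.
move=> /cocycP h /cocycP h'; rewrite (clsE h) (clsE h') -(rmorphD (@coclass R A)).
by apply/esym/coclass_cls; rewrite pullD.
Qed.

Lemma clsN c : cocyc A c -> cls (- c) = - cls c.
Proof.
move=> /cocycP h; rewrite (clsE h) -(rmorphN (@coclass R A)).
by apply/esym/coclass_cls; rewrite pullN.
Qed.

Lemma clsM c c' : cocyc A c -> cocyc A c' -> cls (c * c') = cls c * cls c'.
Proof.
move=> /cocycP h /cocycP h'; rewrite (clsE h) (clsE h') -(rmorphM (@coclass R A)).
by apply/esym/coclass_cls; rewrite pullM.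
Qed.

Lemma cls0 : cls 0 = 0.
Proof.
rewrite -(rmorph0 (@coclass R A)); apply/esym/coclass_cls; exact: pull0.
Qed.

Lemma cls_mulrz c m : cocyc A c -> cls (c *~ m) = cls c *~ m.
Proof.
move=> hc; have nat (k : nat) : cls (c *+ k) = cls c *+ k.
  elim: k => [|k IH]; first exact: cls0.
  rewrite !mulrS clsD ?IH //; exact: (cocyc_mulrz (Posz k)).
case: m => k; first exact: nat.
rewrite NegzE !mulrNz clsN; first by congr (- _); exact: nat.
exact: (cocyc_mulrz (Posz k.+1)).
Qed.

Lemma cls_sum (I : Type) (r : seq I) (P : pred I) (F : I -> cochain R M) :
  (forall i, P i -> cocyc A (F i)) ->
  cls (\sum_(i <- r | P i) F i) = \sum_(i <- r | P i) cls (F i).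
Proof.
move=> hF; have : cocyc A (\sum_(i <- r | P i) F i) /\
    cls (\sum_(i <- r | P i) F i) = \sum_(i <- r | P i) cls (F i).
  elim: r => [|i r [h1 h2]]; first by rewrite !big_nil; split; [exact: cocyc0|exact: cls0].
  rewrite !big_cons; case: ifP => // Pi; split; first by apply: cocycD => //; exact: hF.
  by rewrite clsD ?h2 //; exact: hF.
by case.
Qed.

Lemma cls_deg d c : homogeneous_cochain d c -> cocyc A c -> cohomology_deg d (cls c).
Proof.
move=> hd /cocycP h; exists (Cocycles h); last by rewrite (clsE h).
exact: pull_homogeneous.
Qed.

End Subspace.

(** * The generator on the sphere *)

Section SphereGenerator.
Variables (R : realType) (n : nat) (n_gt0 : (0 < n)%N).
Variables (z : cochain R 'rV[R]_n.+1) (hz : is_zeta z).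
Local Notation Y := 'rV[R]_n.+1.
Local Notation S := (sphere R n.+1).

Lemma sphere_neq0 y : S y -> y != 0.
Proof.
move=> Sy; apply/eqP => y0; move: Sy; rewrite /sphere /= /enorm y0.
under eq_bigr do rewrite mxE expr0n.
by rewrite big1 // sqrtr0 => /esym/eqP; rewrite oner_eq0.
Qed.

(** [v] and its normalization are positive multiples of each other, so the segment between them
    misses the origin. *)
Lemma normalize_segment (T : topologicalType) (v : T -> Y) (v0 : forall x, v x != 0)
    (cv : forall i, continuous (fun x => v x 0 i)) (f : continuousType T Y) :
  f =1 v -> cohom setT (pull_cochain (normalize v0 cv) (pull_cochain (incl S) z)) (pull_cochain f z).
Proof.
move=> fv; rewrite pull_comp; apply: pull_segment => // t x /andP[t0 t1] _.
rewrite fv /= scalerA -scalerDl scaler_eq0 negb_or v0 andbT gt_eqF //.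
have c0 : 0 < (enorm (v x))^-1 by rewrite invr_gt0 enorm_gt0.
move: t0; rewrite le_eqVlt => /orP[/eqP <-|t0]; first by rewrite subr0 mul1r addr0.
by apply: ltr_wpDl => //; rewrite mulr_ge0 ?subr_ge0 // ltW.
Qed.

Lemma cohom_incl (M : topologicalType) (A : set M) (c c' : cochain R M) :
  cohom setT (pull_cochain (incl A) c) (pull_cochain (incl A) c') -> cohom A c c'.
Proof.
move=> [e he]; exists (extend e); apply/vanishP.
rewrite !pullB -pull_coboundary extendK; apply/cochainP => d s; exact: he.
Qed.

(** Freeness over a one-point base writes [c] as a constant plus a multiple of [z]; taking the
    component of degree [n > 0] removes the constant. *)
Lemma nz_span c : cocyc (@nz R n.+1) c -> homogeneous_cochain n c ->
  exists m : int, cohom (@nz R n.+1) c (z *~ m).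
Proof.
(* Matrices without rows form a one-point space. *)
move=> hc hd; pose P := 'M[R]_(0, 1).
have bP : int_basis (setT : set P) (fun _ : unit => 1 : cochain R P).
  by apply: (@int_basis_point R P setT (0 : P)) => // x y; apply/matrixP => -[].
have cs : continuous (fun y : Y => (0 : P, y)).
  by apply: continuous_pair; [exact: cst_continuous|move=> ?; exact: cvg_id].
pose s : continuousType Y (P * Y)%type := mkcts cs.
have hc' : cocyc (setT `*` @nz R n.+1) (pull_cochain (snd_map P Y) c) by apply: pull_cocyc hc => x [].
have [b1 [b2 [h1 h2 h]]] := free2_span (zeta_free hz openT) hc'.
have [x1 hx1] := basis_span bP h1; have [x2 hx2] := basis_span bP h2.
have su (x : unit -> int) : \sum_i (1 : cochain R P) *~ x i = 1 *~ x tt.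
  by rewrite (bigD1 tt) //= big1 ?addr0 // => -[].
rewrite su in hx1; rewrite su in hx2.
have sA y : @nz R n.+1 y -> (setT `*` @nz R n.+1) (s y) by [].
have zs : pull_cochain s (pull_cochain (snd_map P Y) z) = z by rewrite pull_comp pull_id.
have psb b x : cohom setT b (1 *~ x) ->
    cohom (@nz R n.+1) (pull_cochain s (pull_cochain (fst_map P Y) b)) (1 *~ x).
  move=> hb; rewrite pull_comp -(pull1 _ (fst_map P Y \o s : continuousType Y P)) -pull_mulrz.
  exact: pull_cohom hb.
exists (x2 tt); rewrite -(component_id hd).
have -> : z *~ x2 tt = component n (1 *~ x1 tt + z *~ x2 tt).
  rewrite (raddfD (component n)) /= !component_mulrz (component_id (zeta_homogeneous hz)).
  by rewrite (component_eq0 (@homogeneous1 R _)) ?mul0rz ?add0r // eq_sym -lt0n.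
apply: component_cohom; have := pull_cohom sA h.
rewrite pullD pullM zs pull_comp pull_id // => h3; apply: cohom_trans h3 _.
apply: cohomD; first exact: psb.
rewrite -[X in cohom _ _ (X *~ _)]mul1r -mulrzAl; apply: cohomMr; first exact: zeta_cocyc.
exact: psb.
Qed.

Let nu : continuousType (@nz R n.+1) S :=
  @normalize R (@nz R n.+1) n.+1 (fun x => val x) (fun x => set_mem (valP x)) (fun i => @continuous_val_entry R 1 n.+1 _ 0 i).

(** The facets of the fundamental cycle of the sphere are the facets of the Euclidean simplex
    followed by the radial projection [nu]. *)
Lemma sphere_evalE (c : cochain R S) :
  sphere_eval (ltn0Sn n) c = cycle_eval (extend (pull_cochain nu c)).
Proof.
rewrite /cycle_eval ldeltaE size_mkseq big_mkord; apply: eq_bigr => i _; congr (_ * _).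
have sz : size (ldel i (verts R n.+1)) = n.+1 by rewrite size_ldel size_mkseq.
rewrite (@cevE _ _ _ _ _ _ (0 : Y) n) //.
set s := _ \o _.
have sE (t : stdsimplex R n) : s t = facet_point i t.
  rewrite -[LHS]/(lin_fun (nth (0 : Y) (ldel i (verts R n.+1))) t) (facet_lin _ (ltn_ord i)).
  by congr facet_point; exact: val_inj.
have sA : lands (@nz R n.+1) s.
  by move=> t; apply: (eq_ind_r (@nz R n.+1) _ (sE t)); exact: facet_point_neq0.
rewrite -(pull_corestrict sA) -[RHS]/(pull_cochain (incl (@nz R n.+1)) (extend (pull_cochain nu c)) n (corestrict sA)).
rewrite extendK -[RHS]/(c n (pull_simplex nu (corestrict sA))); congr (c n _).
apply/continuousEP => t; apply: val_inj.
exact: (congr1 (fun y => (enorm y)^-1 *: y) (esym (sE t))).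
Qed.

Lemma sphere_sub : S `<=` @nz R n.+1.
Proof. by move=> y; exact: sphere_neq0. Qed.

Lemma zeta_sphere : cocyc S z.
Proof. exact: cocyc_sub sphere_sub (zeta_cocyc hz). Qed.

Lemma pull_nuK (c : cochain R S) : pull_cochain (incl S) (extend (pull_cochain nu c)) = c.
Proof.
have cj : continuous (fun y : S => SigSub (mem_set (sphere_sub (incl_in y))) : @nz R n.+1).
  by apply: continuous_to_set; exact: continuous_incl.
pose j : continuousType S (@nz R n.+1) := mkcts cj.
have -> : pull_cochain (incl S) (extend (pull_cochain nu c)) =
    pull_cochain j (pull_cochain (incl (@nz R n.+1)) (extend (pull_cochain nu c))).
  by rewrite [RHS]pull_comp; exact: eq_pull.
rewrite extendK pull_comp pull_id // => y; apply: val_inj => /=.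
have -> : enorm (val y) = 1 by exact: set_mem (valP y).
by rewrite invr1 scale1r.
Qed.

(** The selection by [xget] is forced: pulled back along [nu], any candidate is a multiple of [z] on
    the punctured space, and evaluation on the cycle shows that the multiple is 1. *)
Lemma std_generatorE : std_generator R (ltn0Sn n) = cls S z.
Proof.
have hz' := zeta_sphere; have /cocycP hcz := hz'.
rewrite /std_generator; set Q := [set coclass _ | _ in _].
have Qz : Q (cls S z).
  exists (Cocycles hcz); last by rewrite (clsE hcz).
  split; first exact: pull_homogeneous (zeta_homogeneous hz).
  rewrite sphere_evalE -(zeta_eval hz); apply: cycle_eval_cohom => //.
  by apply: cohom_incl; rewrite extendK; exact: normalize_segment.
apply: xget_unique => // _ [c [hd he] <-].
set ct := extend (pull_cochain nu (val c)).
have hct : cocyc (@nz R n.+1) ct.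
  by apply/vanishP; rewrite -pull_coboundary extendK pull_coboundary; have /cocycleP -> := valP c; exact: pull0.
have dct : homogeneous_cochain n ct.
  move=> e s en; rewrite -[LHS]/(if pselect _ is left sA then _ else 0).
  by case: pselect => // sA; exact: hd.
have [m hm] := nz_span hct dct.
have m1 : m = 1.
  have := cycle_eval_cohom (ltn0Sn n) hm; rewrite -sphere_evalE he.
  by rewrite cycle_eval_mulrz (zeta_eval hz) mul1r => <-.
rewrite m1 mulr1z in hm.
rewrite (coclass_cls (c := ct)); last exact: pull_nuK.
apply/cls_eq => //; first exact: cocyc_sub sphere_sub hct.
exact: cohom_sub sphere_sub hm.
Qed.

Lemma pullback_gauss k (a b : 'I_k) (ab : a != b) :
  pullback (gauss R n.+1 ab) (std_generator R (ltn0Sn n)) = cls (conf R k n.+1) (gclass z a b).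
Proof.
rewrite std_generatorE; have /cocycP hcz := zeta_sphere.
rewrite (clsE hcz) pullback_coclass.
set c := pull_cocycle _ _.
rewrite (coclass_cls (c := extend (val c))) ?extendK //.
apply/cls_eq; [|exact: gclass_cocyc|].
  by apply/vanishP; rewrite -pull_coboundary extendK; have /cocycleP -> := valP c.
apply: cohom_incl; rewrite extendK pull_comp; exact: normalize_segment.
Qed.

End SphereGenerator.

(** * The Arnold algebra *)

Section Spanning.
Variable T : pzRingType.

Definition in_span k (g : 'I_k -> 'I_k -> T) (x : T) :=
  exists n : idx k -> int, x = \sum_i mono g i *~ n i.

Section Closure.
Variables (k : nat) (g : 'I_k -> 'I_k -> T).

Lemma in_span0 : in_span g 0.
Proof. by exists (fun=> 0); rewrite big1 // => i _; rewrite mulr0z. Qed.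

Lemma in_spanD x y : in_span g x -> in_span g y -> in_span g (x + y).
Proof.
move=> [m ->] [n ->]; exists (fun i => m i + n i); rewrite -big_split.
by apply: eq_bigr => i _; rewrite mulrzDr.
Qed.

Lemma in_span_mulrz x m : in_span g x -> in_span g (x *~ m).
Proof.
move=> [n ->]; exists (fun i => n i * m); rewrite mulrz_suml.
by apply: eq_bigr => i _; rewrite mulrzA.
Qed.

Lemma in_spanN x : in_span g x -> in_span g (- x).
Proof. by move=> /(@in_span_mulrz _ (-1)); rewrite mulrN1z. Qed.

Lemma in_span_mono i : in_span g (mono g i).
Proof.
exists (fun j => (j == i)%:Z); rewrite (bigD1 i) //= eqxx mulr1z big1 ?addr0 //.
by move=> j /negPf ->; rewrite mulr0z.
Qed.

Lemma in_span_sum (I : Type) (r : seq I) (P : pred I) (F : I -> T) :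
  (forall i, P i -> in_span g (F i)) -> in_span g (\sum_(i <- r | P i) F i).
Proof. by move=> h; apply: (big_ind (in_span g)) => //; [exact: in_span0|exact: in_spanD]. Qed.

End Closure.

Lemma in_span1 k (g : 'I_k -> 'I_k -> T) : in_span g 1.
Proof.
suff [i <-] : exists i, mono g i = 1 by exact: in_span_mono.
elim: k g => [|k IH] g; first by exists tt.
have [i e] := IH (fun a b => g (lift ord0 a) (lift ord0 b)).
by exists (i, ord0); rewrite /= e unlift_none mulr1.
Qed.

Variables (s e : int).
Hypothesis ss : s * s = 1.

Record arnold_family k (g : 'I_k -> 'I_k -> T) : Prop := ArnoldFamily {
  family_sym : forall a b, a != b -> g a b = g b a *~ s;
  family_sqr : forall a b, a != b -> g a b * g a b = 0;
  family_cyc : forall a b c, a != b -> b != c -> c != a ->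
    g a b * g b c + g b c * g c a + g c a * g a b = 0;
  family_comm : forall a b c d, a != b -> c != d -> g a b * g c d = (g c d * g a b) *~ e }.

Lemma family_lift k (g : 'I_k.+1 -> 'I_k.+1 -> T) :
  arnold_family g -> arnold_family (fun a b => g (lift ord0 a) (lift ord0 b)).
Proof.
have li (a b : 'I_k) : (lift ord0 a != lift ord0 b) = (a != b) by rewrite (inj_eq lift_inj).
move=> [h1 h2 h3 h4]; split=> [a b|a b|a b c|a b c d]; rewrite -?li; [exact: h1|exact: h2|exact: h3|exact: h4].
Qed.

(* The relation rewrites a product of two generators with the same second index
   into products with distinct second indices. *)
Lemma family_exchange k (g : 'I_k -> 'I_k -> T) a b c : arnold_family g ->
  a != b -> b != c -> c != a ->
  g a c * g b c = - ((g a b * g b c) *~ (s * e) + (g a b * g a c) *~ (e * e)).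
Proof.
move=> [sym sqr cyc comm] ab bc ca; have ac : a != c by rewrite eq_sym.
have := cyc a b c ab bc ca; rewrite (sym c a) // mulrzAr mulrzAl (comm a c a b) // => h.
have -> : g a c * g b c = (g b c * g a c) *~ e by rewrite comm.
have : (g a b * g b c + g b c * g a c *~ s + g a b * g a c *~ e *~ s) *~ (s * e) = 0.
  by rewrite h mul0rz.
rewrite !mulrzDl -!mulrzA (_ : s * (s * e) = e); last by rewrite mulrA ss mul1r.
rewrite addrAC => /eqP; rewrite addr_eq0 => /eqP h'.
by rewrite h' opprK.
Qed.

(** Induction on the number of points. A product that ends with two generators into [ord0] is
    rewritten by the square or the exchange relation; a generator away from [ord0] belongs to the
    smaller family. *)
Lemma in_span_mulr k (g : 'I_k -> 'I_k -> T) x a b : arnold_family g -> a != b ->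
  in_span g x -> in_span g (x * g a b).
Proof.
elim: k g x a b => [g x []//|k IH] g x a b fam ab.
pose g' a b := g (lift ord0 a) (lift ord0 b).
have fam' : arnold_family g' by exact: family_lift.
have S1 y : in_span g' y -> in_span g y.
  move=> [n ->]; apply: in_span_sum => i _; apply: in_span_mulrz.
  have -> : mono g' i = mono g ((i, ord0) : idx k.+1) by rewrite /= unlift_none mulr1.
  exact: in_span_mono.
have Sh y j : in_span g' y -> in_span g (y * g (lift ord0 j) ord0).
  move=> [n ->]; rewrite mulr_suml; apply: in_span_sum => i _; rewrite mulrzAl; apply: in_span_mulrz.
  have -> : mono g' i * g (lift ord0 j) ord0 = mono g ((i, lift ord0 j) : idx k.+1) by rewrite /= liftK.
  exact: in_span_mono.
(* By linearity it is enough to treat [y] and [y * g (lift ord0 j) ord0] with [y] in the span of the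
   smaller family. *)
have reduce (P : T -> Prop) : P 0 -> (forall u v, P u -> P v -> P (u + v)) -> (forall u m, P u -> P (u *~ m)) ->
    (forall y, in_span g' y -> P y) -> (forall y j, in_span g' y -> P (y * g (lift ord0 j) ord0)) ->
    forall x, in_span g x -> P x.
  move=> P0 PD PZ P1 Ph _ [n ->]; apply: (big_ind P) => // -[i j] _; apply: PZ => /=.
  case: (unlift ord0 j) => [j'|]; rewrite ?mulr1; [apply: Ph|apply: P1]; exact: in_span_mono.
have main (a' : 'I_k) : forall x, in_span g x -> in_span g (x * g (lift ord0 a') ord0).
  apply: reduce => [|u v hu hv|u m hu|y hy|y j hy].
  - by rewrite mul0r; exact: in_span0.
  - by rewrite mulrDl; exact: in_spanD.
  - by rewrite mulrzAl; exact: in_span_mulrz.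
  - exact: Sh.
  - have [->|ja] := eqVneq j a'.
      have na : lift ord0 a' != ord0 :> 'I_k.+1 by rewrite eq_sym neq_lift.
      by rewrite -mulrA (family_sqr fam na) mulr0; exact: in_span0.
    have ja' : lift ord0 j != lift ord0 a' :> 'I_k.+1 by rewrite (inj_eq lift_inj).
    (* In both resulting terms the first generator avoids [ord0] and is absorbed by the induction
       hypothesis; one generator into [ord0] remains. *)
    rewrite -mulrA (family_exchange fam ja') ?neq_lift 1?eq_sym ?neq_lift //.
    rewrite mulrN mulrDr !mulrzAr !mulrA; apply: in_spanN.
    by apply: in_spanD; apply: in_span_mulrz; apply: Sh; exact: (IH g').
move: a b ab x; move=> a b; case: (unliftP ord0 a) => [a' ->|->]; case: (unliftP ord0 b) => [b' ->|->] ab.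
- apply: reduce => [|u v hu hv|u m hu|y hy|y j hy].
  + by rewrite mul0r; exact: in_span0.
  + by rewrite mulrDl; exact: in_spanD.
  + by rewrite mulrzAl; exact: in_span_mulrz.
  + by apply/S1/(IH g') => //; rewrite (inj_eq lift_inj) in ab.
  (* The generator away from [ord0] is moved left, next to [y], where the induction hypothesis
     applies. *)
  + rewrite -mulrA (family_comm fam) //.
    rewrite mulrzAr mulrA; apply: in_span_mulrz; apply: Sh; apply: (IH g') => //.
- exact: main.
- by move=> x hx; rewrite (family_sym fam ab) mulrzAr; apply: in_span_mulrz; exact: main.
- by rewrite eqxx in ab.
Qed.

End Spanning.

Section QuotientLift.
Variables (A T : pzRingType) (G : set A) (h : {rmorphism A -> T}).
Hypothesis hG : forall x, G x -> h x = 0.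

Lemma gen_ideal_kernel x : ideal_set (gen_ideal G) x -> h x = 0.
Proof.
move=> Gx; apply: (Gx [set x | h x = 0]); split; last exact: hG.
split=> /= [|u v hu hv|r u hu|r u hu]; first exact: rmorph0.
- by rewrite rmorphB /= hu hv subrr.
- by rewrite rmorphM /= hu mulr0.
- by rewrite rmorphM /= hu mul0r.
Qed.

Lemma qring_lift : exists f : {rmorphism qring (gen_ideal G) -> T},
  forall x, f (qproj (gen_ideal G) x) = h x.
Proof.
pose f (x : qring (gen_ideal G)) : T := h (repr x).
have fE x : f (qproj (gen_ideal G) x) = h x.
  apply/eqP; rewrite -subr_eq0 -rmorphB; apply/eqP/gen_ideal_kernel.
  by apply/(qring_eqP (gen_ideal G)); exact: reprK.
have surj x : exists y, x = qproj (gen_ideal G) y by exists (repr x); rewrite -[LHS]reprK.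
have fa : zmod_morphism f.
  move=> x y; have [x' ->] := surj x; have [y' ->] := surj y.
  by rewrite -(rmorphB (qproj (gen_ideal G))) !fE rmorphB.
have fm : monoid_morphism f.
  split; first by rewrite -(rmorph1 (qproj (gen_ideal G))) fE rmorph1.
  move=> x y; have [x' ->] := surj x; have [y' ->] := surj y.
  by rewrite -(rmorphM (qproj (gen_ideal G))) !fE rmorphM.
pose F : {rmorphism qring (gen_ideal G) -> T} :=
  HB.pack f (GRing.isZmodMorphism.Build _ _ f fa) (GRing.isMonoidMorphism.Build _ _ f fm).
by exists F.
Qed.

End QuotientLift.

(** * The universal property of the free associative algebra *)

Section FreeAlgebra.
Variables (I : choiceType) (T : pzRingType) (v : I -> T).
Local Notation F := (malg (fmonom I) int).

Definition word_prod (w : fmonom I) : T := \prod_(i <- (w : seq I)) v i.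

(* [mmap] requires the target to be a nontrivial ring. *)
Definition free_lift (g : F) : T := \sum_(w <- msupp g) word_prod w *~ mcoeff w g.

Lemma free_liftEw (d : finSet (fmonom I)) (g : F) :
  fsubset (msupp g) d -> free_lift g = \sum_(w <- d) word_prod w *~ mcoeff w g.
Proof.
move=> le; rewrite /free_lift (big_fset_incl _ le) // => w wd /mcoeff_outdom ->.
by rewrite mulr0z.
Qed.

Lemma free_lift_zmod_morphism : zmod_morphism free_lift.
Proof.
move=> g g'; pose d := fsetU (msupp g) (fsetU (msupp g') (msupp (g - g'))).
rewrite !(@free_liftEw d) ?fsubsetUl //.
- rewrite -sumrB; apply: eq_bigr => w _; by rewrite mcoeffB mulrzBr.
- by rewrite /d fsetUA fsetUAC fsubsetUr.
- by rewrite /d fsetUA fsubsetUr.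
Qed.
HB.instance Definition _ := GRing.isZmodMorphism.Build F T free_lift free_lift_zmod_morphism.

Lemma free_liftU c w : free_lift (mkmalgU w c) = word_prod w *~ c.
Proof.
by rewrite (@free_liftEw (fset1 w)) ?msuppU_le // big_seq_fset1 mcoeffUU.
Qed.

Lemma word_prodM w w' : word_prod (mmul w w') = word_prod w * word_prod w'.
Proof. by rewrite /word_prod fmM big_cat. Qed.

Lemma free_lift_monoid_morphism : monoid_morphism free_lift.
Proof.
split; first by rewrite [LHS]free_liftU /word_prod fm1 big_nil.
move=> g g'; rewrite malgME raddf_sum mulr_suml /=; apply: eq_bigr => w _.
rewrite raddf_sum mulr_sumr /=; apply: eq_bigr => w' _.
by rewrite free_liftU word_prodM mulrzAl mulrzAr -mulrzA mulrC.
Qed.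
HB.instance Definition _ := GRing.isMonoidMorphism.Build F T free_lift free_lift_monoid_morphism.

Lemma free_lift_var i : free_lift (mkmalgU (fmu i) 1) = v i.
Proof. by rewrite free_liftU /word_prod fmU big_seq1 mulr1z. Qed.

Lemma monalg_word (w : fmonom I) : mkmalgU w 1 = \prod_(i <- (w : seq I)) mkmalgU (fmu i) 1 :> F.
Proof.
have -> : w = FMonom w by case: w.
elim: (w : seq I) => [|i l IH] /=.
  by rewrite big_nil -fmoneE.
rewrite big_cons -IH malgME !msuppU1 !big_seq_fset1 !mcoeffUU mulr1.
by congr mkmalgU; apply/eqP; rewrite fmP fmM fmU.
Qed.

Lemma mkmalgU_mulrz (w : fmonom I) (c : int) : mkmalgU w c = mkmalgU w 1 *~ c :> F.
Proof. by rewrite -raddfMz intz. Qed.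

End FreeAlgebra.

Lemma qproj_gen (A : pzRingType) (G : set A) x : G x -> qproj (gen_ideal G) x = 0.
Proof.
move=> Gx; rewrite -(rmorph0 (qproj (gen_ideal G))); apply/qring_eqP.
by rewrite subr0; move=> I [_]; exact.
Qed.

Lemma qproj_comm (A : pzRingType) (G : set A) (x y : A) d : G (x * y - (-1) ^+ d * (y * x)) ->
  qproj (gen_ideal G) x * qproj (gen_ideal G) y =
  (qproj (gen_ideal G) y * qproj (gen_ideal G) x) *~ (-1) ^+ d.
Proof.
move=> /qproj_gen; rewrite sign_mulrz rmorphB rmorphMz /= !rmorphM /= => /eqP.
by rewrite subr_eq0 => /eqP.
Qed.

Lemma rmorph_comm (A T : pzRingType) (f : {rmorphism A -> T}) x y m :
  x * y = (y * x) *~ m -> f x * f y = (f y * f x) *~ m.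
Proof. by move=> h; rewrite -!rmorphM h rmorphMz. Qed.

Lemma free_lift_unique (I : choiceType) (T : pzRingType)
    (f : {rmorphism malg (fmonom I) int -> T}) x :
  f x = free_lift (fun i => f (mkmalgU (fmu i) 1)) x.
Proof.
rewrite [in LHS](monalgE x) raddf_sum; apply: eq_bigr => w _.
by rewrite mkmalgU_mulrz raddfMz /= monalg_word rmorph_prod.
Qed.

Section ArnoldSpan.
Variables n k : nat.
Local Notation A := (arnold_alg n.+1 k).

(** [mono] expects a function of two indices, whereas [arnold_gen] takes a proof that they differ; 0
    is the default value on the diagonal. *)
Definition total_gen (a b : 'I_k) : A :=
  if boolP (a != b) is AltTrue ab then arnold_gen n.+1 ab else 0.

Lemma total_genE a b (ab : a != b) : total_gen a b = arnold_gen n.+1 ab.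
Proof.
rewrite /total_gen; case: {-}_ / boolP => [ab'|]; last by rewrite ab.
by rewrite (bool_irrelevance ab' ab).
Qed.

Lemma free_var_deg (i : arnold_index k) : free_deg n.+1 n (free_var i).
Proof.
move=> w; rewrite mcoeffU; case: (fmu i =P w) => [<- _|_]; last by rewrite mulr0n eqxx.
by rewrite fdegU mul1n.
Qed.

Lemma total_gen_family : arnold_family ((-1) ^+ n.+1) ((-1) ^+ (n * n)) total_gen.
Proof.
split=> [a b ab|a b ab|a b c ab bc ca|a b c d ab cd].
- have ba : b != a by rewrite eq_sym.
  (* The algebra is [arnold_alg n.+1], so the relation carries the exponent [n.+2]; moving the term
     across leaves [n.+1]. *)
  have := qproj_gen (arnold_sym n.+1 ab ba); rewrite sign_mulrz raddfD raddfMz /= => /eqP.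
  rewrite -[X in X == _]/(arnold_gen n.+1 ab + arnold_gen n.+1 ba *~ (-1) ^+ n.+2).
  by rewrite !total_genE exprS mulN1r mulrNz subr_eq0 => /eqP.
- by rewrite !total_genE -rmorphM -expr2; exact: (qproj_gen (arnold_sqr n.+1 ab)).
- by have := qproj_gen (arnold_cyc n.+1 ab bc ca); rewrite !rmorphD !rmorphM !total_genE.
- have h : gc_var n.+1 ab * gc_var n.+1 cd = (gc_var n.+1 cd * gc_var n.+1 ab) *~ (-1) ^+ (n * n).
    apply: qproj_comm; exists n, n, (free_var (exist _ (a, b) ab)), (free_var (exist _ (c, d) cd)).
    by split=> //; exact: free_var_deg.
  by rewrite !total_genE; exact: (rmorph_comm (qproj (gen_ideal (@arnold_relation n.+1 k))) h).
Qed.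

(** A word is built from 1 by multiplying by one generator at a time on the right, and
    [in_span_mulr] keeps the result in the span. *)
Lemma arnold_span (x : A) : in_span total_gen x.
Proof.
pose q : {rmorphism free_alg k -> A} :=
  qproj (gen_ideal (@arnold_relation n.+1 k)) \o qproj (gen_ideal (@graded_commutators n.+1 k)).
have -> : x = q (repr (repr x)) by rewrite /= /qproj !reprK.
rewrite free_lift_unique; apply: in_span_sum => w _; apply: in_span_mulrz.
rewrite /word_prod; elim/last_ind: (w : seq _) => [|l [[a b] ab] IH].
  by rewrite big_nil; exact: in_span1.
rewrite big_rcons /= -[X in _ * X](total_genE ab).
apply: (in_span_mulr _ total_gen_family) => //.
by rewrite -signr_odd; case: (odd _).
Qed.

End ArnoldSpan.

Lemma rmorph_commutator (A T : pzRingType) (f : {rmorphism A -> T}) x y d :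
  f (x * y - (-1) ^+ d * (y * x)) = f x * f y - (f y * f x) *~ (-1) ^+ d.
Proof. by rewrite sign_mulrz raddfB raddfMz /= !rmorphM. Qed.

(** * The map to cohomology *)

Section CohomologyMap.
Variables (R : realType) (n k : nat) (z : cochain R 'rV[R]_n.+1).
Hypotheses (n_gt0 : (0 < n)%N) (hz : is_zeta z).
Local Notation C := (conf R k n.+1).
Local Notation g := (@gclass R n z k).

Definition cochain_var (i : arnold_index k) : cochain R 'M[R]_(k, n.+1) :=
  g (val i).1 (val i).2.

Definition cochain_lift : {rmorphism free_alg k -> cochain R 'M[R]_(k, n.+1)} :=
  free_lift cochain_var.

Lemma cochain_lift_cocyc x : cocyc C (cochain_lift x).
Proof.
apply: cocyc_sum => w _; apply: cocyc_mulrz.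
apply: (big_ind (cocyc C)) => [|c c'|i _]; [exact: cocyc1|exact: cocycM|].
exact: (gclass_cocyc hz (valP i)).
Qed.

Lemma cochain_lift_homogeneous d x : free_deg n.+1 d x -> homogeneous_cochain d (cochain_lift x).
Proof.
move=> xd; rewrite /cochain_lift /= /free_lift big_seq.
apply: (big_ind (homogeneous_cochain d)) => [//|c c'|w wx]; first exact: homogeneousD.
have := xd w; rewrite mcoeff_neq0 wx => /(_ isT); rewrite fdegE => <- e s ed.
rewrite cochain_mulrz; suff -> : word_prod cochain_var w e s = 0 by rewrite mul0r.
move: e s ed; rewrite -/(homogeneous_cochain _ _) /word_prod; elim: (w : seq _) => [|i l IH] /=.
  by rewrite big_nil; exact: homogeneous1.
by rewrite big_cons mulSn; apply: homogeneousM => //; exact: gclass_homogeneous.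
Qed.

(** The free algebra is mapped to cochains first: its noncommutative words make sense there, and all
    values are cocycles on [conf]. The relations hold only after passing to classes. *)
Definition class_lift (x : free_alg k) : cohomology R C := cls C (cochain_lift x).

Lemma class_lift_zmod_morphism : zmod_morphism class_lift.
Proof.
move=> x y; rewrite /class_lift raddfB clsD; last 2 first.
- exact: cochain_lift_cocyc.
- by apply: cocycN; exact: cochain_lift_cocyc.
by rewrite clsN //; exact: cochain_lift_cocyc.
Qed.
HB.instance Definition _ := GRing.isZmodMorphism.Build (free_alg k) (cohomology R C) class_lift
  class_lift_zmod_morphism.

Lemma class_lift_monoid_morphism : monoid_morphism class_lift.
Proof.
split; first by rewrite /class_lift rmorph1 cls1.
by move=> x y; rewrite /class_lift rmorphM clsM //; exact: cochain_lift_cocyc.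
Qed.
HB.instance Definition _ := GRing.isMonoidMorphism.Build (free_alg k) (cohomology R C) class_lift
  class_lift_monoid_morphism.

Lemma class_lift_var a b (ab : a != b) : class_lift (free_var (exist _ (a, b) ab)) = cls C (g a b).
Proof. by congr cls; exact: free_lift_var. Qed.

Lemma class_lift_commutator x : graded_commutators n.+1 x -> class_lift x = 0.
Proof.
move=> [p [q [u [v [up vq ->]]]]].
rewrite rmorph_commutator /= /class_lift.
have [cu cv] := (cochain_lift_cocyc u, cochain_lift_cocyc v).
rewrite -!clsM // -cls_mulrz; last exact: cocycM.
apply/eqP; rewrite subr_eq0; apply/eqP/cls_eq; [exact: cocycM|apply: cocyc_mulrz; exact: cocycM|].
rewrite -sign_mulrz; apply: cohom_cupC => //; exact: cochain_lift_homogeneous.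
Qed.

Lemma cohomology_map : exists f : {rmorphism arnold_alg n.+1 k -> cohomology R C},
  forall x, f (qproj _ (qproj _ x)) = class_lift x.
Proof.
have [f1 f1E] := qring_lift class_lift_commutator.
have f1_var a b (ab : a != b) : f1 (gc_var n.+1 ab) = cls C (g a b).
  by rewrite -class_lift_var -f1E.
have cg a b : a != b -> cocyc C (g a b) by exact: gclass_cocyc.
have [|f fE] := @qring_lift _ _ (@arnold_relation n.+1 k) f1.
  move=> x [a b ab ba|a b ab|a b c ab bc ca].
  - rewrite sign_mulrz rmorphD rmorphMz !f1_var exprS mulN1r mulrNz -(cls_mulrz _ (cg _ _ ba)).
    apply/eqP; rewrite subr_eq0; apply/eqP/cls_eq; [exact: cg|exact/cocyc_mulrz/cg|].
    exact: gclass_sym.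
  - rewrite rmorphXn f1_var expr2 -(clsM (cg _ _ ab) (cg _ _ ab)) -cls0; apply/cls_eq; [apply: cocycM; exact: cg|exact: cocyc0|].
    exact: gclass_sqr.
  - rewrite !rmorphD !rmorphM !f1_var.
    have [c1 c2 c3] := And3 (cg _ _ ab) (cg _ _ bc) (cg _ _ ca).
    have [c12 c23 c31] := And3 (cocycM c1 c2) (cocycM c2 c3) (cocycM c3 c1).
    rewrite -(clsM c1 c2) -(clsM c2 c3) -(clsM c3 c1) -(clsD c12 c23) -(clsD (cocycD c12 c23) c31) -cls0.
    apply/(cls_eq (cocycD (cocycD c12 c23) c31)); [exact: cocyc0|exact: gclass_cyc].
by exists f => x; rewrite fE f1E.
Qed.

End CohomologyMap.

Theorem theorem3p2p4 (R : realType) (n k : nat) (hn : (1 < n)%N) :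
  exists f : {rmorphism arnold_alg n k -> cohomology R (conf R k n)},
    [/\ forall (a b : 'I_k) (ab : a != b),
          f (arnold_gen n ab) =
            pullback (gauss R n ab) (std_generator R (ltnW hn)),
        forall (d : nat) (x : arnold_alg n k),
          arnold_deg d x -> cohomology_deg d (f x)
      & bijective f].
Proof.
case: n hn => [//|n] hn; have n_gt0 : (0 < n)%N by [].
rewrite (bool_irrelevance (ltnW hn) (ltn0Sn n)).
have [z hz] := zeta_exists R n.
have [f fE] := cohomology_map k n_gt0 hz.
have f_gen a b (ab : a != b) : f (arnold_gen n.+1 ab) = cls (conf R k n.+1) (gclass z a b).
  by rewrite -class_lift_var -fE.
exists f; split=> [a b ab|d _ [x xd <-]|].
- by rewrite f_gen; exact/esym/pullback_gauss.
- rewrite fE; apply: cls_deg; first exact: cochain_lift_homogeneous.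
  exact: cochain_lift_cocyc.
have bas := conf_basis hz k.
have f_mono i : f (mono (@total_gen n k) i) = cls _ (mono (gclass z (k := k)) i).
  pose v a b : free_alg k := if boolP (a != b) is AltTrue ab then free_var (exist _ (a, b) ab) else 0.
  have vE a b (ab : a != b) : v a b = free_var (exist _ (a, b) ab).
    rewrite /v; case: {-}_ / boolP => [ab'|]; last by rewrite ab.
    by rewrite (bool_irrelevance ab' ab).
  pose q : {rmorphism free_alg k -> arnold_alg n.+1 k} :=
    qproj (gen_ideal (@arnold_relation n.+1 k)) \o qproj (gen_ideal (@graded_commutators n.+1 k)).
  (* [f] is known on images of the free algebra, so the monomial is lifted there before it is
     evaluated. *)
  have -> : mono (@total_gen n k) i = q (mono v i).
    rewrite (mono_morph v i (rmorph1 q) (rmorphM q)).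
    by apply: eq_mono => a b ab; rewrite vE total_genE.
  rewrite fE; congr cls; rewrite (mono_morph v i (rmorph1 _) (rmorphM _)).
  by apply: eq_mono => a b ab; rewrite vE; exact: free_lift_var.
have f_sum x : f (\sum_i mono (@total_gen n k) i *~ x i) =
    cls _ (\sum_i mono (gclass z (k := k)) i *~ x i).
  rewrite raddf_sum cls_sum; last by move=> i _; apply/cocyc_mulrz/basis_cocyc.
  apply: eq_bigr => i _; rewrite raddfMz /= f_mono cls_mulrz //; exact: basis_cocyc.
(* An element of the kernel is a combination of monomials, which are mapped to independent classes;
   so its coefficients vanish. The monomials are thereby a basis of the algebra as well. *)
have f_inj : injective f.
  apply: raddf_inj => x fx; have [m xm] := arnold_span x.
  suff m0 i : m i = 0 by rewrite xm big1 // => i _; rewrite m0 mulr0z.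
  apply: (basis_indep bas); move: (esym (f_sum m)); rewrite -[X in _ = X](congr1 f xm) fx -cls0.
  move=> /cls_eq; apply; last exact: cocyc0.
  by apply: cocyc_sum => j _; apply/cocyc_mulrz/basis_cocyc.
have f_surj h : exists x, f x = h.
  have [c cc ->] := cls_surj h; have [m cm] := basis_span bas cc.
  exists (\sum_i mono (@total_gen n k) i *~ m i); rewrite f_sum; apply/esym/cls_eq => //.
  by apply: cocyc_sum => j _; apply/cocyc_mulrz/basis_cocyc.
have [f' fK] := choice f_surj.
by exists f' => // x; apply: f_inj; rewrite fK.
Qed.
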